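(* Let $n\ge1$, $i\ge0$ and $k\ge0$ be integers, let $Y$ be a separable Banach space, let $T\in\mathscr D'(\mathbf R^n,Y)$, and let $A$ be the set of points $a\in\mathbf R^n$ at which $T$ is $\boldsymbol\nu_{\mathbf B(0,1)}^i$ pointwise differentiable of order $(k-1,1)$ and $\operatorname{pt}\mathrm D^mT(a)=0$ for $m=0,\dots,k-1$. Then $\mathscr L^n$ almost all $a\in A$ satisfy the following three statements: (1) The distribution $T$ is pointwise differentiable of order $k$ at $a$. (2) If $k>0$ or $Y^\ast$ is separable, then $T$ is $\boldsymbol\nu_{\mathbf B(0,1)}^i$ pointwise differentiable of order $k$ at $a$. (3) If $k>0$, then $\operatorname{pt}\mathrm D^kT(a)=0$.
   Context: All vector spaces are real. $Y^\ast$ is the Banach space of continuous linear functionals on $Y$ (separability in the norm topology), and $\langle y,\upsilon\rangle=\upsilon(y)$ (also applied pointwise to functions). $\mathscr L^n$ is Lebesgue measure; $\mathbf B(a,r)$ is the closed ball. $\mathscr D(\mathbf R^n,Y)$ is the space of compactly supported $C^\infty$ functions $\mathbf R^n\to Y$ with its usual locally convex (inductive limit) topology, $\mathscr D'(\mathbf R^n,Y)$ is the space of continuous linear maps $T:\mathscr D(\mathbf R^n,Y)\to\mathbf R$, and $\mathscr D_K(\mathbf R^n,Y)=\{\phi\in\mathscr D(\mathbf R^n,Y):\operatorname{spt}\phi\subset K\}$. One writes $T_x(\phi(x))$ for $T(\phi)$. Derivatives $\mathrm D^mf(a)$ are symmetric $m$-linear maps on $(\mathbf R^n)^m$ with norm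 $\|\psi\|=\sup\{|\psi(v_1,\dots,v_m)|:|v_j|\le1\}$. For compact $K$, $\boldsymbol\nu_K^i(\phi)=\sup\{\|\mathrm D^m\phi(x)\|:x\in K,\ m=0,\dots,i\}$. A polynomial function of degree at most $-1$ is the zero function. Definitions. Let $a\in\mathbf R^n$, let $P$ denote a polynomial function $\mathbf R^n\to Y^\ast$ and put $S(\phi)=\int\langle\phi,P\rangle\,d\mathscr L^n$ for $\phi\in\mathscr D(\mathbf R^n,Y)$. Let $\nu$ be a seminorm whose restriction to $\mathscr D_{\mathbf B(0,1)}(\mathbf R^n,Y)$ is a norm. - For an integer $l\ge-1$: $T$ is pointwise differentiable of order $l$ at $a$ iff for some $P$ of degree at most $l$, $\lim_{r\to0+}r^{-l-n}(T-S)_x(\phi(r^{-1}(x-a)))=0$ for all $\phi\in\mathscr D(\mathbf R^n,Y)$. Such $P$ is unique, and $\operatorname{pt}\mathrm D^lT(a)=\mathrm D^lP(a)$ if $l\ge0$. - For an integer $l\ge0$: $T$ is $\nu$ pointwise differentiable of order $l$ at $a$ iff for some $P$ of degree at most $l$, $\lim_{r\to0+}\sup\{r^{-l-n}(T-S)_x(\phi(r^{-1}(x-a))):\phi\in\mathscr D_{\mathbf B(0,1)}(\mathbf R^n,Y),\ \nu(\phi)\le1\}=0$. - For an integer $l$ and $0<\alpha\le1$ with $l+\alpha\ge0$: $T$ is $\nu$ pointwise differentiable of order $(l,\alpha)$ at $a$ iff for some $P$ of degree at most $l$, $\limsup_{r\to0+}\sup\{r^{-l-\alpha-n}(T-S)_x(\phi(r^{-1}(x-a))):\phi\in\mathscr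 D_{\mathbf B(0,1)}(\mathbf R^n,Y),\ \nu(\phi)\le1\}<\infty$. If $T$ is $\boldsymbol\nu_{\mathbf B(0,1)}^i$ pointwise differentiable of order $(k-1,1)$ at $a$ with polynomial $P$, then $T$ is pointwise differentiable of every order $m=0,\dots,k-1$ at $a$ with $\operatorname{pt}\mathrm D^mT(a)=\mathrm D^mP(a)$. For $k=0$ the vanishing condition is void. *)

(* Defs.v *)
From HB Require Import structures.
From mathcomp Require Import all_boot all_order all_algebra.
From mathcomp Require Import all_classical all_reals all_analysis.
Set Implicit Arguments.
Unset Strict Implicit.
Unset Printing Implicit Defensive.
Import Order.TTheory GRing.Theory Num.Theory.
Import numFieldNormedType.Exports.
Local Open Scope classical_set_scope.
Local Open Scope ring_scope.

(* 'rV[R]_n carries the sigma-algebra generated by the coordinates, i.e. the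
   Borel sets, as n.-tuple R does. *)
Section measurable_rV.
Context {R : realType}.
Variable n : nat.

Let coor : 'I_n -> 'rV[R]_n -> measurableTypeR R := fun i x => x 0 i.

Let rV_set0 : g_sigma_preimage coor set0.
Proof. exact: sigma_algebra0. Qed.

Let rV_setC A : g_sigma_preimage coor A -> g_sigma_preimage coor (~` A).
Proof. exact: sigma_algebraC. Qed.

Let rV_bigcup (F : _^nat) : (forall i, g_sigma_preimage coor (F i)) ->
  g_sigma_preimage coor (\bigcup_i F i).
Proof. exact: sigma_algebra_bigcup. Qed.

HB.instance Definition _ := @isMeasurable.Build default_measure_display
  'rV[R]_n (g_sigma_preimage coor) rV_set0 rV_setC rV_bigcup.

Lemma measurable_coor (i : 'I_n) :
  measurable_fun [set: 'rV[R]_n] (fun x => x 0 i : measurableTypeR R).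
Proof.
move=> _ B mB; rewrite setTI; apply: sub_sigma_algebra => /=.
rewrite -bigcup_seq/=; exists i => /=; first by rewrite mem_index_enum.
by exists B => //; rewrite setTI.
Qed.

Lemma measurable_fun_rV d (T : measurableType d) (f : T -> 'rV[R]_n) :
  (forall i, measurable_fun [set: T] (fun t => f t 0 i : measurableTypeR R)) ->
  measurable_fun [set: T] f.
Proof.
move=> mf _ B; rewrite setTI => mB.
suff : g_sigma_preimage coor `<=` [set B | measurable (f @^-1` B)] by exact.
apply: smallest_sub.
  split => [|A/= mA|F/= mF]; first by rewrite /= preimage_set0.
    rewrite setTD preimage_setC; exact: measurableC.
  by rewrite preimage_bigcup; exact: bigcup_measurable.
rewrite -bigcup_seq/= => A [i _ [C mC <-]].
rewrite setTI/= -comp_preimage -[X in measurable X]setTI; exact: mf.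
Qed.

End measurable_rV.

Section lebesgue_rV.
Context {R : realType}.

Definition rV_cons n (p : measurableTypeR R * 'rV[R]_n) : 'rV[R]_n.+1 :=
  \row_i (if unlift 0 i is Some j then p.2 0 j else p.1).

Definition rV_uncons n (x : 'rV[R]_n.+1) : measurableTypeR R * 'rV[R]_n :=
  (x 0 0, \row_i x 0 (lift 0 i)).

Lemma rV_consK n : cancel (@rV_cons n) (@rV_uncons n).
Proof.
move=> [t v]; rewrite /rV_cons /rV_uncons/=; congr pair.
  by rewrite mxE unlift_none.
by apply/rowP => i; rewrite mxE mxE liftK.
Qed.

Lemma measurable_rV_cons n : measurable_fun [set: _] (@rV_cons n).
Proof.
apply: measurable_fun_rV => i.
case: (unliftP 0 i) => [j|] ->.
  rewrite (_ : (fun _ => _) =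
    (fun v : 'rV[R]_n => v 0 j : measurableTypeR R) \o snd).
    by apply: measurableT_comp => //; exact: measurable_coor.
  by apply/funext => -[t v]/=; rewrite mxE liftK.
rewrite (_ : (fun _ => _) = fst)//.
by apply/funext => -[t v]/=; rewrite mxE unlift_none.
Qed.

Lemma measurable_rV_uncons n : measurable_fun [set: _] (@rV_uncons n).
Proof.
apply: measurable_fun_pair; first exact: measurable_coor.
apply: measurable_fun_rV => i.
rewrite (_ : (fun _ => _) = fun x : 'rV[R]_n.+1 => x 0 (lift 0 i)).
  exact: measurable_coor.
by apply/funext => x; rewrite mxE.
Qed.

Section step.
Variables (n : nat) (mu : {sigma_finite_measure set 'rV[R]_n -> \bar R}).

Definition lebesgue_rV_step :=
  pushforward ((@lebesgue_measure R) \x mu)%E (@rV_cons n).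

HB.instance Definition _ := isMeasurableFun.Build _ _ _ _
  (@rV_cons n) (@measurable_rV_cons n).

Let step0 : lebesgue_rV_step set0 = 0%E.
Proof. exact: measure0. Qed.

Let step_ge0 A : (0 <= lebesgue_rV_step A)%E.
Proof. exact: measure_ge0. Qed.

Let step_sigma_additive : semi_sigma_additive lebesgue_rV_step.
Proof. exact: measure_semi_sigma_additive. Qed.

HB.instance Definition _ := isMeasure.Build _ _ _ lebesgue_rV_step
  step0 step_ge0 step_sigma_additive.

Let step_sigma_finite : sigma_finite [set: 'rV[R]_n.+1] lebesgue_rV_step.
Proof.
have /sigma_finiteP[F [TF ndF Foo]] := sigma_finiteT (@lebesgue_measure R).
have /sigma_finiteP[G [TG ndG Goo]] := sigma_finiteT mu.
exists (fun k => @rV_uncons n @^-1` (F k `*` G k)).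
  apply/esym; rewrite -subTset => x _.
  have [i _ Fx] : (\bigcup_k F k) (@rV_uncons n x).1 by rewrite -TF.
  have [j _ Gx] : (\bigcup_k G k) (@rV_uncons n x).2 by rewrite -TG.
  exists (maxn i j) => //; split.
    by move: Fx; exact/subsetPset/ndF/leq_maxl.
  by move: Gx; exact/subsetPset/ndG/leq_maxr.
move=> k; have [mF Fk] := Foo k; have [mG Gk] := Goo k; split.
  rewrite -[X in measurable X]setTI; apply: measurable_rV_uncons => //.
  exact: measurableX.
rewrite /lebesgue_rV_step /pushforward -comp_preimage.
rewrite (_ : _ \o _ = id); last by apply/funext => x /=; exact: rV_consK.
by rewrite preimage_id product_measure1E// lte_mul_pinfty// ge0_fin_numE.
Qed.

HB.instance Definition _ := Measure_isSigmaFinite.Build _ _ _ lebesgue_rV_step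
  step_sigma_finite.

End step.

(* The n-fold product of the Lebesgue measure of R; lebesgue_rV_box below gives
   its value on boxes. *)
Fixpoint lebesgue_rV n : {sigma_finite_measure set 'rV[R]_n -> \bar R} :=
  if n is m.+1 then lebesgue_rV_step (lebesgue_rV m) else \d_(0 : 'rV[R]_0).

Lemma lebesgue_rV_box n (a b : 'rV[R]_n) : (forall i, a 0 i <= b 0 i) ->
  lebesgue_rV n [set x | forall i, a 0 i <= x 0 i <= b 0 i] =
  (\prod_i (b 0 i - a 0 i))%:E.
Proof.
elim: n a b => [|n IH] a b ab.
  by rewrite big_ord0 /= diracE mem_set// => -[].
pose tl (x : 'rV[R]_n.+1) : 'rV[R]_n := \row_i x 0 (lift 0 i).
have mbox : measurable
    [set x : 'rV[R]_n | forall i, tl a 0 i <= x 0 i <= tl b 0 i].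
  rewrite [X in measurable X](_ : _ = \bigcap_(i in [set: 'I_n])
      ((fun x : 'rV[R]_n => x 0 i : measurableTypeR R) @^-1`
        `[tl a 0 i, tl b 0 i])).
    apply: fin_bigcap_measurable => // i _; rewrite -[X in measurable X]setTI.
    by apply: measurable_coor => //; exact: measurable_itv.
  apply/seteqP; split => x /= xab i => [_|]; first by rewrite /= in_itv/=.
  by have := xab i I; rewrite /= in_itv/=.
rewrite /= /lebesgue_rV_step /pushforward.
rewrite [X in (_ \x _)%E X](_ : _ = `[a 0 0, b 0 0]%classic `*`
    [set x : 'rV[R]_n | forall i, tl a 0 i <= x 0 i <= tl b 0 i]); last first.
  apply/seteqP; split => -[t v]/=.
    move=> H; split; first by have := H 0; rewrite mxE unlift_none/= in_itv.
    by move=> i; have := H (lift 0 i); rewrite !mxE liftK.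
  rewrite in_itv/= => -[tab vab] i; rewrite mxE.
  by case: (unliftP 0 i) => [j|] ->//=; have := vab j; rewrite !mxE.
rewrite product_measure1E//= IH; last by move=> i; rewrite !mxE.
rewrite lebesgue_measure_itv/= lte_fin big_ord_recl EFinM.
under eq_bigr do rewrite !mxE.
by have := ab 0; rewrite le_eqVlt => /orP[/eqP->|->]; rewrite ?ltxx ?subrr.
Qed.

End lebesgue_rV.
(* The dual Banach space: continuous linear functionals with the operator norm
   dual_norm, whose topology is the one inherited through Lmodule_isNormed. *)
Section dual.
Context {R : realType}.
Variable Y : normedModType R.

Definition cont_linear : {pred Y -> R^o} :=
  mem [set f : Y -> R^o | linear f /\ continuous f].

Record dual := Dual {
  dual_fun :> Y -> R^o ;
  dual_funP : dual_fun \in cont_linear }.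

HB.instance Definition _ := [isSub for dual_fun].
HB.instance Definition _ := [Choice of dual by <:].

Lemma cont_linear_submod_closed : submod_closed cont_linear.
Proof.
split.
  rewrite inE; split => [a x y|]; first by rewrite scaler0 addr0.
  exact: cst_continuous.
move=> a f g /set_mem[lf cf] /set_mem[lg cg]; rewrite inE; split.
  move=> b x y; rewrite /= !fctE/= lf lg !scalerDr addrACA; congr (_ + _).
  by rewrite !scalerA mulrC.
by move=> x; apply: cvgD; [apply: cvgZl_tmp; exact: cf|exact: cg].
Qed.

HB.instance Definition _ := GRing.isSubmodClosed.Build _ _ cont_linear
  cont_linear_submod_closed.
HB.instance Definition _ := [SubChoice_isSubLmodule of dual by <:].

Let dual_linear (f : dual) : linear f.
Proof. by have /set_mem[] := dual_funP f. Qed.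

HB.instance Definition _ (f : dual) :=
  GRing.isLinear.Build R Y R^o _ (f : Y -> R^o) (@dual_linear f).

Definition dual_norm (f : dual) : R :=
  sup [set `|f y| | y in [set y | `|y| <= 1]].

Let has_sup_dual_norm (f : dual) :
  has_sup [set `|f y| | y in [set y | `|y| <= 1]].
Proof.
split; first by exists `|f 0|, 0 => //=; rewrite normr0.
have /set_mem[_ /linear_bounded_continuous/linear_boundedP] := dual_funP f.
move=> /pinfty_ex_gt0[r r0 fr]; exists r => _ [y /= y1 <-].
by rewrite (le_trans (fr y))// ler_piMr// ltW.
Qed.

Lemma dual_normP (f : dual) y : `|f y| <= dual_norm f * `|y|.
Proof.
have [->|y0] := eqVneq y 0; first by rewrite linear0 !normr0 mulr0.
rewrite -ler_pdivrMr ?normr_gt0//; apply: (ub_le_sup (has_sup_dual_norm f).2).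
exists (`|y|^-1 *: y).
  by rewrite /= normrZ normfV normr_id mulVf ?normr_eq0.
by rewrite linearZ/= normrZ normfV normr_id mulrC.
Qed.

Let dual_normD f g : dual_norm (f + g) <= dual_norm f + dual_norm g.
Proof.
apply: ge_sup => [|_ [y /= y1 <-]]; first exact: (has_sup_dual_norm (f + g)).1.
rewrite (le_trans (ler_normD _ _))//; apply: lerD;
  by apply: (ub_le_sup (has_sup_dual_norm _).2); exists y.
Qed.

Let dual_normZ_le (l : R) f : dual_norm (l *: f) <= `|l| * dual_norm f.
Proof.
apply: ge_sup => [|_ [y /= y1 <-]]; first exact: (has_sup_dual_norm (l *: f)).1.
rewrite normrZ ler_wpM2l//; apply: (ub_le_sup (has_sup_dual_norm _).2).
by exists y.
Qed.

Let dual_normZ (l : R) f : dual_norm (l *: f) = `|l| * dual_norm f.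
Proof.
apply/eqP; rewrite eq_le dual_normZ_le/=.
have [->|l0] := eqVneq l 0.
  rewrite normr0 mul0r; apply: le_trans (ub_le_sup (has_sup_dual_norm _).2 _).
    exact: (normr_ge0 ((0 *: f : dual) 0)).
  by exists 0 => //=; rewrite normr0.
rewrite -ler_pdivlMl ?normr_gt0// -normfV.
by rewrite -[in leLHS](scalerK l0 f); exact: dual_normZ_le.
Qed.

Let dual_norm_eq0 f : dual_norm f = 0 -> f = 0.
Proof.
move=> f0; apply/val_inj/funext => y /=.
by apply/eqP; rewrite -normr_le0 -(mul0r `|y|) -f0; exact: dual_normP.
Qed.

HB.instance Definition _ := Lmodule_isNormed.Build R dual
  dual_normD dual_normZ dual_norm_eq0.

End dual.

Definition separable_space (X : topologicalType) : Prop :=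
  exists2 D : set X, countable D & dense D.

Section calculus.
Context {R : realType} {V W : normedModType R}.

Definition iter_derive (f : V -> W) (vs : seq V) : V -> W :=
  foldr (fun v g => 'D_v g) f vs.

(* D^m f(a) as a function of (v_1, ..., v_m): the iterated directional
   derivative D_(v_1) ... D_(v_m) f (a). *)
Definition derive_mlin m (f : V -> W) (a : V) : m.-tuple V -> W :=
  fun vs => iter_derive f vs a.

(* C^oo on the whole space. Each 'D_v g appears only after g has been required
   to be differentiable everywhere, so that no default value of 'D_v is used. *)
Definition smooth (f : V -> W) : Prop :=
  forall vs x, differentiable (iter_derive f vs) x.

Lemma iter_derive0 vs : iter_derive (cst 0) vs = cst 0.
Proof.
elim: vs => //= v vs ->; apply/funext => x; exact: derive_cst.
Qed.

Lemma iter_deriveZD a f g : smooth f -> smooth g -> forall vs,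
  iter_derive (a *: f + g) vs = a *: iter_derive f vs + iter_derive g vs.
Proof.
move=> sf sg; elim=> //= v vs ->; apply/funext => x.
have df := @diff_derivable _ _ _ _ x v (sf vs x).
have dg := @diff_derivable _ _ _ _ x v (sg vs x).
by rewrite !fctE/= -deriveZ// -deriveD//; exact: derivableZ.
Qed.

Lemma smooth0 : smooth (cst 0).
Proof. by move=> vs x; rewrite iter_derive0. Qed.

Lemma smoothZD a f g : smooth f -> smooth g -> smooth (a *: f + g).
Proof.
move=> sf sg vs x; rewrite iter_deriveZD//.
by apply: differentiableD => //; exact: differentiableZ.
Qed.

Let is_diff_affine c b x : is_diff x (fun x : V => c *: (x - b)) ( *:%R c).
Proof.
apply: (@is_diff_eq _ _ _ ( *:%R c \o (id - cst b)) ( *:%R c \o (id - 0))).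
by apply/funext => y /=; rewrite !fctE subr0.
Qed.

Lemma iter_derive_affine c b f : smooth f -> forall vs,
  iter_derive (fun x => f (c *: (x - b))) vs =
  (fun x => iter_derive f [seq c *: v | v <- vs] (c *: (x - b))).
Proof.
move=> sf; elim=> //= v vs ->; apply/funext => x.
have df := sf [seq c *: v | v <- vs] (c *: (x - b)).
rewrite [RHS]deriveE// deriveE; last first.
  exact: (@differentiable_comp _ _ _ _ (fun x => c *: (x - b))).
rewrite (@diff_comp _ _ _ _ (fun x => c *: (x - b)))//=.
by rewrite (@diff_val _ _ _ _ _ _ _ (is_diff_affine c b x)).
Qed.

Lemma smooth_affine c b f : smooth f -> smooth (fun x => f (c *: (x - b))).
Proof.
move=> sf vs x; rewrite iter_derive_affine//.
exact: (@differentiable_comp _ _ _ _ (fun x => c *: (x - b))).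
Qed.

End calculus.

Section test_functions.
Context {R : realType}.
Variables (n : nat) (Y : normedModType R).
Implicit Types f : 'rV[R]_n -> Y.

Definition spt f : set 'rV[R]_n := closure [set x | f x != 0].

Definition test_function : {pred 'rV[R]_n -> Y} :=
  mem [set f : 'rV[R]_n -> Y | smooth f /\ compact (spt f)].

Record testfun := Testfun {
  testfun_fun :> 'rV[R]_n -> Y ;
  testfunP : testfun_fun \in test_function }.

HB.instance Definition _ := [isSub for testfun_fun].
HB.instance Definition _ := [Choice of testfun by <:].

Lemma test_function_submod_closed : submod_closed test_function.
Proof.
split.
  rewrite inE; split; first exact: smooth0.
  rewrite /spt (_ : [set _ | _] = set0) ?closure0; first exact: compact0.
  by apply/seteqP; split => x //=; rewrite eqxx.
move=> a f g /set_mem[sf cf] /set_mem[sg cg]; rewrite inE; split.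
  exact: smoothZD.
apply: (@subclosed_compact _ _ (spt f `|` spt g)); first exact: closed_closure.
  exact: compactU.
rewrite /spt -closureU; apply: closureS => x /=; rewrite !fctE => fgx.
have [fx0|] := eqVneq (f x) 0; last by left.
by right; move: fgx; rewrite fx0 scaler0 add0r.
Qed.

HB.instance Definition _ := GRing.isSubmodClosed.Build _ _ test_function
  test_function_submod_closed.
HB.instance Definition _ := [SubChoice_isSubLmodule of testfun by <:].

Definition testfun_in (K : set 'rV[R]_n) : set testfun :=
  [set phi | spt phi `<=` K].

(* The canonical norm of 'rV[R]_n is the sup norm, which gives the right
   topology; the balls and unit vectors below are Euclidean. *)
Definition enorm (x : 'rV[R]_n) : R := Num.sqrt (\sum_i x 0 i ^+ 2).

Definition eball (a : 'rV[R]_n) (r : R) : set 'rV[R]_n :=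
  [set x | enorm (x - a) <= r].

(* Both suprema below are taken over nonempty bounded sets when phi is a test
   function and K is compact and nonempty; sup set0 = 0 when K is empty. *)
Definition mlin_norm m (psi : m.-tuple 'rV[R]_n -> Y) : R :=
  sup [set `|psi vs| | vs in [set vs | forall j, enorm (tnth vs j) <= 1]].

Definition nu_seminorm (K : set 'rV[R]_n) (i : nat) (phi : testfun) : R :=
  sup [set mlin_norm (derive_mlin (m := m) phi x) | m in `I_i.+1 & x in K].

(* Base of neighbourhoods of 0 of the locally convex inductive limit of the
   spaces testfun_in K: the absolutely convex sets whose trace on each
   testfun_in K is a neighbourhood of 0 for the topology generated by the
   seminorms nu_seminorm K j, for all j. *)
Definition testfun_nbhs0 (U : set testfun) : Prop :=
  (forall phi psi (s t : R), U phi -> U psi -> `|s| + `|t| <= 1 ->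
    U (s *: phi + t *: psi)) /\
  (forall K, compact K -> exists i, exists2 e : R, 0 < e &
    testfun_in K `&` [set phi | forall j, (j <= i)%N -> nu_seminorm K j phi < e]
      `<=` U).

Definition testfun_open (W : set testfun) : Prop :=
  forall phi, W phi -> exists2 U, testfun_nbhs0 U &
    [set phi + psi | psi in U] `<=` W.

Let testfun_openT : testfun_open setT.
Proof.
move=> phi _; exists setT => //; split => // K _; exists 0%N; by exists 1.
Qed.

Let testfun_openI : setI_closed testfun_open.
Proof.
move=> W1 W2 o1 o2 phi [/o1[U1 [a1 n1] s1] /o2[U2 [a2 n2] s2]].
exists (U1 `&` U2); last first.
  by move=> _ [psi [U1p U2p] <-]; split; [apply: s1|apply: s2]; exists psi.
split.
  by move=> f g s t [? ?] [? ?] st; split; [exact: a1|exact: a2].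
move=> K cK.
have [i1 [e1 e1gt0 K1]] := n1 K cK; have [i2 [e2 e2gt0 K2]] := n2 K cK.
exists (maxn i1 i2); exists (Num.min e1 e2); first by rewrite lt_min e1gt0.
move=> phi' [Kphi phie]; split; [apply: K1|apply: K2]; split=> // j ji.
  by have := phie j; rewrite lt_min leq_max ji => /(_ isT)/andP[].
by have := phie j; rewrite lt_min leq_max ji orbT => /(_ isT)/andP[].
Qed.

Let testfun_open_bigU (I : Type) (f : I -> set testfun) :
  (forall i, testfun_open (f i)) -> testfun_open (\bigcup_i f i).
Proof.
move=> fo phi [i _ /fo[U U0 Uf]]; exists U => //.
by move=> x /Uf; exists i.
Qed.

HB.instance Definition _ := isOpenTopological.Build testfun
  testfun_openT testfun_openI testfun_open_bigU.

(* x |-> phi (r^-1 (x - a)); it is a test function when r <> 0 (see rescaleE)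
   and insubd returns the zero test function otherwise. *)
Definition rescale (a : 'rV[R]_n) (r : R) (phi : testfun) : testfun :=
  insubd 0 (fun x => phi (r^-1 *: (x - a))).

Lemma rescaleE a r phi : r != 0 ->
  rescale a r phi = (fun x => phi (r^-1 *: (x - a))) :> ('rV[R]_n -> Y).
Proof.
move=> r0; have /set_mem[sphi cphi] := testfunP phi.
rewrite /rescale val_insubd (_ : _ \in _)//; apply/mem_set; split.
  exact: smooth_affine.
pose h (y : 'rV[R]_n) := r *: y + a.
have hc : continuous h.
  move=> y; rewrite /continuous_at.
  apply: (@cvgD _ _ _ (nbhs y) _ ( *:%R r) (cst a) (r *: y) a); last first.
    exact: cvg_cst.
  by apply: (@cvgZ _ _ _ (nbhs y) _ (cst r) id r y) => //; exact: cvg_cst.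
have ch : compact (h @` spt phi).
  by apply: (continuous_compact (continuous_subspaceT hc)).
apply: (subclosed_compact _ ch); first exact: closed_closure.
rewrite /spt closureE; apply: smallest_sub.
  by apply: compact_closed ch; exact: norm_hausdorff.
move=> x /= phix; exists (r^-1 *: (x - a)); first exact: subset_closure.
by rewrite /h scalerA divff// scale1r subrK.
Qed.

End test_functions.

Section pointwise_differentiability.
Context {R : realType}.
Variables (n : nat) (Y : normedModType R).
Implicit Types (T nu : testfun n Y -> R) (a : 'rV[R]_n) (l : int)
  (P : 'rV[R]_n -> dual Y) (phi : testfun n Y) (r alpha : R).

(* P is a polynomial function of degree at most l. For l < 0 no multi-index b is
   selected and P is zero; for 0 <= l the bound on the entries of b is implied
   by the bound on their sum. *)
Definition polyfun l P : Prop :=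
  exists c : {ffun 'I_n -> 'I_`|l|%N.+1} -> dual Y, forall x,
    P x = \sum_(b : {ffun 'I_n -> 'I_`|l|%N.+1} | ((\sum_i b i)%N%:Z <= l))
      (\prod_i x 0 i ^+ b i) *: c b.

Definition integral_dist P phi : R :=
  (\int[lebesgue_rV n]_x (P x (phi x) : R))%R.

(* (T - S)_x (phi (r^-1 (x - a))), where S is integral_dist P. *)
Definition remainder T P a r phi : R :=
  T (rescale a r phi) - integral_dist P (rescale a r phi).

Definition ptdiff_by T a l P : Prop :=
  polyfun l P /\
  forall phi,
    r ^ (- l - n%:Z) * remainder T P a r phi @[r --> 0^'+] --> (0 : R).

Definition ptdiff T a l : Prop := exists P, ptdiff_by T a l P.

(* T is pointwise differentiable of order l at a and pt D^l T(a) = psi; the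
   polynomial P is unique. *)
Definition is_ptD T a (l : nat) (psi : l.-tuple 'rV[R]_n -> dual Y) : Prop :=
  exists2 P, ptdiff_by T a l P & derive_mlin P a = psi.

(* nu stands for a seminorm that is a norm on the test functions supported in
   the unit ball. *)
Definition remainder_sup T P nu a (c : R -> R) r : \bar R :=
  ereal_sup [set (c r * remainder T P a r phi)%:E |
    phi in testfun_in (eball 0 1) `&` [set phi | nu phi <= 1]].

Definition nu_ptdiff nu T a l : Prop :=
  exists2 P, polyfun l P &
    remainder_sup T P nu a (fun r => r ^ (- l - n%:Z)) r @[r --> 0^'+] --> 0%E.

(* Order (l, alpha). *)
Definition nu_ptdiff_frac nu T a l alpha : Prop :=
  exists2 P, polyfun l P &
    (limf_esup (remainder_sup T P nu a
                  (fun r => r `^ (- l%:~R - alpha - n%:R))%R) 0%R^'+ < +oo)%E.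

End pointwise_differentiability.

(* Main.v *)
Require Import Defs.
From HB Require Import structures.
From mathcomp Require Import all_boot all_order all_algebra.
From mathcomp Require Import all_classical all_reals all_analysis.
From mathcomp Require Import ring lra.
Import Order.TTheory GRing.Theory Num.Theory.
Import numFieldNormedType.Exports.
Set Implicit Arguments.
Unset Strict Implicit.
Unset Printing Implicit Defensive.
Local Open Scope classical_set_scope.
Local Open Scope ring_scope.

(* At a point [a] of the set the hypotheses force the Taylor polynomial of order [k - 1] to vanish
   and give |T f| <= j r^(n+k) M for every test function f supported in the cube of radius r
   around [a] whose rescaled derivatives of order at most [i] are bounded by [M]. Up to a null set
   it suffices to study the density points [a] of a compact set [C] on which this holds uniformly.

   Partitions of unity by cubes of side 2^-m (Whitney's method) show that the part of [T f] living
   off [C] is at most a constant times r^k M times the measure of the cube minus [C], which is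
   o(r^(n+k)) at a density point, while the remaining part, carried by ever smaller neighbourhoods
   of [C], tends to [0] when k > 0. This settles the case k > 0.

   For k = 0 the remaining part is, in each direction y of [Y], a functional R on scalar test
   functions with |R f| <= (int f^2) / 4 + B. Hence (int h^2) / 2 - R h has near minimizers h,
   which satisfy |R f - int h f| <= e^2 / s + s (int f^2) / 2 for all s > 0, and a covering
   argument turns this into a weak type inequality: R is given at almost every point by a number,
   the derivative in the direction y. Countably many directions suffice; the derivatives form an
   element g of the dual, and approximation by sums of products of scalar test functions and
   vectors yields (1). If the dual is separable, then near almost every point [T] is close to
   a distribution with one of countably many constant values y', uniformly on a compact set of
   positive density, and summing over the cubes of a partition of unity yields the uniform
   convergence in (2). *)

(** Nothing is known about the measurability of the sets of good points. Density points are
    therefore taken in closures: an estimate survives at a limit point with worse constants, because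
    a cube around the limit point lies in a cube of twice the radius around a nearby good point.
    Exceptional sets are likewise never measured, only enclosed in measurable sets of small measure.
    The quadratic functional stands in for a representation of the order-zero part by a square
    integrable function. A near minimizer is itself a test function, so its value at [a] makes sense
    and is nearly constant on small cubes. The price is that each tolerance has its own minimizer
    and yields only an approximate derivative; exact ones are recovered afterwards as limits. The
    functional is bounded below because, at small scales, the part carried by [C] costs only a
    constant times a Riemann sum of [|f|], and a linear cost is dominated by a small multiple of the
    quadratic one. Balls are cubes because the canonical norm is the sup norm. The Euclidean norm
    enters only through the seminorm of the statement and costs powers of [n]. *)

Ltac nonneg := repeat first [assumption | apply: mulr_ge0 | apply: addr_ge0 | apply: exprn_ge0
  | apply: divr_ge0]; rewrite ?ler01 ?ler0n ?normr_ge0//; try (by apply: ltW).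

(** * Cubes, coverings and density points *)

Section cubes.
Context {R : realType} {n : nat}.
Notation V := 'rV[R]_n.
Notation mu := (@lebesgue_rV R n).
Implicit Types (x a : V) (r : R).

Lemma rV_normP x r : 0 <= r -> `|x| <= r <-> (forall i, `|x 0 i| <= r).
Proof.
move=> r0; rewrite [`|x|]/Num.norm/= mx_normrE; split.
  by move=> /bigmax_leP[_ h] i; exact: (h (0, i)).
by move=> h; apply/bigmax_leP; split => // -[i j] _ /=; rewrite ord1.
Qed.

Lemma rV_coord_le x i : `|x 0 i| <= `|x|.
Proof. by have /rV_normP := lexx `|x|; apply. Qed.

Definition cube a r : set V := [set x | `|x - a| <= r].

Lemma closed_cube a r : closed (cube a r).
Proof.
rewrite /cube (_ : [set x | _] = (fun x => `|x - a|) @^-1` [set t | t <= r])//.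
apply: preimage_closed; last exact: closed_le.
move=> x _; apply: (@continuous_comp _ _ _ (fun x => x - a) Num.norm).
  by apply: (@continuousB _ _ _ id (cst a)) => //; exact: cst_continuous.
exact: norm_continuous.
Qed.

Lemma compact_cube a r : compact (cube a r).
Proof.
apply: bounded_closed_compact; last exact: closed_cube.
exists (`|a| + r); split; first exact: num_real.
move=> M aM x /= xr; apply: le_trans (ltW aM).
by rewrite -lerBlDl; apply: le_trans xr; rewrite lerB_dist.
Qed.

Lemma cube_itv a r : 0 <= r -> cube a r =
  [set x | forall i, (\row_j (a 0 j - r)) 0 i <= x 0 i <= (\row_j (a 0 j + r)) 0 i].
Proof.
move=> r0; apply/seteqP; split => x /=.
  move=> /(rV_normP _ r0) h i; have := h i.
  by rewrite !mxE ler_norml => /andP[h1 h2]; apply/andP; split; lra.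
move=> h; apply/(rV_normP _ r0) => i; have := h i.
by rewrite !mxE ler_norml => /andP[h1 h2]; apply/andP; split; lra.
Qed.

Lemma measure_cube a r : 0 <= r -> mu (cube a r) = ((2 * r) ^+ n)%:E.
Proof.
move=> r0; rewrite cube_itv// lebesgue_rV_box.
  congr EFin; rewrite -[in RHS](card_ord n) -prodr_const; apply: eq_bigr => i _.
  by rewrite !mxE; lra.
by move=> i; rewrite !mxE; lra.
Qed.

Lemma measurable_cube a r : measurable (cube a r).
Proof.
have [r0|r0] := leP 0 r; last first.
  rewrite (_ : cube a r = set0); first exact: measurable0.
  by apply/seteqP; split => // x /= /(le_trans (normr_ge0 _)); rewrite leNgt r0.
rewrite cube_itv//.
rewrite [X in measurable X](_ : _ = \bigcap_(i in [set: 'I_n])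
    ((fun x : V => x 0 i : measurableTypeR R) @^-1`
      `[(\row_j (a 0 j - r)) 0 i, (\row_j (a 0 j + r)) 0 i])).
  apply: fin_bigcap_measurable => // i _; rewrite -[X in measurable X]setTI.
  by apply: measurable_coor => //; exact: measurable_itv.
apply/seteqP; split => x /= xab i => [_|]; first by rewrite /= in_itv/=.
by have := xab i I; rewrite /= in_itv/=.
Qed.

Lemma cubeS a b r s : `|a - b| + r <= s -> cube a r `<=` cube b s.
Proof.
move=> h x /= xr; apply: le_trans h.
rewrite -(subrKA a) addrC; apply: le_trans (ler_normD _ _) _.
by rewrite lerD2l.
Qed.

(** A countable family in which a member fits between any point and any cube around it; it supplies
    all countable subcovers. *)
Definition rat_cube (p : 'rV[rat]_n * nat) := cube (map_mx ratr p.1) p.2.+1%:R^-1.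

Lemma rat_cubeP x (e : R) : 0 < e ->
  exists p, rat_cube p x /\ rat_cube p `<=` cube x e.
Proof.
move=> e0; have e20 : 0 < e / 2 by rewrite divr_gt0.
have [m _ /(_ m (leqnn _)) /= em] := near_infty_natSinv_lt (PosNum e20).
pose s : R := m.+1%:R^-1.
have s0 : 0 < s by rewrite invr_gt0.
have q_ i : exists q : rat, `|x 0 i - ratr q| <= s.
  have [q] := @rat_in_itvoo R (x 0 i) (x 0 i + s) ltac:(by rewrite ltrDl).
  rewrite in_itv/= => /andP[h1 h2]; exists q.
  by rewrite ler_norml; apply/andP; split; lra.
have [q qx] := choice q_.
exists (\row_i q i, m).
have xq : `|x - map_mx ratr (\row_i q i)| <= s.
  by apply/rV_normP => [|i]; [exact: ltW|rewrite !mxE].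
split; first exact: xq.
by apply: cubeS; rewrite distrC; move: em => /=; rewrite -/s; lra.
Qed.

Lemma open_rat_cubes (U : set V) : open U ->
  U = \bigcup_(p in [set p | rat_cube p `<=` U]) rat_cube p.
Proof.
move=> oU; apply/seteqP; split => [x Ux|x [p pU]]; last exact: pU.
have /nbhs_ballP[e /= e0 eU] : nbhs x U by exact: open_nbhs_nbhs.
have [p [px pe]] := rat_cubeP x (divr_gt0 e0 (ltr0n _ 2)).
exists p => //= y /pe ye; apply: eU; rewrite mx_norm_ball /ball_/=.
by rewrite distrC; apply: le_lt_trans ye _; rewrite ltr_pdivrMr// ltr_pMr// ltr1n.
Qed.

Lemma open_measurable_rV (U : set V) : open U -> measurable U.
Proof.
move=> /open_rat_cubes ->; rewrite bigcup_mkcond.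
apply: countable_bigcupT_measurable; first exact: countableP.
by move=> p; case: ifPn => _; [exact: measurable_cube|exact: measurable0].
Qed.

Lemma closed_measurable_rV (U : set V) : closed U -> measurable U.
Proof.
move=> cU; rewrite -[U]setCK; apply: measurableC; apply: open_measurable_rV.
exact: closed_openC.
Qed.

Lemma continuous_measurable_rV (f : V -> R) : continuous f ->
  measurable_fun [set: V] f.
Proof.
move=> /continuousP cf; apply: (measurability _ (measurable_realfun.RGenOpens.measurableE R)).
move=> _ [_ [a [b ->] <-]]; rewrite setTI; apply: open_measurable_rV.
exact/cf/interval_open.
Qed.

Lemma sum_measure_le (I : eqType) (s : seq I) (A : I -> set V) (B : set V) :
  measurable B -> uniq s -> (forall i, i \in s -> measurable (A i)) ->
  (forall i, i \in s -> A i `<=` B) ->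
  (forall i j, i \in s -> j \in s -> i != j -> A i `&` A j = set0) ->
  (\sum_(i <- s) mu (A i) <= mu B)%E.
Proof.
elim: s B => [|i s IH] B mB /=; first by rewrite big_nil.
move=> /andP[is_ us] mA AB dA; rewrite big_cons.
have mAi : measurable (A i) by apply: mA; rewrite mem_head.
rewrite (measureDI _ mB mAi) addeC; apply: leeD.
  apply: IH => //.
  - exact: measurableD.
  - by move=> j js; apply: mA; rewrite in_cons js orbT.
  - move=> j js x Ajx; split; first by apply: (AB j) => //; rewrite in_cons js orbT.
    move=> Aix; have : (A i `&` A j) x by [].
    rewrite dA ?mem_head ?in_cons ?js ?orbT//.
    by apply: contraNneq is_ => ->.
  - by move=> j k js ks; apply: dA; rewrite in_cons ?js ?ks orbT.
by apply: le_measure; rewrite ?inE//; [exact: measurableI|move=> x Ax; split => //;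
  apply: (AB i) => //; rewrite mem_head].
Qed.

Lemma measure_cover_le (I : eqType) (s : seq I) (A : I -> set V) (B : set V) :
  measurable B -> (forall i, i \in s -> measurable (A i)) ->
  (forall x, B x -> exists2 i, i \in s & A i x) ->
  (mu B <= \sum_(i <- s) mu (A i))%E.
Proof.
elim: s B => [|i s IH] B mB mA AB.
  rewrite big_nil (_ : B = set0) ?measure0//.
  by apply/seteqP; split => // x /AB[].
have mAi : measurable (A i) by apply: mA; rewrite mem_head.
rewrite big_cons (measureDI _ mB mAi) addeC; apply: leeD.
  by apply: le_measure; rewrite ?inE//; exact: measurableI.
apply: IH; first exact: measurableD.
  by move=> j js; apply: mA; rewrite in_cons js orbT.
move=> x [/AB[j]]; rewrite in_cons => /orP[/eqP-> //|js] Ax _.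
by exists j.
Qed.

(** Greedy choice: keep a cube of largest radius, drop those that meet it, recurse on the rest. A
    dropped cube has no larger radius, so the kept cube enlarged three times contains it. *)
Lemma vitali_finite (I : eqType) (s : seq I) (c : I -> V) (r : I -> R) :
  exists D : seq I, [/\ uniq D, {subset D <= s},
    (forall i j, i \in D -> j \in D -> i != j ->
       cube (c i) (r i) `&` cube (c j) (r j) = set0) &
    forall i, i \in s -> exists2 j, j \in D & cube (c i) (r i) `<=` cube (c j) (3 * r j)].
Proof.
have [m] := ubnP (size s); elim: m s => // m IH s sm.
case: s sm => [|i1 s1] sm; first by exists [::].
have [i0 i0s i0max] : exists2 i0, i0 \in i1 :: s1 & forall i, i \in i1 :: s1 -> r i <= r i0.
  elim: s1 i1 {IH sm} => [|i2 s2 IH2] i1.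
    by exists i1; rewrite ?mem_head// => i; rewrite inE => /eqP->.
  have [j js jmax] := IH2 i2.
  have [rj|rj] := leP (r j) (r i1).
    exists i1; rewrite ?mem_head// => i; rewrite in_cons => /orP[/eqP->//|/jmax].
    by move=> /le_trans; apply.
  exists j; first by rewrite in_cons js orbT.
  by move=> i; rewrite in_cons => /orP[/eqP->|/jmax//]; exact: ltW.
set s := i1 :: s1 in i0s i0max sm *.
(* The second conjunct matters when the radius of [i0] is negative: the empty cube is disjoint from
   itself, and without it the list would not shrink. *)
pose P i := `[< cube (c i) (r i) `&` cube (c i0) (r i0) = set0 >] && (i != i0).
have ss : (size [seq i <- s | P i] < m)%N.
  rewrite -ltnS; apply: leq_trans sm; rewrite ltnS size_filter -(count_predC P s).
  by rewrite -addn1 leq_add2l -has_count; apply/hasP; exists i0 => //=; rewrite /P eqxx andbF.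
have [D [uD Ds dD cD]] := IH _ ss.
have PD i : i \in D -> P i by move=> /Ds; rewrite mem_filter => /andP[].
exists (i0 :: D); split.
- by rewrite /= uD andbT; apply/negP => /PD; rewrite /P eqxx andbF.
- by move=> i; rewrite in_cons => /orP[/eqP->//|/Ds]; rewrite mem_filter => /andP[].
- move=> i j; rewrite !in_cons => /orP[/eqP->|iD] /orP[/eqP->|jD]; rewrite ?eqxx//.
  + by move=> _; have /andP[/asboolP + _] := PD _ jD; rewrite setIC.
  + by move=> _; have /andP[/asboolP + _] := PD _ iD.
  + exact: dD.
move=> i is_; have [Pi|nPi] := boolP (P i).
  have [|j jD ij] := cD i; first by rewrite mem_filter Pi.
  by exists j => //; rewrite in_cons jD orbT.
exists i0; rewrite ?mem_head//; move: nPi; rewrite negb_and negbK => /orP[|/eqP->].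
  move=> /asboolPn/eqP/set0P[x [xi xi0]]; apply: cubeS.
  have := i0max i is_; have : `|c i - c i0| <= r i + r i0; last by lra.
  rewrite -(subrKA x) addrC; apply: le_trans (ler_normD _ _) _.
  by rewrite addrC lerD// distrC.
by rewrite /cube => x /= h; have := normr_ge0 (x - c i0); move: h; lra.
Qed.

(** Covering lemma for an arbitrary set [N]. Rational cubes inside the given cubes form a countable
    cover, hence a measurable one. Finitely many of them are covered by tripled disjoint cubes, each
    of measure [(6 * r) ^ n], whence the factor [6 ^ n]; a monotone limit gives the whole cover. *)
Lemma cubes_cover_small (S : V -> R -> Prop) (N : set V) (e : R) :
  (forall a, N a -> exists2 r, 0 < r & S a r) ->
  (forall (s : seq nat) (c : nat -> V) (r : nat -> R), uniq s ->
    (forall i, i \in s -> 0 < r i /\ S (c i) (r i)) ->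
    (forall i j, i \in s -> j \in s -> i != j ->
      cube (c i) (r i) `&` cube (c j) (r j) = set0) ->
    \sum_(i <- s) r i ^+ n <= e) ->
  exists U, [/\ measurable U, N `<=` U & (mu U <= (6 ^+ n * e)%:E)%E].
Proof.
move=> NS Se.
pose good (p : 'rV[rat]_n * nat) (q : V * R) :=
  [/\ 0 < q.2, S q.1 q.2 & rat_cube p `<=` cube q.1 q.2].
pose K := [pred k | `[< exists p, unpickle k = Some p /\ exists q, good p q >]].
have /choice[g gP] : forall k, exists pq : ('rV[rat]_n * nat) * (V * R),
    k \in K -> unpickle k = Some pq.1 /\ good pq.1 pq.2.
  move=> k; have [kK|//] := boolP (k \in K); last by exists ((0, 0%N), (0, 0)).
  by have /asboolP[p [kp [q gq]]] := kK; exists (p, q).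
pose F k := if k \in K then rat_cube (g k).1 else set0.
have mF k : measurable (F k).
  by rewrite /F; case: ifP => _; [exact: measurable_cube|exact: measurable0].
pose G m := \big[setU/set0]_(k < m) F k.
have mG m : measurable (G m) by apply: bigsetU_measurable.
have FG : \bigcup_k F k = \bigcup_m G m.
  apply/seteqP; split => x [k _].
    by move=> Fx; exists k.+1 => //; rewrite /G big_ord_recr/=; right.
  by rewrite /G -bigcup_mkord => -[i _ Fx]; exists i.
exists (\bigcup_k F k); split.
- exact: bigcupT_measurable.
- move=> a Na; have [r r0 Sr] := NS a Na.
  have [p [pa pr]] := rat_cubeP a r0.
  have pK : pickle p \in K.
    by apply/asboolP; exists p; rewrite pickleK; split => //; exists (a, r).
  exists (pickle p) => //; rewrite /F pK.
  by have [] := gP _ pK; rewrite pickleK => -[<-].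
rewrite FG.
have cvgG : mu \o G @ \oo --> mu (\bigcup_m G m).
  apply: nondecreasing_cvg_mu => //; first exact: bigcupT_measurable.
  by apply/nondecreasing_seqP => m; apply/subsetPset; rewrite /G big_ord_recr/=; left.
rewrite -(cvg_lim _ cvgG)//; apply: lime_le; first by apply/cvg_ex; exists (mu (\bigcup_m G m)).
apply: nearW => m /=.
pose s := [seq k <- iota 0 m | k \in K].
have [D [uD Ds dD cD]] := vitali_finite s (fun k => (g k).2.1) (fun k => (g k).2.2).
have gD k : k \in D -> 0 < (g k).2.2 /\ S (g k).2.1 (g k).2.2.
  by move=> /Ds; rewrite mem_filter => /andP[/gP[_ []]].
apply: le_trans (_ : (\sum_(k <- D) mu (cube (g k).2.1 (3 * (g k).2.2)) <= _)%E).
  apply: measure_cover_le => //; first by move=> *; exact: measurable_cube.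
  move=> x; rewrite /G -bigcup_mkord => -[k /= km]; rewrite /F.
  case: ifPn => // kK pkx; have [kp [_ _ /(_ _ pkx) gkx]] := gP _ kK.
  have [|j jD ij] := cD k; first by rewrite mem_filter kK mem_iota.
  by exists j => //; exact: ij.
rewrite big_seq (eq_bigr (fun k => (6 ^+ n * (g k).2.2 ^+ n)%:E)); last first.
  move=> k /gD[g0 _]; rewrite measure_cube ?mulr_ge0 ?ltW//.
  by rewrite mulrA -natrM exprMn.
rewrite -big_seq sumEFin lee_fin -mulr_sumr ler_wpM2l ?exprn_ge0//.
exact: (Se D (fun k => (g k).2.1) (fun k => (g k).2.2)).
Qed.

Lemma negligible_small (N : set V) :
  (forall e, 0 < e -> exists U, [/\ measurable U, N `<=` U & (mu U <= e%:E)%E]) ->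
  mu.-negligible N.
Proof.
move=> h; have /choice[U UP] : forall k : nat, exists U,
    [/\ measurable U, N `<=` U & (mu U <= (k.+1%:R^-1)%:E)%E].
  by move=> k; apply: h; rewrite invr_gt0.
exists (\bigcap_k U k); split.
- by apply: bigcapT_measurable => k; have [] := UP k.
- apply/eqP; rewrite eq_le measure_ge0 andbT; apply/lee_addgt0Pr => e e0.
  have [k _ /(_ k (leqnn _)) /= ke] := near_infty_natSinv_lt (PosNum e0).
  rewrite add0e; apply: le_trans (_ : (k.+1%:R^-1)%:E <= _)%E; last by rewrite lee_fin ltW.
  have [mU _ Uk] := UP k; apply: le_trans Uk.
  apply: le_measure; rewrite ?inE//; last by move=> x; apply.
  by apply: bigcapT_measurable => j; have [] := UP j.
- by move=> x Nx k _; have [_ NU _] := UP k; exact: NU.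
Qed.

Lemma negligible_bigcup_countable (T : countType) (N : T -> set V) :
  (forall t, mu.-negligible (N t)) -> mu.-negligible (\bigcup_t N t).
Proof.
move=> h; pose M k := if unpickle k is Some t then N t else set0.
apply: (@negligibleS _ _ _ _ (\bigcup_k M k)).
  by move=> x [t _ Nx]; exists (pickle t) => //; rewrite /M pickleK.
apply: negligible_bigcup => k; rewrite /M; case: unpickle => [t|]; first exact: h.
exact: negligible_set0.
Qed.

Definition density_pt (C : set V) a := forall e, 0 < e -> exists2 d, 0 < d &
  forall r, 0 < r -> r < d -> (mu (cube a r `\` C) <= (e * r ^+ n)%:E)%E.

Lemma compact_bounded_cube (C : set V) : compact C -> exists2 L, 0 < L & C `<=` cube 0 L.
Proof.
move=> /compact_bounded[M [Mr CM]]; exists (`|M| + 1); first by rewrite ltr_wpDl.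
by move=> x Cx; rewrite /cube/= subr0; apply: CM => //; rewrite (le_lt_trans (ler_norm _))// ltrDl.
Qed.

Definition thick (C : set V) (d : R) := [set x | exists2 b, C b & `|x - b| < d].

Lemma open_thick C d : 0 < d -> open (thick C d).
Proof.
move=> d0; rewrite (_ : thick C d = \bigcup_(b in C) ball b d).
  by apply: bigcup_open => b _; exact: ball_open.
apply/seteqP; split => [x [b Cb xb]|x [b Cb]].
  by exists b => //; rewrite mx_norm_ball /ball_/= distrC.
by rewrite mx_norm_ball /ball_/= distrC => xb; exists b.
Qed.

Lemma measurable_thick C d : 0 < d -> measurable (thick C d).
Proof. by move=> d0; apply: open_measurable_rV; exact: open_thick. Qed.

(** Continuity from above: the neighbourhoods with [C] removed decrease to the empty set because [C]
    is closed, and they have finite measure because [C] is bounded. *)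
Lemma measure_thick_small (C : set V) (e : R) : compact C -> 0 < e ->
  exists2 d, 0 < d & (mu (thick C d `\` C) <= e%:E)%E.
Proof.
move=> cC e0; have clC : closed C by apply: compact_closed => //; exact: norm_hausdorff.
have [L L0 CL] := compact_bounded_cube cC.
pose F m := thick C m.+1%:R^-1 `\` C.
have mF m : measurable (F m).
  apply: measurableD; first by apply: measurable_thick; rewrite invr_gt0.
  exact: closed_measurable_rV.
have capF : \bigcap_m F m = set0.
  apply/seteqP; split => // x Fx; have [_ nCx] := Fx 0%N I; apply: nCx.
  apply: clC => B /nbhs_ballP[d /= d0 dB].
  have [m _ /(_ m (leqnn _)) /= md] := near_infty_natSinv_lt (PosNum d0).
  have [[b Cb xb] _] := Fx m I; exists b; split => //; apply: dB.
  by rewrite mx_norm_ball /ball_/=; apply: lt_trans xb _.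
have cvgF : mu \o F @ \oo --> mu (\bigcap_m F m).
  apply: nonincreasing_cvg_mu => //; last 2 first.
  - by rewrite capF; exact: measurable0.
  - apply/nonincreasing_seqP => m; apply/subsetPset => x [[b Cb xb] nCx]; split => //.
    by exists b => //; apply: lt_le_trans xb _; rewrite lef_pV2 ?posrE// ler_nat.
  apply: le_lt_trans (_ : (mu (cube 0 (L + 1)) < +oo)%E).
    apply: le_measure; rewrite ?inE//; first exact: measurable_cube.
    move=> x [[b /CL Cb xb] _]; rewrite /cube/= subr0 -(subrK b x).
    apply: le_trans (ler_normD _ _) _; rewrite addrC lerD//; first by move: Cb;
      rewrite /cube/= subr0.
    by move: xb; rewrite invr1 => /ltW.
  by rewrite measure_cube ?ltry// addr_ge0// ltW.
rewrite capF measure0 in cvgF.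
have [m _ /(_ m (leqnn _)) /= me] : \forall m \near \oo, (mu (F m) < e%:E)%E.
  apply: (cvgF [set x | (x < e%:E)%E]); apply: open_nbhs_nbhs.
  by split; [exact: open_ereal_lt_ereal|rewrite /= lte_fin].
by exists m.+1%:R^-1; [rewrite invr_gt0|exact: ltW].
Qed.

(** Around a point of [C] that is not a density point there are arbitrarily small cubes of which a
    fixed proportion misses [C]. These proportions lie in a thin neighbourhood of [C] with [C]
    removed, whose measure is small, so disjoint families of such cubes have small total volume and
    the covering lemma applies. *)
Lemma ae_density_pt (C : set V) : compact C -> mu.-negligible (C `\` density_pt C).
Proof.
move=> cC; have clC : closed C by apply: compact_closed => //; exact: norm_hausdorff.
pose N (j : nat) := [set a | C a /\ forall d, 0 < d -> exists r, [/\ 0 < r, r < d &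
  (mu (cube a r `\` C) > (j.+1%:R^-1 * r ^+ n)%:E)%E]].
apply: (@negligibleS _ _ _ _ (\bigcup_j N j)).
  move=> a [Ca nda]; apply: contrapT => nN; apply: nda => e e0.
  have [j _ /(_ j (leqnn _)) /= je] := near_infty_natSinv_lt (PosNum e0).
  apply: contrapT => nd; apply: nN; exists j => //; split => // d d0.
  apply: contrapT => nr; apply: nd; exists d => // r r0 rd.
  rewrite leNgt; apply/negP => h; apply: nr; exists r; split => //.
  apply: le_lt_trans h; rewrite lee_fin ler_wpM2r ?exprn_ge0// ltW//.
apply: negligible_bigcup => j.
apply: negligible_small => e e0.
(* The two factors of the denominator undo the [6 ^ n] of the covering lemma and the proportion
   [j.+1%:R^-1]. *)
have [d d0 de] := measure_thick_small cC
  (divr_gt0 e0 (mulr_gt0 (exprn_gt0 n (ltr0n _ 6)) (ltr0Sn R j))).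
have mt : measurable (thick C d `\` C).
  by apply: measurableD; [exact: measurable_thick|exact: closed_measurable_rV].
have [||U [mU NU Ue]] := @cubes_cover_small (fun a r => [/\ C a, r < d &
  (mu (cube a r `\` C) > (j.+1%:R^-1 * r ^+ n)%:E)%E]) (N j) (e / 6 ^+ n).
- by move=> a [Ca /(_ _ d0)[r [r0 rd h]]]; exists r.
- move=> s c r us sP sd.
  have : (\sum_(i <- s) (j.+1%:R^-1 * r i ^+ n)%:E <= mu (thick C d `\` C))%E.
    apply: le_trans (_ : (\sum_(i <- s) mu (cube (c i) (r i) `\` C) <= _)%E).
      by rewrite big_seq [leRHS]big_seq; apply: lee_sum => i /sP[_ [_ _ /ltW]].
    apply: sum_measure_le => //.
    - by move=> i _; apply: measurableD; [exact: measurable_cube|exact: closed_measurable_rV].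
    - move=> i /sP[_ [Ci rd _]] x [xi nCx]; split => //.
      by exists (c i) => //; apply: le_lt_trans xi _.
    - move=> p q ps qs pq; rewrite -subset0 => x [[xp _] [xq _]].
      by rewrite -(sd p q ps qs pq).
  move=> /le_trans/(_ de); rewrite sumEFin lee_fin -mulr_sumr.
  by rewrite -ler_pdivlMl ?invr_gt0// invrK mulrC invfM mulrA divfK.
exists U; split => //; apply: le_trans Ue _.
by rewrite lee_fin mulrC divfK// expf_neq0// pnatr_eq0.
Qed.

End cubes.

(** * Smooth functions and their jets *)

Section scale_product.
Context {R : realType} {V W : normedModType R}.

Lemma scaler_is_bilinear :
  bilinear_for
    (GRing.Scale.Law.clone _ _ *:%R _) (GRing.Scale.Law.clone _ _ *:%R _)
    (@GRing.scale R W : R^o -> W -> W).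
Proof.
split=> [u'|u] a x y /=; first by rewrite scalerDl scalerA.
by rewrite scalerDr !scalerA mulrC.
Qed.

Let scale_bil : {bilinear R^o -> W -> W} :=
  HB.pack (@GRing.scale R W : R^o -> W -> W)
    (bilinear_isBilinear.Build R R^o W W _ _ (@GRing.scale R W : R^o -> W -> W)
       scaler_is_bilinear).

Variables (p : V -> R^o) (f : V -> W).

(** The product rule as a chain rule: pairing followed by the continuous bilinear map of scaling. *)
Lemma is_diff_scaleM x : differentiable p x -> differentiable f x ->
  is_diff x (fun y => p y *: f y) (fun v => p x *: 'd f x v + 'd p x v *: f x).
Proof.
move=> dp df.
have sc : continuous (fun q : R^o * W => scale_bil q.1 q.2).
  by move=> q; exact: scale_continuous.
have dq : is_diff (p x, f x) (fun q : R^o * W => q.1 *: q.2)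
    (fun q => p x *: q.2 + q.1 *: f x).
  apply: DiffDef; first exact: (@differentiable_bilin R R^o W W scale_bil (p x, f x) sc).
  exact: (@diff_bilin R R^o W W scale_bil (p x, f x) sc).
have dpf : is_diff x (fun y => (p y, f y)) (fun v => ('d p x v, 'd f x v)).
  by apply: is_diff_pair; exact: differentiableP.
exact: (@is_diff_comp _ _ _ _ (fun y => (p y, f y)) _ (fun q : R^o * W => q.1 *: q.2) _ x dpf dq).
Qed.

Lemma differentiable_scaleM x : differentiable p x -> differentiable f x ->
  differentiable (fun y => p y *: f y) x.
Proof. by move=> dp df; have [] := is_diff_scaleM dp df. Qed.

Lemma derive_scaleM x v : differentiable p x -> differentiable f x ->
  'D_v (fun y => p y *: f y) x = p x *: 'D_v f x + 'D_v p x *: f x.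
Proof.
move=> dp df; have h := is_diff_scaleM dp df.
have dpf := differentiable_scaleM dp df.
by rewrite (deriveE _ dpf) (deriveE _ dp) (deriveE _ df) diff_val.
Qed.

End scale_product.

Section smooth_calculus.
Context {R : realType} {V : normedModType R}.

Lemma iter_derive_rcons (W : normedModType R) (f : V -> W) vs v :
  iter_derive f (rcons vs v) = iter_derive ('D_v f) vs.
Proof. by rewrite /iter_derive foldr_rcons. Qed.

Lemma smoothP (W : normedModType R) (f : V -> W) :
  smooth f <-> (forall x, differentiable f x) /\ forall v, smooth ('D_v f).
Proof.
split=> [sf|[df sDf] vs x]; first split => [x|v vs x]; first exact: (sf [::]).
  by rewrite -iter_derive_rcons; exact: sf.
case/lastP: vs => [|vs v]; first exact: df.
by rewrite iter_derive_rcons; exact: sDf.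
Qed.

Lemma smooth_differentiable (W : normedModType R) (f : V -> W) x : smooth f -> differentiable f x.
Proof. by move=> sf; exact: (sf [::]). Qed.

Lemma smooth_continuous (W : normedModType R) (f : V -> W) : smooth f -> continuous f.
Proof. by move=> sf x; apply: differentiable_continuous; exact: smooth_differentiable. Qed.

Lemma smooth_derive (W : normedModType R) (f : V -> W) v : smooth f -> smooth ('D_v f).
Proof. by move=> /smoothP[]. Qed.

Lemma iter_derive_cst (W : normedModType R) (c : W) vs :
  iter_derive (cst c : V -> W) vs = cst (if vs is [::] then c else 0).
Proof.
elim: vs => //= v vs ->; apply/funext => x; exact: derive_cst.
Qed.

Lemma smooth_cst (W : normedModType R) (c : W) : smooth (cst c : V -> W).
Proof. by move=> vs x; rewrite iter_derive_cst; exact: differentiable_cst. Qed.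

Lemma smoothD (W : normedModType R) (f g : V -> W) : smooth f -> smooth g ->
  smooth (fun x => f x + g x).
Proof.
move=> sf sg; rewrite (_ : (fun _ => _) = 1 *: f + g); first exact: smoothZD.
by apply/funext => x; rewrite !fctE/= scale1r.
Qed.

Lemma smoothZ (W : normedModType R) (f : V -> W) (c : R) : smooth f ->
  smooth (fun x => c *: f x).
Proof.
move=> sf; rewrite (_ : (fun _ => _) = c *: f + cst 0); last first.
  by apply/funext => x; rewrite fctE/= addr0.
by apply: smoothZD => //; exact: smooth_cst.
Qed.

Lemma smoothB (W : normedModType R) (f g : V -> W) : smooth f -> smooth g ->
  smooth (fun x => f x - g x).
Proof.
move=> sf sg; rewrite (_ : (fun _ => _) = -1 *: g + f); first exact: smoothZD.
by apply/funext => x; rewrite !fctE/= scaleN1r addrC.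
Qed.

Lemma iter_deriveD (W : normedModType R) (f g : V -> W) vs x : smooth f -> smooth g ->
  iter_derive (fun x => f x + g x) vs x = iter_derive f vs x + iter_derive g vs x.
Proof.
move=> sf sg; rewrite (_ : (fun _ => _) = 1 *: f + g).
  by rewrite iter_deriveZD// !fctE/= scale1r.
by apply/funext => y; rewrite !fctE/= scale1r.
Qed.

Lemma iter_deriveZ (W : normedModType R) (f : V -> W) c vs x : smooth f ->
  iter_derive (fun x => c *: f x) vs x = c *: iter_derive f vs x.
Proof.
move=> sf; rewrite (_ : (fun _ => _) = c *: f + cst 0).
  rewrite iter_deriveZD//; last exact: smooth_cst.
  by rewrite iter_derive0 !fctE/= addr0.
by apply/funext => y; rewrite fctE/= addr0.
Qed.

Lemma smooth_sum (W : normedModType R) (I : Type) (s : seq I) (P : pred I) (F : I -> V -> W) :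
  (forall i, P i -> smooth (F i)) -> smooth (fun x => \sum_(i <- s | P i) F i x).
Proof.
move=> sF; elim: s => [|i s IH].
  by under eq_fun do rewrite big_nil; exact: smooth_cst.
under eq_fun do rewrite big_cons; have [Pi|//] := boolP (P i).
by apply: smoothD => //; exact: sF.
Qed.

(** Induction on the number of derivatives with both factors generalized: the innermost derivative
    leaves a sum of two products of smooth functions. The inner induction [D] splits iterated
    derivatives of that sum only up to order [q], the order to which the products are already known
    to be differentiable. *)
Lemma smooth_scaleM (W : normedModType R) (p : V -> R^o) (f : V -> W) :
  smooth p -> smooth f -> smooth (fun x => p x *: f x).
Proof.
suff h q : forall (p : V -> R^o) (f : V -> W), smooth p -> smooth f ->
    forall vs, (size vs <= q)%N -> forall x, differentiable
      (iter_derive (fun x => p x *: f x) vs) x.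
  by move=> sp sf vs x; exact: (h (size vs)).
elim: q => [|q IH] {}p {}f sp sf vs.
  by rewrite leqn0 => /nilP -> x; apply: differentiable_scaleM; exact: smooth_differentiable.
case/lastP: vs => [_ x|vs v].
  by apply: differentiable_scaleM; exact: smooth_differentiable.
rewrite size_rcons ltnS => vq x; rewrite iter_derive_rcons.
have sDp := smooth_derive v sp; have sDf := smooth_derive v sf.
have -> : 'D_v (fun x => p x *: f x) = fun x => p x *: 'D_v f x + 'D_v p x *: f x.
  by apply/funext => y; apply: derive_scaleM; exact: smooth_differentiable.
have D us : (size us <= q)%N -> iter_derive (fun x => p x *: 'D_v f x + 'D_v p x *: f x) us =
  fun x => iter_derive (fun x => p x *: 'D_v f x) us x + iter_derive
    (fun x => 'D_v p x *: f x) us x.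
  elim: us => [//|u us IHu] uq; rewrite /= IHu; last exact: ltnW.
  apply/funext => y; have uq' : (size us <= q)%N by exact: ltnW.
  by rewrite deriveD//; apply: diff_derivable; apply: IH.
rewrite D//; apply: differentiableD; exact: IH.
Qed.

Lemma derive_smooth_scaleM (W : normedModType R) (p : V -> R^o) (f : V -> W) v :
  smooth p -> smooth f ->
  'D_v (fun x => p x *: f x) = fun x => p x *: 'D_v f x + 'D_v p x *: f x.
Proof.
by move=> sp sf; apply/funext => y; apply: derive_scaleM; exact: smooth_differentiable.
Qed.

End smooth_calculus.

Section jets.
Context {R : realType} {n : nat} {W : normedModType R}.
Notation V := 'rV[R]_n.
Implicit Types (f g : V -> W) (x v : V) (M r : R).

(** Says [r ^ m * |D^m f(x)| <= M] for all [m <= i], the powers of [r] being absorbed in the length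
    of the directions. In this form rescaling a function changes [r] and leaves [M] alone. *)
Definition jet_le (i : nat) (r M : R) (f : V -> W) (x : V) : Prop :=
  forall vs, (size vs <= i)%N -> (forall v, v \in vs -> `|v| <= r) ->
    `|iter_derive f vs x| <= M.

Lemma jet_le0 i r M f x : jet_le i r M f x -> `|f x| <= M.
Proof. by move=> /(_ [::]); apply. Qed.

Lemma jet_le_ge0 i r M f x : jet_le i r M f x -> 0 <= M.
Proof. by move=> /jet_le0; apply: le_trans. Qed.

(** Peeling off the innermost derivative turns the bounds for products, dilations and differences
    into inductions on [i], so that no Leibniz formula is expanded. *)
Lemma jet_leS i r M f x : jet_le i.+1 r M f x <->
  `|f x| <= M /\ forall v, `|v| <= r -> jet_le i r M ('D_v f) x.
Proof.
split=> [h|[f0 h]].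
  split=> [|v vr vs vsi vsr]; first exact: jet_le0 h.
  rewrite -iter_derive_rcons; apply: h; first by rewrite size_rcons.
  by move=> u; rewrite mem_rcons in_cons => /orP[/eqP->//|/vsr].
move=> vs; case/lastP: vs => [|vs v]; first by [].
rewrite size_rcons ltnS iter_derive_rcons => vsi vr; apply: h => //.
  by apply: vr; rewrite mem_rcons mem_head.
by move=> u us; apply: vr; rewrite mem_rcons in_cons us orbT.
Qed.

Lemma jet_le_mono i j r s M N f x : (j <= i)%N -> s <= r -> M <= N ->
  jet_le i r M f x -> jet_le j s N f x.
Proof.
move=> ji sr MN h vs vsj vss; apply: le_trans MN; apply: h.
  exact: leq_trans ji.
by move=> v /vss /le_trans; apply.
Qed.

Lemma jet_leD i r M N f g x : smooth f -> smooth g ->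
  jet_le i r M f x -> jet_le i r N g x -> jet_le i r (M + N) (fun x => f x + g x) x.
Proof.
move=> sf sg hf hg vs vsi vsr; rewrite iter_deriveD//.
by rewrite (le_trans (ler_normD _ _))// lerD//; [exact: hf|exact: hg].
Qed.

Lemma jet_leZ i r M c f x : smooth f ->
  jet_le i r M f x -> jet_le i r (`|c| * M) (fun x => c *: f x) x.
Proof.
by move=> sf hf vs vsi vsr; rewrite iter_deriveZ// normrZ ler_wpM2l//; exact: hf.
Qed.

Lemma jet_leB i r M N f g x : smooth f -> smooth g ->
  jet_le i r M f x -> jet_le i r N g x -> jet_le i r (M + N) (fun x => f x - g x) x.
Proof.
move=> sf sg hf hg.
rewrite (_ : (fun _ => _) = fun x => f x + -1 *: g x); last first.
  by apply/funext => y; rewrite scaleN1r.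
apply: jet_leD => //; first exact: smoothZ.
by have := jet_leZ (-1) sg hg; rewrite normrN1 mul1r.
Qed.

Lemma jet_le_cst i r (c : W) x : jet_le i r `|c| (cst c) x.
Proof.
by move=> vs _ _; rewrite iter_derive_cst /cst; case: vs => //; rewrite normr0.
Qed.

Lemma jet_le_sum (I : Type) (s : seq I) (P : pred I) (F : I -> V -> W) (M : I -> R) i r x :
  (forall j, P j -> smooth (F j)) -> (forall j, P j -> jet_le i r (M j) (F j) x) ->
  jet_le i r (\sum_(j <- s | P j) M j) (fun x => \sum_(j <- s | P j) F j x) x.
Proof.
move=> sF hF; elim: s => [|j s IH].
  rewrite big_nil (_ : (fun _ => _) = cst 0).
    by rewrite -(normr0 W); exact: jet_le_cst.
  by apply/funext => y; rewrite big_nil.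
have [Pj|nPj] := boolP (P j); last first.
  rewrite big_cons (negbTE nPj) (_ : (fun _ => _) = fun x => \sum_(k <- s | P k) F k x)//.
  by apply/funext => y; rewrite big_cons (negbTE nPj).
rewrite big_cons Pj (_ : (fun _ => _) = fun x => F j x + \sum_(k <- s | P k) F k x); last first.
  by apply/funext => y; rewrite big_cons Pj.
by apply: jet_leD => //; [exact: sF|exact: smooth_sum|exact: hF].
Qed.

Lemma derive_scale_dir f c v x : smooth f -> 'D_(c *: v) f x = c *: 'D_v f x.
Proof.
move=> sf; have df := smooth_differentiable x sf.
by rewrite !(deriveE _ df) linearZ.
Qed.

Lemma jet_le_dilate i r M c f x : smooth f -> 1 <= c ->
  jet_le i r M f x -> jet_le i (c * r) (c ^+ i * M) f x.
Proof.
move=> + c1; have c0 : 0 < c by rewrite (lt_le_trans ltr01).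
elim: i f => [|i IH] f sf.
  move=> h vs; rewrite leqn0 => /nilP-> _; rewrite expr0 mul1r; exact: jet_le0 h.
move=> /jet_leS[f0 h]; apply/jet_leS.
have M0 : 0 <= M by exact: le_trans f0.
split; first by rewrite (le_trans f0)// ler_peMl// exprn_ege1.
move=> v vr; pose u := c^-1 *: v.
have -> : 'D_v f = fun x => c *: 'D_u f x.
  by apply/funext => y; rewrite -derive_scale_dir// /u scalerA divff ?scale1r ?gt_eqF.
have sDf := smooth_derive u sf.
have := @jet_leZ i (c * r) (c ^+ i * M) c _ x sDf.
rewrite (gtr0_norm c0) mulrA -exprS; apply; apply: IH => //.
by apply: h; rewrite /u normrZ gtr0_norm ?invr_gt0// ler_pdivrMl.
Qed.

Lemma jet_le_affine i r s M c b f x : smooth f -> `|c| * s <= r ->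
  jet_le i r M f (c *: (x - b)) -> jet_le i s M (fun x => f (c *: (x - b))) x.
Proof.
move=> sf cs h vs vsi vss; rewrite iter_derive_affine//; apply: h.
  by rewrite size_map.
move=> u /mapP[v /vss vs' ->]; rewrite normrZ; apply: le_trans cs.
by rewrite ler_wpM2l.
Qed.

Lemma iter_derive_open (U : set V) f g : open U -> (forall x, U x -> f x = g x) ->
  forall vs x, U x -> iter_derive f vs x = iter_derive g vs x.
Proof.
move=> oU fg; elim=> [|v vs IH] x Ux; first exact: fg.
apply: near_eq_derive; apply: filterS (open_nbhs_nbhs (conj oU Ux)) => y; exact: IH.
Qed.

Lemma jet_le_open (U : set V) f g i r M x : open U -> U x -> (forall x, U x -> f x = g x) ->
  jet_le i r M f x -> jet_le i r M g x.
Proof.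
by move=> oU Ux fg h vs vsi vsr; rewrite -(iter_derive_open oU fg vs Ux); exact: h.
Qed.

Lemma jet_le_notin_spt f i r x : ~ spt f x -> jet_le i r 0 f x.
Proof.
move=> nx; apply: (@jet_le_open (~` spt f) (cst 0)) => //.
- exact/closed_openC/closed_closure.
- move=> y ny; have [->//|fy] := eqVneq (f y) 0.
  by exfalso; apply: ny; exact: subset_closure.
- by rewrite -(normr0 W); exact: jet_le_cst.
Qed.

Lemma derive_dir_sum f x v : smooth f ->
  'D_v f x = \sum_(j < n) v 0 j *: 'D_(delta_mx 0 j) f x.
Proof.
move=> sf; have df := smooth_differentiable x sf.
rewrite (deriveE _ df) {1}(row_sum_delta v) linear_sum; apply: eq_bigr => j _.
by rewrite linearZ (deriveE _ df).
Qed.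

Lemma spt_derive f v : spt ('D_v f) `<=` spt f.
Proof.
rewrite {1}/spt closureE; apply: smallest_sub; first exact: closed_closure.
move=> x /= Dfx; apply: contrapT => nx; move/eqP: Dfx; apply.
apply/eqP; rewrite -normr_le0.
apply: (@jet_le_notin_spt f 1 `|v| x nx [:: v]) => // u.
by rewrite inE => /eqP->.
Qed.

(** The derivatives in all directions of length at most [r] are controlled by the finitely many
    partial derivatives, to which the induction on [i] applies since their supports shrink. *)
Lemma jet_le_compact f i r : smooth f -> compact (spt f) ->
  exists M, forall x, jet_le i r M f x.
Proof.
elim: i f => [|i IH] f sf cf.
  have [M0 f0] : exists M, forall x, `|f x| <= M.
    have cfK : compact (f @` spt f).
      by apply: continuous_compact => //; apply: continuous_subspaceT; exact: smooth_continuous.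
    have [M [Mr fM]] := compact_bounded cfK.
    exists (`|M| + 1) => x; have [fx|fx] := eqVneq (f x) 0.
      by rewrite fx normr0 addr_ge0.
    apply: fM; first by rewrite (le_lt_trans (ler_norm _))// ltrDl.
    by exists x => //; exact: subset_closure.
  by exists M0 => x vs; rewrite leqn0 => /nilP->.
have [M0 f0] := IH f sf cf.
have /choice[M1 f1] : forall j : 'I_n, exists M, forall x, jet_le i r M ('D_(delta_mx 0 j) f) x.
  move=> j; apply: IH; first exact: smooth_derive.
  by apply: subclosed_compact cf (@spt_derive _ _); exact: closed_closure.
have M10 j : 0 <= M1 j by exact: jet_le_ge0 (f1 j 0).
exists (M0 + \sum_(j < n) `|r| * M1 j) => x; apply/jet_leS; split.
  apply: le_trans (jet_le0 (f0 x)) _; rewrite lerDl sumr_ge0// => j _.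
  by rewrite mulr_ge0.
move=> v vr; have -> : 'D_v f = fun x => \sum_(j < n) v 0 j *: 'D_(delta_mx 0 j) f x.
  by apply/funext => y; exact: derive_dir_sum.
apply: (@jet_le_mono i i r r (\sum_(j < n) `|v 0 j| * M1 j)) => //.
  apply: ler_wpDl; first exact: jet_le_ge0 (f0 x).
  apply: ler_sum => j _; rewrite ler_wpM2r//.
  by rewrite (le_trans (rV_coord_le _ _))// (le_trans vr)// ler_norm.
by apply: jet_le_sum => j _; [apply: smoothZ; exact: smooth_derive|
  apply: jet_leZ => //; exact: smooth_derive].
Qed.

End jets.

(** Each order of differentiation replaces one product by two, which produces [2 ^+ i]. *)
Lemma jet_leM (R : realType) (n : nat) (W : normedModType R) (p : 'rV[R]_n -> R^o)
    (f : 'rV[R]_n -> W) i r M N x : smooth p -> smooth f ->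
  jet_le i r M p x -> jet_le i r N f x ->
  jet_le i r (2 ^+ i * (M * N)) (fun x => p x *: f x) x.
Proof.
elim: i p f => [|i IH] p f sp sf.
  move=> /jet_le0 hp /jet_le0 hf vs; rewrite leqn0 => /nilP-> _ /=.
  by rewrite expr0 mul1r normrZ ler_pM.
move=> hp hf; have M0 := jet_le_ge0 hp; have N0 := jet_le_ge0 hf.
have [p0 Dp] := (jet_leS _ _ _ _ _).1 hp; have [f0 Df] := (jet_leS _ _ _ _ _).1 hf.
apply/jet_leS; split.
  rewrite normrZ; apply: le_trans (ler_pM _ _ p0 f0) _ => //.
  by rewrite ler_peMl ?mulr_ge0// exprn_ege1// ler1n.
move=> v vr; rewrite derive_smooth_scaleM//.
rewrite exprS -mulrA mulr_natl mulr2n.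
have sDp := smooth_derive v sp; have sDf := smooth_derive v sf.
apply: jet_leD; [exact: smooth_scaleM|exact: smooth_scaleM| |]; apply: IH => //.
- exact: jet_le_mono hp.
- exact: Df.
- exact: Dp.
- exact: jet_le_mono hf.
Qed.

(** * Bump functions and tilings *)

Section smooth_step.
Context {R : realType}.
Implicit Types (f g : R -> R) (t : R).

Fixpoint Ck (q : nat) f : Prop :=
  if q is q'.+1 then (forall t, derivable f t 1) /\ Ck q' (derive1 f) else True.

Lemma Ck_pred q f : Ck q.+1 f -> Ck q f.
Proof. by elim: q f => // q IH f [df h]; split => //; exact: IH. Qed.

Lemma CkD q f g : Ck q f -> Ck q g -> Ck q (f + g).
Proof.
elim: q f g => // q IH f g [df hf] [dg hg]; split; first by move=> t; exact: derivableD.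
rewrite (_ : derive1 (f + g) = (derive1 f) + (derive1 g)); first exact: IH.
by apply/funext => t; rewrite !fctE !derive1E deriveD.
Qed.

Lemma CkN q f : Ck q f -> Ck q (- f).
Proof.
elim: q f => // q IH f [df hf]; split; first by move=> t; exact: derivableN.
rewrite (_ : derive1 (- f) = - (derive1 f)); first exact: IH.
by apply/funext => t; rewrite !fctE !derive1E deriveN.
Qed.

Lemma CkM q f g : Ck q f -> Ck q g -> Ck q (f * g).
Proof.
elim: q f g => // q IH f g /[dup] cf [df hf] /[dup] cg [dg hg]; split.
  by move=> t; exact: derivableM.
rewrite (_ : derive1 (f * g) = f * (derive1 g) + g * (derive1 f)).
  by apply: CkD; apply: IH => //; exact: Ck_pred.
by apply/funext => t; rewrite !fctE !derive1E deriveM.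
Qed.

Lemma CkV q f : (forall t, f t != 0) -> Ck q f -> Ck q (fun t => (f t)^-1).
Proof.
move=> f0; elim: q => // q IH /[dup] cf [df hf]; split.
  by move=> t; exact: derivableV.
rewrite (_ : derive1 (fun t => (f t)^-1) =
    - ((fun t => (f t)^-1) * (fun t => (f t)^-1) * (derive1 f))).
  by apply/CkN/CkM => //; apply: CkM; apply: IH; exact: Ck_pred.
apply/funext => t; rewrite derive1E deriveV// !fctE/= derive1E.
by rewrite -invfM -expr2 scaleNr.
Qed.

Lemma Ck_cst q (c : R) : Ck q (cst c).
Proof.
elim: q c => // q IH c; split; first by move=> t; exact: derivable_cst.
rewrite (_ : derive1 (cst c) = cst 0); first exact: IH.
by apply/funext => t; rewrite derive1_cst.
Qed.

Lemma Ck_affine q (c b : R) f : Ck q f -> Ck q (fun t => f (c * t + b)).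
Proof.
elim: q f => // q IH f [df hf].
have da t : is_derive t 1 (fun t => f (c * t + b)) (c * (derive1 f) (c * t + b)).
  have d1 : is_derive t (1 : R) (fun t : R => c * t + b) c.
    by apply: is_derive_eq; rewrite addr0 [LHS]mulr1.
  have d2 : is_derive (c * t + b) 1 f ((derive1 f) (c * t + b)).
    by rewrite derive1E; exact: derivableP.
  rewrite mulrC; exact: (@is_derive1_comp _ f (fun t : R => c * t + b)).
split; first by move=> t; have [] := da t.
rewrite (_ : derive1 _ = (fun=> c) * (fun t => (derive1 f) (c * t + b))).
  apply: CkM; last exact: IH.
  exact: Ck_cst.
by apply/funext => t; rewrite derive1E derive_val.
Qed.

(** The factor [p] makes the family stable under derivation: the derivative of a member is again a
    member, so smoothness needs only one derivative to be computed, including at [0]. *)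
Definition flat_exp (p : {poly R}) t : R :=
  if 0 < t then p.[t^-1] * expR (- t^-1) else 0.

(** [expR u >= (u / m) ^ (N + 1)] with [m = N + 1] beats a polynomial with [N] coefficients and
    leaves a factor [1 / u] to spare. *)
Lemma horner_expR_bound (p : {poly R}) : exists2 K, 0 <= K &
  forall u, 1 <= u -> `|p.[u] * expR (- u)| <= K / u.
Proof.
pose N := size p; pose m : R := N.+1%:R.
have m0 : 0 < m by rewrite ltr0n.
exists (\sum_(i < N) `|p`_i| * m ^+ N.+1).
  by apply: sumr_ge0 => i _; rewrite mulr_ge0// exprn_ge0// ltW.
move=> u u1; have u0 : 0 < u by rewrite (lt_le_trans ltr01).
have eu : (u / m) ^+ N.+1 <= expR u.
  apply: le_trans (_ : expR (u / m) ^+ N.+1 <= _); last first.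
    by rewrite -expRM_natl -/m mulrC divfK// gt_eqF.
  rewrite lerXn2r ?nnegrE ?expR_ge0 ?divr_ge0 ?(ltW u0) ?(ltW m0)//.
  by rewrite (le_trans _ (expR_ge1Dx _))// lerDr.
rewrite horner_coef mulr_suml mulr_suml.
apply: le_trans (ler_norm_sum _ _ _) _; apply: ler_sum => i _.
rewrite !normrM (gtr0_norm (expR_gt0 _)) -mulrA -[leRHS]mulrA ler_wpM2l//.
rewrite normrX (gtr0_norm u0) expRN ler_pdivlMr// -mulrA mulrC -mulrA.
rewrite ler_pdivrMl ?expR_gt0// mulrC.
have -> : expR u * m ^+ N.+1 = m ^+ N.+1 * expR u by rewrite mulrC.
rewrite mulrC -ler_pdivrMl ?exprn_gt0// (le_trans _ eu)//.
rewrite exprMn exprVn [leRHS]mulrC ler_pM2l ?invr_gt0 ?exprn_gt0//.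
by rewrite -exprS ler_weXn2l// ltnS ltnW.
Qed.

Lemma is_derive_flat_exp (p : {poly R}) t :
  is_derive t 1 (flat_exp p) (flat_exp ('X^2 * (p - p^`())%R) t).
Proof.
have [t0|t0|->] := ltgtP t 0.
- apply: (@near_eq_is_derive _ _ _ (cst 0)).
    near=> y; rewrite /flat_exp ifF//; apply/negbTE; rewrite -leNgt ltW//.
    by near: y; exact: lt_nbhsl.
  by rewrite /flat_exp ltNge (ltW t0)/=; exact: is_derive_cst.
- pose g (y : R) := p.[y^-1] * expR (- y^-1).
  apply: (@near_eq_is_derive _ _ _ g).
    near=> y; rewrite /flat_exp ifT//.
    by near: y; exact: lt_nbhsr.
  have tn0 : t != 0 by rewrite gt_eqF.
  have dV : is_derive t 1 (fun y : R => y^-1) (- t ^- 2).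
    have := @is_deriveV R id t 1 1 tn0 (is_derive_id _ _).
    by rewrite [X in is_derive _ _ _ X]mulr1.
  have d1 : is_derive t 1 (fun y => p.[y^-1]) ((p^`()).[t^-1] * - t ^- 2).
    exact: (@is_derive1_comp _ (horner p) (fun y : R => y^-1)).
  have d2 : is_derive t 1 (fun y : R => expR (- y^-1)) (expR (- t^-1) * t ^- 2).
    apply: (@is_derive1_comp _ expR (fun y : R => - y^-1)).
    by rewrite -[t ^- 2]opprK; exact: is_deriveN.
  have := @is_deriveM _ _ _ _ _ _ _ _ d1 d2; rewrite /flat_exp t0 !hornerE.
  rewrite [X in is_derive _ _ _ X -> _](_ : _ =
    t^-1 ^+ 2 * (p.[t^-1] - p^`().[t^-1]) * expR (- t^-1))//.
  by rewrite exprVn /GRing.scale/=; ring.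
have F0 q : flat_exp q 0 = 0 by rewrite /flat_exp ltxx.
(* The extra ['X] is the factor [h^-1] of the difference quotient at [0], read at [u = h^-1]; the
   bound [K / u] then becomes [K * h]. *)
have [K K0 pK] := horner_expR_bound ('X * p)%R.
have lim0 : h^-1 *: (flat_exp p (h *: 1 + 0) - flat_exp p 0) @[h --> 0^'] --> (0 : R).
  apply/cvgr0Pnorm_le => e e0; near=> h.
  have hn0 : h != 0 by near: h; exact: nbhs_dnbhs_neq.
  rewrite F0 subr0 addr0 [h *: 1]mulr1 /flat_exp; have [h0|h0] := ltP 0 h; last first.
    by rewrite scaler0 normr0 ltW.
  have h1 : h <= 1.
    by rewrite (le_trans (ler_norm _))//; near: h; exact: dnbhs0_le.
  have he : h <= e / (K + 1).
    rewrite (le_trans (ler_norm _))//; near: h; apply: dnbhs0_le.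
    by rewrite divr_gt0// ltr_wpDl.
  have h1' : 1 <= h^-1 by rewrite invf_ge1.
  have := pK _ h1'; rewrite invrK hornerM hornerX -mulrA => /le_trans; apply.
  apply: le_trans (_ : K * (e / (K + 1)) <= _); first by rewrite ler_wpM2l.
  by rewrite mulrA ler_pdivrMr ?ltr_wpDl// mulrC ler_wpM2l ?(ltW e0)// lerDl.
apply: DeriveDef; first by apply/cvg_ex; exists 0.
by rewrite F0; apply: cvg_lim => //.
Unshelve. all: by end_near. Qed.

Lemma Ck_flat_exp q p : Ck q (flat_exp p).
Proof.
elim: q p => // q IH p; split; first by move=> t; have [] := is_derive_flat_exp p t.
rewrite (_ : derive1 _ = flat_exp ('X^2 * (p - p^`())%R)); first exact: IH.
by apply/funext => t; rewrite derive1E; have h := is_derive_flat_exp p t; rewrite derive_val.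
Qed.

Let b t := flat_exp 1 t.

Let b_ge0 t : 0 <= b t.
Proof. by rewrite /b /flat_exp; case: ifP => // _; rewrite hornerC mul1r expR_ge0. Qed.

Let b_gt0 t : 0 < t -> 0 < b t.
Proof. by rewrite /b /flat_exp => ->; rewrite hornerC mul1r expR_gt0. Qed.

Let b_le0 t : t <= 0 -> b t = 0.
Proof. by rewrite /b /flat_exp leNgt => /negbTE ->. Qed.

Let den_gt0 t : 0 < b t + b (1 - t).
Proof.
have [t0|t0] := ltP 0 t; first by rewrite ltr_pwDl// b_gt0.
by rewrite ltr_wpDl// b_gt0//; lra.
Qed.

Definition smooth_step t := b t / (b t + b (1 - t)).

Lemma Ck_smooth_step q : Ck q smooth_step.
Proof.
apply: (@CkM q b (fun t => (b t + b (1 - t))^-1)); first exact: Ck_flat_exp.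
apply: (@CkV q (fun t => b t + b (1 - t))); first by move=> t; rewrite gt_eqF.
apply: (@CkD q b (fun t => b (1 - t))); first exact: Ck_flat_exp.
rewrite (_ : (fun _ => _) = fun t => b (-1 * t + 1)).
  by apply: Ck_affine; exact: Ck_flat_exp.
by apply/funext => t; rewrite mulN1r addrC.
Qed.

Lemma smooth_step_le0 t : t <= 0 -> smooth_step t = 0.
Proof. by move=> t0; rewrite /smooth_step b_le0// mul0r. Qed.

Lemma smooth_step_ge1 t : 1 <= t -> smooth_step t = 1.
Proof.
move=> t1; rewrite /smooth_step (@b_le0 (1 - t)) ?addr0 ?divff//; last by lra.
by rewrite gt_eqF// b_gt0//; lra.
Qed.

Lemma smooth_step_ge0 t : 0 <= smooth_step t.
Proof. by rewrite divr_ge0// ltW. Qed.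

End smooth_step.

Section bumps.
Context {R : realType} {n : nat}.
Notation V := 'rV[R]_n.
Implicit Types (x a : V) (th : R -> R).

Lemma differentiable_coord_comp th (i : 'I_n) x : (forall t, derivable th t 1) ->
  differentiable (fun y : V => th (y 0 i) : R^o) x.
Proof.
move=> dth; apply: (@differentiable_comp _ _ _ _ (fun y : V => y 0 i : R^o) th).
  exact: differentiable_coord.
by apply/derivable1_diffP; exact: dth.
Qed.

Lemma derive_coord_comp th (i : 'I_n) v x : (forall t, derivable th t 1) ->
  'D_v (fun y : V => th (y 0 i) : R^o) x = v 0 i * derive1 th (x 0 i).
Proof.
move=> dth; transitivity ('D_(v 0 i) th (x 0 i)).
  rewrite /derive (_ : (fun h : R => h^-1 *: _) =
    fun h : R => h^-1 *: ((th \o shift (x 0 i)) (h *: v 0 i) - th (x 0 i)))//.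
  by apply/funext => h /=; rewrite !mxE.
have dt : differentiable (th : R^o -> R^o) (x 0 i) by apply/derivable1_diffP.
rewrite derive1E (deriveE _ dt) (deriveE _ dt).
by rewrite -[in LHS](mulr1 (v 0 i)) -[_ * 1]/(v 0 i *: (1 : R^o)) linearZ.
Qed.

Lemma Ck_derive1n th : (forall q, Ck q th) -> forall q t, derivable (derive1n q th) t 1.
Proof.
move=> cth q; elim: q th cth => [|q IH] th cth t.
  by have [] := cth 1%N.
by rewrite derive1Sn; apply: IH => p; have [] := cth p.+1.
Qed.

Lemma iter_derive_coord th (i : 'I_n) vs : (forall q, Ck q th) ->
  iter_derive (fun x : V => th (x 0 i) : R^o) vs =
  fun x => (\prod_(v <- vs) v 0 i) * derive1n (size vs) th (x 0 i).
Proof.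
move=> cth; have dth := Ck_derive1n cth.
elim: vs => [|v vs IH] /=; first by apply/funext => x; rewrite big_nil mul1r.
rewrite IH; apply/funext => x; set c := \prod_(v <- vs) v 0 i.
have := @deriveZ _ _ R^o (fun y : V => derive1n (size vs) th (y 0 i)) c x v.
rewrite big_cons mulrC => ->; last first.
  by apply: diff_derivable; exact: differentiable_coord_comp.
rewrite derive_coord_comp// -derive1nS [c *: _]mulrC.
by rewrite -/c mulrA [X in _ = X * _]mulrC.
Qed.

Lemma smooth_coord th (i : 'I_n) : (forall q, Ck q th) ->
  smooth (fun x : V => th (x 0 i) : R^o).
Proof.
move=> cth vs x; rewrite iter_derive_coord//.
have := @differentiableZ _ _ R^o (fun y : V => derive1n (size vs) th (y 0 i))
  (\prod_(v <- vs) v 0 i) x.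
by apply; apply: differentiable_coord_comp; exact: Ck_derive1n.
Qed.

Lemma smooth_prod_coord th (s : seq 'I_n) : (forall q, Ck q th) ->
  smooth (fun x : V => \prod_(i <- s) th (x 0 i) : R^o).
Proof.
move=> cth; elim: s => [|i s IH].
  rewrite (_ : (fun _ => _) = cst 1); first exact: smooth_cst.
  by apply/funext => x; rewrite big_nil.
rewrite (_ : (fun _ => _) =
    fun x : V => (th (x 0 i) : R^o) *: (\prod_(i <- s) th (x 0 i) : R^o)); last first.
  by apply/funext => x; rewrite big_cons.
by apply: smooth_scaleM => //; exact: smooth_coord.
Qed.

(* Translates of [tile] by the integers add up to [1] because the sum telescopes. *)
Definition tile (t : R) := smooth_step (t + 1) - smooth_step t.

Lemma Ck_tile q : Ck q tile.
Proof.
apply: (@CkD _ q (fun t => smooth_step (t + 1)) (- smooth_step)); last first.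
  by apply: CkN; exact: Ck_smooth_step.
rewrite (_ : (fun _ => _) = fun t => smooth_step (1 * t + 1)).
  by apply: Ck_affine; exact: Ck_smooth_step.
by apply/funext => t; rewrite mul1r.
Qed.

Lemma tile_supp t : tile t != 0 -> `|t| < 1.
Proof.
move=> t0; rewrite ltr_norml; apply/andP; split; rewrite ltNge; apply/negP => h.
  by move/eqP: t0; apply; rewrite /tile !smooth_step_le0 ?subrr//; lra.
by move/eqP: t0; apply; rewrite /tile !smooth_step_ge1 ?subrr//; lra.
Qed.

Lemma sum_tile (N : nat) t : `|t| <= N%:R ->
  \sum_(j < N.*2.+1) tile (t - (j%:R - N%:R)) = 1.
Proof.
rewrite ler_norml => /andP[t1 t2].
have E m : \sum_(j < m) tile (t - (j%:R - N%:R)) =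
    smooth_step (t + N%:R + 1) - smooth_step (t + N%:R + 1 - m%:R).
  elim: m => [|m IH]; first by rewrite big_ord0 subr0 subrr.
  rewrite big_ord_recr /= IH /tile.
  have -> : t - (m%:R - N%:R) + 1 = t + N%:R + 1 - m%:R by ring.
  have -> : t - (m%:R - N%:R) = t + N%:R + 1 - m.+1%:R by rewrite -natr1; ring.
  by ring.
rewrite E smooth_step_ge1 ?smooth_step_le0 ?subr0//; last by lra.
by rewrite -natr1 -muln2 natrM; lra.
Qed.

Definition plateau (t : R) := smooth_step (t + 2) * smooth_step (2 - t).

Lemma Ck_plateau q : Ck q plateau.
Proof.
apply: (@CkM _ q (fun t => smooth_step (t + 2)) (fun t => smooth_step (2 - t))).
  rewrite (_ : (fun _ => _) = fun t => smooth_step (1 * t + 2)).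
    by apply: Ck_affine; exact: Ck_smooth_step.
  by apply/funext => t; rewrite mul1r.
rewrite (_ : (fun _ => _) = fun t => smooth_step (-1 * t + 2)).
  by apply: Ck_affine; exact: Ck_smooth_step.
by apply/funext => t; rewrite mulN1r addrC.
Qed.

Lemma plateau_supp t : plateau t != 0 -> `|t| < 2.
Proof.
move=> t0; rewrite ltr_norml; apply/andP; split; rewrite ltNge; apply/negP => h.
  by move/eqP: t0; apply; rewrite /plateau (@smooth_step_le0 _ (t + 2)) ?mul0r//; lra.
by move/eqP: t0; apply; rewrite /plateau (@smooth_step_le0 _ (2 - t)) ?mulr0//; lra.
Qed.

Lemma plateau1 t : `|t| <= 1 -> plateau t = 1.
Proof.
by rewrite ler_norml => /andP[? ?]; rewrite /plateau !smooth_step_ge1 ?mulr1//; lra.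
Qed.

Lemma plateau_ge0 t : 0 <= plateau t.
Proof. by rewrite mulr_ge0// smooth_step_ge0. Qed.

Definition prod_coord th (x : V) : R^o := \prod_i th (x 0 i).

Lemma prod_coord_supp th (r : R) : 0 <= r -> (forall t, th t != 0 -> `|t| < r) ->
  forall x, prod_coord th x != 0 -> `|x| <= r.
Proof.
move=> r0 h x /prodf_neq0 xn; apply/rV_normP => // i; apply: ltW.
by apply: h; exact: xn.
Qed.

Lemma smooth_prod_coordT th : (forall q, Ck q th) -> smooth (prod_coord th).
Proof. exact: smooth_prod_coord. Qed.

End bumps.

Section test_function_calculus.
Context {R : realType} {n : nat} {Y : normedModType R}.
Notation V := 'rV[R]_n.
Implicit Types (f g : V -> Y) (a x : V) (r : R).

Definition supp_in (Z : normedModType R) (f : V -> Z) a r := forall x, f x != 0 -> `|x - a| <= r.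

Lemma spt_supp_in (Z : normedModType R) (f : V -> Z) a r : supp_in f a r -> spt f `<=` cube a r.
Proof.
by move=> fr; rewrite /spt closureE; apply: smallest_sub; [exact: closed_cube|exact: fr].
Qed.

Lemma supp_in_testfun f a r : smooth f -> supp_in f a r -> f \in @test_function R n Y.
Proof.
move=> sf fr; apply/mem_set; split => //.
apply: (@subclosed_compact _ _ (cube a r)); last exact: spt_supp_in.
  exact: closed_closure.
exact: compact_cube.
Qed.

Lemma test_smooth f : f \in @test_function R n Y -> smooth f.
Proof. by move=> /set_mem[]. Qed.

Lemma test_supp_in f : f \in @test_function R n Y -> exists2 r, 0 < r & supp_in f 0 r.
Proof.
move=> /set_mem[_ /compact_bounded_cube[r r0 fr]]; exists r => // x fx.
by apply: fr; exact: subset_closure.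
Qed.

Lemma test_jet f i r : f \in @test_function R n Y -> exists M, forall x, jet_le i r M f x.
Proof. by move=> /set_mem[sf cf]; exact: jet_le_compact. Qed.

Lemma test_scaleM (Z : normedModType R) (p : V -> R^o) (g : V -> Z) :
  p \in @test_function R n R^o ->
  smooth g -> (fun x => p x *: g x) \in @test_function R n Z.
Proof.
move=> /set_mem[sp cp] sg; apply/mem_set; split; first exact: smooth_scaleM.
apply: (@subclosed_compact _ _ (spt p)) => //; first exact: closed_closure.
by apply: closureS => x /=; apply: contraNneq => ->; rewrite scale0r.
Qed.

Lemma test_scaleMr (Z : normedModType R) (p : V -> R^o) (g : V -> Z) : g \in @test_function R n Z ->
  smooth p -> (fun x => p x *: g x) \in @test_function R n Z.
Proof.
move=> /set_mem[sg cg] sp; apply/mem_set; split; first exact: smooth_scaleM.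
apply: (@subclosed_compact _ _ (spt g)) => //; first exact: closed_closure.
by apply: closureS => x /=; apply: contraNneq => ->; rewrite scaler0.
Qed.

Lemma testD f g : f \in @test_function R n Y -> g \in @test_function R n Y ->
  (fun x => f x + g x) \in @test_function R n Y.
Proof. by move=> tf tg; exact: (rpredD tf tg). Qed.

Lemma testB f g : f \in @test_function R n Y -> g \in @test_function R n Y ->
  (fun x => f x - g x) \in @test_function R n Y.
Proof. by move=> tf tg; exact: (rpredB tf tg). Qed.

Lemma testZ f (c : R) : f \in @test_function R n Y -> (fun x => c *: f x) \in @test_function R n Y.
Proof.
move=> tf; have := (@test_function_submod_closed R n Y).2 c f 0 tf (rpred0 _).
by rewrite addr0.
Qed.

Lemma test_sum (I : Type) (s : seq I) (P : pred I) (F : I -> V -> Y) :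
  (forall i, P i -> F i \in @test_function R n Y) ->
  (fun x => \sum_(i <- s | P i) F i x) \in @test_function R n Y.
Proof.
move=> tF; rewrite (_ : (fun _ => _) = \sum_(i <- s | P i) F i); first exact: rpred_sum.
by apply/funext => x; rewrite fct_sumE.
Qed.

Variable T : {linear testfun n Y -> R^o}.

(** Evaluation on plain functions: a function that is not a test function gets the value [T 0 = 0],
    and membership has to be proved only where linearity or an estimate is used. *)
Definition appl f : R := T (insubd (0 : testfun n Y) f).

Lemma applZD (c : R) f g : f \in @test_function R n Y -> g \in @test_function R n Y ->
  appl (fun x => c *: f x + g x) = c * appl f + appl g.
Proof.
move=> tf tg; have tfg : (fun x => c *: f x + g x) \in @test_function R n Y.
  by apply: testD => //; exact: testZ.
rewrite /appl -[RHS](linearP T); congr (T _); apply/val_inj.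
by rewrite /= !val_insubd tf tg tfg.
Qed.

Lemma appl0 : appl (fun=> 0) = 0.
Proof.
rewrite /appl (_ : insubd _ _ = 0) ?linear0//.
by apply/val_inj; rewrite val_insubd; case: ifP.
Qed.

Lemma applD f g : f \in @test_function R n Y -> g \in @test_function R n Y ->
  appl (fun x => f x + g x) = appl f + appl g.
Proof.
move=> tf tg; rewrite -[appl f]mul1r -applZD//; congr appl.
by apply/funext => x; rewrite scale1r.
Qed.

Lemma applZ f (c : R) : f \in @test_function R n Y -> appl (fun x => c *: f x) = c * appl f.
Proof.
move=> tf; rewrite -[RHS]addr0 -appl0 -applZD//; last exact: rpred0.
by congr appl; apply/funext => x; rewrite addr0.
Qed.

Lemma applB f g : f \in @test_function R n Y -> g \in @test_function R n Y ->
  appl (fun x => f x - g x) = appl f - appl g.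
Proof.
move=> tf tg; rewrite addrC -mulN1r -applZD//; congr appl.
by apply/funext => x; rewrite scaleN1r addrC.
Qed.

Lemma appl_sum (I : Type) (s : seq I) (P : pred I) (F : I -> V -> Y) :
  (forall i, P i -> F i \in @test_function R n Y) ->
  appl (fun x => \sum_(i <- s | P i) F i x) = \sum_(i <- s | P i) appl (F i).
Proof.
move=> tF; elim: s => [|i s IH].
  by rewrite big_nil -[RHS]appl0; congr appl; apply/funext => x; rewrite big_nil.
rewrite big_cons; case: ifPn => Pi.
  rewrite -IH -applD; last exact: test_sum; last exact: tF.
  by congr appl; apply/funext => x; rewrite big_cons Pi.
by rewrite -IH; congr appl; apply/funext => x; rewrite big_cons (negbTE Pi).
Qed.

End test_function_calculus.

Section tiles.
Context {R : realType} {n : nat}.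
Notation V := 'rV[R]_n.
Notation mu := (@lebesgue_rV R n).
Implicit Types (a x : V) (d : R) (N i : nat).

Definition gridix N : finType := {ffun 'I_n -> 'I_(N.*2.+1)}.

Definition node a d N (l : gridix N) : V := \row_i (a 0 i + d * ((l i)%:R - N%:R)).

Definition tile_at a d N (l : gridix N) (x : V) : R^o :=
  prod_coord tile (d^-1 *: (x - node a d l)).

Lemma prod_tile_supp x : prod_coord (@tile R) x != 0 -> `|x| <= 1.
Proof. by apply: prod_coord_supp => // t; exact: tile_supp. Qed.

Lemma smooth_prod_tile : smooth (prod_coord (@tile R) : V -> R^o).
Proof. by apply: smooth_prod_coordT => q; exact: Ck_tile. Qed.

Lemma smooth_tile_at a d N (l : gridix N) : smooth (tile_at a d l).
Proof. exact: smooth_affine smooth_prod_tile. Qed.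

Lemma tile_at_supp a d N (l : gridix N) : 0 < d -> supp_in (tile_at a d l) (node a d l) d.
Proof.
move=> d0 x /prod_tile_supp; rewrite normrZ gtr0_norm ?invr_gt0//.
by rewrite ler_pdivrMl// mulr1.
Qed.

Lemma test_tile_at a d N (l : gridix N) : 0 < d -> tile_at a d l \in @test_function R n R^o.
Proof.
move=> d0; apply: (@supp_in_testfun R n R^o _ (node a d l) d).
  exact: smooth_tile_at.
exact: tile_at_supp.
Qed.

Lemma sum_tile_at a d N x : 0 < d -> `|x - a| <= d * N%:R ->
  \sum_(l : gridix N) tile_at a d l x = 1.
Proof.
move=> d0 xa.
transitivity (\prod_(i < n) \sum_(j < N.*2.+1) tile (d^-1 * (x 0 i - a 0 i) - (j%:R - N%:R))).
  rewrite bigA_distr_bigA; apply: eq_bigr => l _; apply: eq_bigr => i _.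
  rewrite !mxE; congr tile; rewrite opprD addrA mulrBr mulrA mulVf ?gt_eqF//.
  by rewrite mul1r.
rewrite big1// => i _; apply: sum_tile.
rewrite normrM gtr0_norm ?invr_gt0// ler_pdivrMl//.
by have := rV_coord_le (x - a) i; rewrite !mxE => /le_trans; apply.
Qed.

Lemma ex_tile_const i : exists c : R, 1 <= c /\ forall x : V,
  jet_le i 1 c (prod_coord (@tile R) : V -> R^o) x.
Proof.
have [M hM] : exists M, forall x, jet_le i 1 M (prod_coord (@tile R) : V -> R^o) x.
  apply: test_jet; apply: (@supp_in_testfun R n R^o _ 0 1 smooth_prod_tile).
  by move=> x; rewrite subr0; exact: prod_tile_supp.
exists (Num.max 1 M); split; first by rewrite le_max lexx.
by move=> x; apply: jet_le_mono (hM x) => //; rewrite le_max lexx orbT.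
Qed.

Definition tile_const i : R := sval (cid (ex_tile_const i)).

Lemma tile_const_ge1 i : 1 <= tile_const i.
Proof. by rewrite /tile_const; case: cid => c []. Qed.

Lemma jet_tile_at a d N (l : gridix N) i x : 0 < d -> jet_le i d (tile_const i) (tile_at a d l) x.
Proof.
move=> d0; apply: (@jet_le_affine _ _ _ i 1); first exact: smooth_prod_tile.
  by rewrite gtr0_norm ?invr_gt0// mulVf// gt_eqF.
by rewrite /tile_const; case: cid => c [].
Qed.

(** Distinct nodes differ by at least [d] in some coordinate. Disjoint cubes of radius [d / 3]
    around them allow nodes to be counted by volume. *)
Lemma node_disjoint a d N (l l' : gridix N) : 0 < d -> l != l' ->
  cube (node a d l) (d / 3) `&` cube (node a d l') (d / 3) = set0.
Proof.
move=> d0 ll'; rewrite -subset0 => x [xl xl'].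
have [i li] : exists i : 'I_n, l i != l' i.
  apply/existsP; apply: contraNT ll'; rewrite negb_exists => /forallP h.
  by apply/eqP/ffunP => i; apply/eqP; have := h i; rewrite negbK.
have {xl xl'} : `|node a d l 0 i - node a d l' 0 i| <= 2 * d / 3.
  have h1 := rV_coord_le (x - node a d l) i.
  have h2 := rV_coord_le (x - node a d l') i.
  move: h1 h2 xl xl'; rewrite /cube/= !mxE; move=> h1 h2 xl xl'.
  have {}h1 := le_trans h1 xl; have {}h2 := le_trans h2 xl'.
  move: h1 h2; rewrite !ler_norml => /andP[? ?] /andP[? ?]; apply/andP; split; lra.
rewrite !mxE; apply/negP; rewrite -ltNge.
have -> : a 0 i + d * ((l i)%:R - N%:R) - (a 0 i + d * ((l' i)%:R - N%:R)) =
    d * ((l i)%:R - (l' i)%:R) by ring.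
rewrite normrM gtr0_norm// -mulrA mulrCA ltr_pM2l//.
suff h : 1 <= `|(l i)%:R - (l' i)%:R| :> R by apply: lt_le_trans h; lra.
have : l i != l' i :> nat by [].
rewrite neq_ltn => /orP[h|h].
  by rewrite distrC -natrB 1?ltnW// normr_nat ler1n subn_gt0.
by rewrite -natrB 1?ltnW// normr_nat ler1n subn_gt0.
Qed.

Lemma node_count a d N (S : {pred gridix N}) (B : set V) (b : R) : 0 < d -> measurable B ->
  (forall l, l \in S -> cube (node a d l) (d / 3) `<=` B) ->
  (mu B <= b%:E)%E -> #|S|%:R * (2 * d / 3) ^+ n <= b.
Proof.
move=> d0 mB SB Bb.
have := @sum_measure_le R n (gridix N) (enum S) (fun l => cube (node a d l) (d / 3)) B mB
  (enum_uniq _).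
move=> /(_ (fun _ _ => measurable_cube _ _)).
have SB' l : l \in enum S -> cube (node a d l) (d / 3) `<=` B by rewrite mem_enum; exact: SB.
have dis l l' : l \in enum S -> l' \in enum S -> l != l' ->
    cube (node a d l) (d / 3) `&` cube (node a d l') (d / 3) = set0.
  by move=> _ _; exact: node_disjoint.
move=> /(_ SB' dis) /le_trans /(_ Bb).
rewrite big_enum/= (eq_bigr (fun=> ((2 * d / 3) ^+ n)%:E)); last first.
  by move=> l _; rewrite measure_cube ?divr_ge0 ?ltW// mulrA.
by rewrite sumEFin lee_fin sumr_const [X in _ -> X <= _]mulr_natl.
Qed.

(** The cubes of radius [d / 3] around these nodes lie in the cube of radius [4 * d / 3] around [x],
    which has [4 ^ n] times the volume of one of them. *)
Lemma card_tiles_at a d N x : 0 < d ->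
  (#|[pred l : gridix N | (`|x - node a d l| <= d)%R]| <= 4 ^ n)%N.
Proof.
move=> d0; have d30 : 0 < 2 * d / 3 by rewrite divr_gt0// mulr_gt0.
have e4 : 2 * (4 * d / 3) = 4 * (2 * d / 3) by ring.
rewrite -(ler_nat R) natrX -(ler_pM2r (exprn_gt0 n d30)) -exprMn -e4.
apply: (@node_count a d N _ (cube x (4 * d / 3)) _ d0 (measurable_cube _ _)).
  move=> l; rewrite inE => xl; apply: cubeS; rewrite distrC.
  by apply: le_trans (lerD xl (lexx _)) _; lra.
by rewrite measure_cube// divr_ge0// mulr_ge0// ltW.
Qed.

(** The bound does not depend on the size of the grid because at most [4 ^ n] tiles have a nonzero
    jet at [x]. *)
Lemma jet_sum_tile_at a d N (S : {pred gridix N}) i x : 0 < d ->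
  jet_le i d (4 ^+ n * tile_const i) (fun y => \sum_(l in S) tile_at a d l y : R^o) x.
Proof.
move=> d0; have c0 : 0 <= tile_const i by rewrite (le_trans ler01)// tile_const_ge1.
pose Mf (l : gridix N) : R := if `|x - node a d l| <= d then tile_const i else 0.
apply: (@jet_le_mono _ _ _ i i d d (\sum_(l in S) Mf l)) => //; last first.
  apply: jet_le_sum => l _; first exact: smooth_tile_at.
  rewrite /Mf; case: ifPn => xl; first exact: jet_tile_at.
  apply: jet_le_notin_spt => /(spt_supp_in (tile_at_supp d0)).
  by apply/negP; rewrite /cube/=.
apply: le_trans (_ : \sum_(l : gridix N) Mf l <= _).
  rewrite [leRHS](bigID (mem S))/= lerDl sumr_ge0// => l _.
  by rewrite /Mf; case: ifP.
rewrite /Mf -big_mkcond/= sumr_const -[leLHS]mulr_natl ler_wpM2r// -natrX ler_nat.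
exact: card_tiles_at.
Qed.

End tiles.

(** * Restriction to a neighbourhood of a compact set *)

Section local_estimate.
Context {R : realType} {n : nat} {Y : normedModType R}.
Notation V := 'rV[R]_n.
Variables (T : {linear testfun n Y -> R^o}) (i k : nat).
Implicit Types (f g : V -> Y) (a b x : V) (r d M : R).

(* [est j r0 b] bounds [T] on functions supported near [b] by the [i]-th order
   norms, with the homogeneity of a distribution vanishing to order [k] at [b]. *)
Definition est (j r0 : R) b := forall r f M, 0 < r -> r <= r0 ->
  f \in @test_function R n Y -> supp_in f b r -> (forall x, jet_le i r M f x) ->
  `|appl T f| <= j * r ^+ (n + k) * M.

(** A function supported within [r] of [b] is supported within [2 * r] of some good point [b'].
    Using the estimate of [b'] at scale [2 * r] multiplies [r ^+ (n + k)] by [2 ^+ (n + k)] and the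
    jet bound by [2 ^+ i]. *)
Lemma est_closure (j r0 : R) b : closure [set b | est j r0 b] b ->
  est (j * 2 ^+ (n + k + i)) (r0 / 2) b.
Proof.
move=> clb r f M r_gt0 rr0 tf fb fM.
have [b' [eb' bb']] := clb _ (nbhsx_ballx b _ r_gt0).
move: bb'; rewrite mx_norm_ball /ball_/= => bb'.
have := eb' (2 * r) f (2 ^+ i * M).
rewrite exprMn => h; rewrite exprD; apply: le_trans (h _ _ tf _ _) _.
- by rewrite mulr_gt0.
- by rewrite mulrC -ler_pdivlMr.
- move=> x /fb xb; rewrite -(subrKA b) addrC [leRHS]mulrDl !mul1r.
  by apply: le_trans (ler_normD _ _) _; rewrite lerD// ltW.
- by move=> x; apply: jet_le_dilate => //; [exact: test_smooth|rewrite ler1n].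
by rewrite le_eqVlt; apply/orP; left; apply/eqP; ring.
Qed.

Lemma est_mono (j j' r0 r1 : R) b : j <= j' -> r1 <= r0 -> est j r0 b -> est j' r1 b.
Proof.
move=> jj' rr h r f M r_gt0 rr1 tf fb fM; apply: le_trans (h r f M _ _ tf fb fM) _ => //.
  exact: le_trans rr.
by rewrite ler_wpM2r ?ler_wpM2r ?exprn_ge0// ?(ltW r_gt0)// (jet_le_ge0 (fM 0)).
Qed.

(** A tile of radius [d] whose node is within [20 * d] of [b] is supported within [21 * d] of [b]:
    the power of [21] is the passage from scale [d] to scale [21 * d], the rest bounds the product
    of the tile with another function. *)
Definition pieceC : R := 21 ^+ (n + k + i) * 2 ^+ i * tile_const (n := n) i.

Lemma pieceC_ge0 : 0 <= pieceC.
Proof. by rewrite !mulr_ge0// ?exprn_ge0// (le_trans ler01)// tile_const_ge1. Qed.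

Lemma est_piece (j r0 : R) b d N (l : gridix N) (g : V -> Y) M :
  est j r0 b -> 0 < d -> 21 * d <= r0 -> `|node 0 d l - b| <= 20 * d -> smooth g ->
  (forall x, `|x - node 0 d l| <= d -> jet_le i d M g x) ->
  `|appl T (fun x => tile_at 0 d l x *: g x)| <= j * (pieceC * d ^+ (n + k) * M).
Proof.
move=> eb d0 dr0 lb sg gM; have c1 := @tile_const_ge1 R n i.
have M0 : 0 <= M by apply: (jet_le_ge0 (gM (node 0 d l) _)); rewrite subrr normr0 ltW.
have st := @smooth_tile_at R n 0 d N l.
have tt := @test_tile_at R n 0 d N l d0.
have tf := test_scaleM tt sg.
have := eb (21 * d) (fun x => tile_at 0 d l x *: g x)
  (21 ^+ i * (2 ^+ i * (tile_const (n := n) i * M))).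
rewrite exprMn => h; apply: le_trans (h _ _ tf _ _) _.
- by rewrite mulr_gt0.
- exact: dr0.
- move=> x; have [tx|tx _] := eqVneq (tile_at 0 d l x) 0; first by rewrite tx scale0r eqxx.
  have xl := tile_at_supp d0 tx; rewrite -(subrKA (node 0 d l)) addrC.
  apply: le_trans (ler_normD _ _) _; apply: le_trans (lerD lb xl) _; lra.
- move=> x; apply: jet_le_dilate; [exact: smooth_scaleM|by rewrite ler1n|].
  have [xl|xl] := leP `|x - node 0 d l| d.
    by apply: jet_leM => //; [exact: jet_tile_at|exact: gM].
  apply: (@jet_le_mono _ _ _ i i d d 0) => //.
    by rewrite !mulr_ge0// ?exprn_ge0// (le_trans ler01).
  apply: jet_le_notin_spt => sx.
  have : spt (tile_at 0 d l) x.
    by move: sx; apply: closureS => y /=; apply: contraNneq => ->; rewrite scale0r.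
  by move=> /(spt_supp_in (tile_at_supp d0)); rewrite /cube/= leNgt xl.
by rewrite /pieceC le_eqVlt; apply/orP; left; apply/eqP; rewrite !exprD; ring.
Qed.

End local_estimate.

(** Subtracting a constant affects only order zero; every higher order contains at least one
    direction of length at most [d], hence a factor [d]. So on small cubes only the oscillation of
    [f] counts. *)
Lemma jet_le_sub_cst (R : realType) (n : nat) (W : normedModType R) (f : 'rV[R]_n -> W)
    i M (d e : R) y x : smooth f -> 0 <= d -> d <= 1 -> jet_le i 1 M f x -> `|f x - y| <= e ->
  jet_le i d (e + d * M) (fun x => f x - y) x.
Proof.
move=> sf d0 d1 fM fe; have M0 := jet_le_ge0 fM.
have e0 : 0 <= e by exact: le_trans fe.
case: i fM => [_|i fM].
  move=> vs; rewrite leqn0 => /nilP-> _ /=; apply: le_trans fe _.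
  by rewrite lerDl mulr_ge0.
have [f0 Df] := (jet_leS _ _ _ _ _).1 fM.
apply/jet_leS; split; first by apply: le_trans fe _; rewrite lerDl mulr_ge0.
move=> v vd; apply: (@jet_le_mono _ _ _ i i d d (d * M)) => //; first by rewrite lerDr.
have -> : 'D_v (fun x => f x - y) = 'D_v f.
  apply/funext => z; rewrite deriveB.
  - by rewrite derive_cst subr0.
  - by apply: diff_derivable; exact: smooth_differentiable.
  - exact: derivable_cst.
have [d00|dn0] := eqVneq d 0.
  move: vd; rewrite d00 normr_le0 => /eqP->.
  rewrite (_ : 'D_0 f = cst 0); last by apply/funext => z; exact: derive0.
  by rewrite mul0r -(normr0 W); exact: jet_le_cst.
have dp : 0 < d by rewrite lt_def dn0.
have -> : 'D_v f = fun z => d *: 'D_(d^-1 *: v) f z.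
  by apply/funext => z; rewrite -derive_scale_dir// scalerA divff// scale1r.
rewrite -[X in X * M](gtr0_norm dp); apply: jet_leZ; first exact: smooth_derive.
apply: (@jet_le_mono _ _ _ i i 1 d M) => //; apply: Df.
by rewrite normrZ gtr0_norm ?invr_gt0// ler_pdivrMl// mulr1.
Qed.

(** * Dyadic Whitney cutoffs around a compact set *)

Section whitney.
Context {R : realType} {n : nat}.
Notation V := 'rV[R]_n.
Notation mu := (@lebesgue_rV R n).
Variables (C : set V) (Lb : nat).
Hypothesis CLb : forall b, C b -> `|b| + 20 <= Lb%:R.
Hypothesis clC : closed C.
Implicit Types (a b x : V) (r d M : R) (m : nat).

Definition dy m : R := 2 ^- m.
(** With this many nodes the grid of step [dy m] reaches [Lb] at every scale; the margin [20] in
    [CLb] puts all points within [20 * dy m] of [C] inside it. *)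
Definition gridn m := (2 ^ m * Lb)%N.

Lemma dy_gt0 m : 0 < dy m. Proof. by rewrite invr_gt0 exprn_gt0. Qed.

Lemma dyS m : dy m = 2 * dy m.+1.
Proof. by rewrite /dy exprS invfM mulrA divff ?mul1r. Qed.

Lemma dy_le1 m : dy m <= 1.
Proof. by rewrite invf_le1 ?exprn_gt0// exprn_ege1// ler1n. Qed.

Lemma dy_gridn m : dy m * (gridn m)%:R = Lb%:R.
Proof. by rewrite natrM natrX mulrA mulVf ?mul1r// expf_neq0. Qed.

Lemma dy_ndecr m p : (m <= p)%N -> dy p <= dy m.
Proof. by move=> mp; rewrite lef_pV2 ?posrE ?exprn_gt0// ler_weXn2l// ler1n. Qed.

Lemma dy_small (e : R) : 0 < e -> exists m, forall p, (m <= p)%N -> dy p <= e.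
Proof.
move=> e0; have [m _ /(_ m (leqnn _)) /= me] := near_infty_natSinv_lt (PosNum e0).
exists m => p /dy_ndecr /le_trans; apply; apply: le_trans (ltW me).
by rewrite lef_pV2 ?posrE ?exprn_gt0// -natrX ler_nat ltn_expl.
Qed.

Lemma dy_scale r : 0 < r -> r <= 1 -> exists m, dy m <= r /\ r <= 2 * dy m.
Proof.
move=> r0 r1; have [m0 h0] := dy_small r0.
have ex : exists m, dy m <= r by exists m0; exact: h0.
case: (ex_minnP ex) => m mr mmin; exists m; split => //.
case: m mr mmin => [|m] mr mmin; first by rewrite /dy expr0 invr1; lra.
rewrite -dyS leNgt; apply/negP => h.
by have := mmin m (ltW h); rewrite ltnn.
Qed.

(** A tile has radius [dy m], so the threshold [10] makes [cutoff m] equal to [1] within [8 * dy m]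
    of [C] and to [0] beyond [11 * dy m]. Consecutive cutoffs therefore agree within [4 * dy m] of
    [C]. *)
Definition closeto m (l : gridix (gridn m)) : bool :=
  `[< exists2 b, C b & `|node 0 (dy m) l - b| <= 10 * dy m >].

Definition cutoff m (x : V) : R^o := \sum_(l : gridix (gridn m) | closeto l) tile_at 0 (dy m) l x.

Lemma smooth_cutoff m : smooth (cutoff m).
Proof. by apply: smooth_sum => l _; exact: smooth_tile_at. Qed.

Lemma jet_cutoff m i x : jet_le i (dy m) (4 ^+ n * tile_const (n := n) i) (cutoff m) x.
Proof. exact: (@jet_sum_tile_at R n 0 (dy m) _ [pred l | closeto l] i x (dy_gt0 m)). Qed.

Lemma sum_tiles_thick m x b : C b -> `|x - b| <= 20 * dy m ->
  \sum_l tile_at 0 (dy m) (N := gridn m) l x = 1.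
Proof.
move=> Cb xb; apply: sum_tile_at; first exact: dy_gt0.
rewrite dy_gridn subr0 -(subrK b x) addrC.
apply: le_trans (ler_normD _ _) _; apply: le_trans (CLb Cb); rewrite lerD2l.
by apply: le_trans xb _; rewrite ler_piMr// dy_le1.
Qed.

Lemma cutoff1 m x b : C b -> `|x - b| <= 8 * dy m -> cutoff m x = 1.
Proof.
move=> Cb xb; have d0 := dy_gt0 m.
rewrite -(@sum_tiles_thick m x b Cb); last by apply: le_trans xb _; rewrite ler_pM2r// ler_nat.
rewrite [RHS](bigID (@closeto m))/= [X in _ = _ + X]big1 ?addr0// => l nl.
apply/eqP; apply: contraNT nl => /(tile_at_supp d0) xl.
apply/asboolP; exists b => //; apply: le_trans (ler_distD x _ _) _.
by rewrite distrC; apply: le_trans (lerD xl xb) _; lra.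
Qed.

Lemma cutoff_neq0 m x : cutoff m x != 0 -> exists2 b, C b & `|x - b| <= 11 * dy m.
Proof.
move=> ex; have d0 := dy_gt0 m.
have [l cl tl] : exists2 l : gridix (gridn m), closeto l & tile_at 0 (dy m) l x != 0.
  apply: contrapT => nl; move/eqP: ex; apply; rewrite /cutoff big1// => l cl.
  have [//|tl] := eqVneq (tile_at 0 (dy m) l x) 0.
  by exfalso; apply: nl; exists l.
have [b Cb lb] := asboolP _ cl.
exists b => //; have xl := tile_at_supp d0 tl.
apply: le_trans (ler_distD (node 0 (dy m) l) _ _) _.
by apply: le_trans (lerD xl lb) _; lra.
Qed.

Definition far (B : set V) (t : R) : R := fine (mu (B `\` thick C t)).

Lemma mu_far B t : measurable B -> (mu B < +oo)%E -> 0 < t ->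
  mu (B `\` thick C t) = (far B t)%:E.
Proof.
move=> mB Boo t0; rewrite /far fineK// ge0_fin_numE//.
apply: le_lt_trans Boo; apply: le_measure; rewrite ?inE//.
by apply: measurableD => //; exact: measurable_thick.
Qed.

Lemma far_ge0 B t : 0 <= far B t.
Proof. exact: fine_ge0. Qed.

Lemma far_annulus B s t : measurable B -> (mu B < +oo)%E -> 0 < s -> s <= t ->
  mu ((B `\` thick C s) `\` (B `\` thick C t)) = (far B s - far B t)%:E.
Proof.
move=> mB Boo s0 st; have t0 := lt_le_trans s0 st.
have ms : measurable (B `\` thick C s) by apply: measurableD => //; exact: measurable_thick.
have mt : measurable (B `\` thick C t) by apply: measurableD => //; exact: measurable_thick.
rewrite measureD//; last first.
  by apply: le_lt_trans Boo; apply: le_measure; rewrite ?inE// => x [].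
rewrite (_ : _ `&` _ = B `\` thick C t); 
  first by rewrite EFinB -(mu_far mB Boo s0) -(mu_far mB Boo t0).
apply/seteqP; split => [x []//|x [Bx tx]]; split=> //; split => // -[b Cb xb].
by apply: tx; exists b => //; exact: lt_le_trans st.
Qed.

Lemma far_le B t v : measurable B -> (mu B < +oo)%E -> 0 < t ->
  (mu (B `\` C) <= v%:E)%E -> far B t <= v.
Proof.
move=> mB Boo t0; rewrite -lee_fin -mu_far//; apply: le_trans.
apply: le_measure; rewrite ?inE//.
- by apply: measurableD => //; exact: measurable_thick.
- by apply: measurableD => //; exact: closed_measurable_rV.
- by move=> x [Bx tx]; split => // Cx; apply: tx; exists x => //; rewrite subrr normr0.
Qed.

End whitney.

(** Used for annuli around [C] of which three consecutive ones overlap; hence three telescoping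
    sums. *)
Lemma sum_telescope3 (R : realType) (G : nat -> R) (B : R) Q :
  (forall q, 0 <= G q <= B) -> \sum_(q < Q) (G q.+3 - G q) <= 3 * B.
Proof.
move=> GB; have -> : \sum_(q < Q) (G q.+3 - G q) = G Q + G Q.+1 + G Q.+2 - (G 0%N + G 1%N + G 2%N).
  by elim: Q => [|Q IH]; rewrite ?big_ord0 ?subrr// big_ord_recr/= IH; ring.
have := GB Q; have := GB Q.+1; have := GB Q.+2; have := GB 0%N; have := GB 1%N; have := GB 2%N.
by do 6 (move=> /andP[? ?]); lra.
Qed.

Section whitney_sum.
Context {R : realType} {n : nat} {Y : normedModType R}.
Notation V := 'rV[R]_n.
Notation mu := (@lebesgue_rV R n).
Variables (T : {linear testfun n Y -> R^o}) (i k : nat) (j r0 : R).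
Variables (C : set V) (Lb : nat).
Hypothesis CLb : forall b, C b -> `|b| + 20 <= Lb%:R.
Hypothesis clC : closed C.
Hypothesis estC : forall b, C b -> est T i k j r0 b.
Hypothesis j_ge0 : 0 <= j.
Implicit Types (f g : V -> Y) (a b x : V) (r d M : R) (m : nat).

Let cutoff := cutoff C Lb.

Definition etaC : R := 4 ^+ n * tile_const (n := n) i.

Lemma etaC_ge0 : 0 <= etaC.
Proof. by rewrite mulr_ge0 ?exprn_ge0// (le_trans ler01)// tile_const_ge1. Qed.

Definition touches (p : V -> R^o) f m : {pred gridix (gridn Lb m)} :=
  [pred l | `[< exists x, [/\ tile_at 0 (dy m) l x != 0, p x != 0 & f x != 0] >]].

Arguments touches : clear implicits.

(* On the support of [p *: f] the tiles of scale [m] add up to [1]. *)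
Lemma appl_tiles (p : V -> R^o) f m : smooth p -> f \in @test_function R n Y ->
  (forall x, p x != 0 -> exists2 b, C b & `|x - b| <= 20 * dy m) ->
  appl T (fun x => p x *: f x) =
  \sum_(l in touches p f m) appl T (fun x => tile_at 0 (dy m) l x *: (p x *: f x)).
Proof.
move=> sp tf pC; have sf := test_smooth tf.
rewrite -appl_sum; last first.
  move=> l _; apply: test_scaleM; first exact/test_tile_at/dy_gt0.
  exact: smooth_scaleM.
congr appl; apply/funext => x; rewrite -scaler_suml.
have [->|px] := eqVneq (p x) 0; first by rewrite scale0r scaler0.
have [->|fx] := eqVneq (f x) 0; first by rewrite !scaler0.
have [b Cb xb] := pC x px.
rewrite -[LHS]scale1r -(sum_tiles_thick CLb Cb xb); congr (_ *: _).
rewrite (bigID (mem (touches p f m)))/= [X in _ + X]big1 ?addr0// => l nl.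
by have [//|tl] := eqVneq (tile_at 0 (dy m) l x) 0; move/asboolP: nl; case; exists x.
Qed.

Lemma touches_near (p : V -> R^o) f m l : l \in touches p f m ->
  exists x, [/\ `|x - node 0 (dy m) l| <= dy m, p x != 0 & f x != 0].
Proof. by move=> /asboolP[x [/(tile_at_supp (dy_gt0 m)) xl px fx]]; exists x. Qed.

(** [(1 + 2 ^+ i) * etaC] bounds the jet of a difference of two consecutive cutoffs, the second one
    dilated to the coarser scale; [(3 / 2) ^+ n] converts the volume [(2 * d / 3) ^+ n] of the
    counting cubes into [d ^+ n]. *)
Definition layerC : R := pieceC (n := n) (R := R) i k * (2 ^+ i * ((1 + 2 ^+ i) * etaC))
  * (3 / 2) ^+ n.

Lemma layerC_ge0 : 0 <= layerC.
Proof.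
have pC := @pieceC_ge0 R n i k; have eC := etaC_ge0.
by rewrite /layerC; repeat apply: mulr_ge0 => //; rewrite ?addr_ge0 ?exprn_ge0 ?divr_ge0.
Qed.

(** The difference of the cutoffs lives between the distances [4 * d] and [11 * d] from [C]. The
    counting cubes of the tiles that meet it lie in the cube of radius [3 * r] and between the
    distances [2 * d] and [16 * d], so the number of tiles times [d ^+ n] is at most a constant
    times the measure of this annulus, which misses [C]. *)
Lemma layer_le f a r M m : f \in @test_function R n Y -> supp_in f a r ->
  (forall x, jet_le i r M f x) -> dy m <= r -> 21 * dy m <= r0 ->
  `|appl T (fun x => (cutoff m x - cutoff m.+1 x) *: f x)| <=
  j * layerC * dy m ^+ k * M *
    (far C (cube a (3 * r)) (2 * dy m) - far C (cube a (3 * r)) (16 * dy m)).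
Proof.
move=> tf fr fM mr mr0; have d0 := dy_gt0 (R := R) m; set d := dy m in d0 mr mr0 *.
have M0 := jet_le_ge0 (fM 0); have sf := test_smooth tf.
have dm1 : dy m.+1 = d / 2 by rewrite /d (dyS m) mulrC mulKf.
pose p : V -> R^o := fun x => cutoff m x - cutoff m.+1 x.
have sp : smooth p by apply: smoothB; exact: smooth_cutoff.
have p_near x : p x != 0 -> exists2 b, C b & `|x - b| <= 11 * d.
  move=> px; have [e0|/cutoff_neq0//] := eqVneq (cutoff m x) 0.
  have [e1|/cutoff_neq0[b Cb xb]] := eqVneq (cutoff m.+1 x) 0.
    by move: px; rewrite /p e0 e1 subrr eqxx.
  by exists b => //; apply: le_trans xb _; rewrite dm1; lra.
have p_far x b : p x != 0 -> C b -> 4 * d < `|x - b|.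
  move=> px Cb; rewrite ltNge; apply/negP => xb; move/eqP: px; apply.
  rewrite /p /cutoff !(@cutoff1 _ _ _ _ CLb _ x b Cb) ?subrr//.
    by apply: le_trans xb _; rewrite dm1; lra.
  by apply: le_trans xb _; rewrite -/d; lra.
rewrite -/(p _) (_ : (fun x => _) = fun x => p x *: f x)// (@appl_tiles p f m)//; last first.
  by move=> x /p_near[b Cb xb]; exists b => //; apply: le_trans xb _; rewrite -/d; lra.
have jp x : jet_le i d ((1 + 2 ^+ i) * etaC) p x.
  rewrite mulrDl mul1r; apply: jet_leB; [exact: smooth_cutoff|exact: smooth_cutoff|exact:
    jet_cutoff|].
  rewrite /d dyS; apply: jet_le_dilate; [exact: smooth_cutoff|by rewrite ler1n|exact: jet_cutoff].
have jpf x : jet_le i d (2 ^+ i * (((1 + 2 ^+ i) * etaC) * M)) (fun x => p x *: f x) x.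
  by apply: jet_leM => //; apply: jet_le_mono (fM x).
have piece l : l \in touches p f m ->
    `|appl T (fun x => tile_at 0 d l x *: (p x *: f x))| <=
    j * (pieceC (n := n) (R := R) i k * d ^+ (n + k) * (2 ^+ i * (((1 + 2 ^+ i) * etaC) * M))).
  move=> /touches_near[x [xl px fx]]; have [b Cb xb] := p_near x px.
  apply: (est_piece (estC Cb) d0 mr0) => //; last exact: smooth_scaleM.
  apply: le_trans (ler_distD x _ _) _; rewrite distrC.
  by apply: le_trans (lerD xl xb) _; rewrite -/d; lra.
apply: le_trans (ler_norm_sum _ _ _) _; apply: le_trans (ler_sum _ piece) _.
rewrite sumr_const.
have mB := measurable_cube a (3 * r); have r_gt0 : 0 < r by exact: lt_le_trans d0 mr.
have Boo : (mu (cube a (3 * r)) < +oo)%E by rewrite measure_cube ?ltry// mulr_ge0// ltW.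
have d16 : 0 < 16 * d by rewrite mulr_gt0.
have d2 : 0 < 2 * d by rewrite mulr_gt0.
have cnt := @node_count R n 0 d _ (touches p f m) _ (far C (cube a (3 * r)) (2 * d)
  - far C (cube a (3 * r)) (16 * d)) d0
  (measurableD (measurableD mB (measurable_thick C d2)) (measurableD mB (measurable_thick C d16))).
have {cnt} : #|touches p f m|%:R * (2 * d / 3) ^+ n <=
    far C (cube a (3 * r)) (2 * d) - far C (cube a (3 * r)) (16 * d).
  apply: cnt; last by rewrite far_annulus// ler_pM2r// ler_nat.
  move=> l /touches_near[x []]; rewrite -/d => xl px fx z; rewrite /cube/= => zl.
  have xz : `|x - z| <= 4 * d / 3.
    apply: le_trans (ler_distD (node 0 d l) _ _) _.
    by rewrite [X in _ + X]distrC; apply: le_trans (lerD xl zl) _; lra.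
  split; first split.
  - rewrite /=; apply: le_trans (ler_distD x _ _) _; rewrite distrC.
    by apply: le_trans (lerD xz (fr _ fx)) _; lra.
  - move=> [b Cb zb]; have := p_far x b px Cb; apply/negP; rewrite -leNgt.
    by apply: le_trans (ler_distD z _ _) _; apply: le_trans (lerD xz (ltW zb)) _; lra.
  - move=> [_]; apply; have [b Cb xb] := p_near x px; exists b => //.
    apply: le_lt_trans (ler_distD x _ _) _; rewrite distrC.
    by apply: le_lt_trans (lerD xz xb) _; lra.
set F := far _ _ _ - _ => cnt.
have -> : j * layerC * d ^+ k * M * F = j * (pieceC (n := n) (R := R) i k * d ^+ k *
    (2 ^+ i * (((1 + 2 ^+ i) * etaC) * M))) * ((3 / 2) ^+ n * F).
  by rewrite /layerC; ring.
apply: le_trans (_ : j * (pieceC (n := n) (R := R) i k * d ^+ k *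
    (2 ^+ i * (((1 + 2 ^+ i) * etaC) * M))) * ((3 / 2) ^+ n
      * (#|touches p f m|%:R * (2 * d / 3) ^+ n)) <= _).
  rewrite -[leLHS]mulr_natl le_eqVlt; apply/orP; left; apply/eqP.
  have -> : (3 / 2) ^+ n * (#|touches p f m|%:R * (2 * d / 3) ^+ n) = #|touches p f m|%:R * d ^+ n.
    rewrite mulrCA -exprMn; congr (_ * _ ^+ _); first by field.
  by rewrite exprD; ring.
rewrite ler_wpM2l//; last by rewrite ler_wpM2l// exprn_ge0.
have pC := @pieceC_ge0 R n i k; have eC := etaC_ge0.
by nonneg.
Qed.

End whitney_sum.

Section whitney_limit.
Context {R : realType} {n : nat} {Y : normedModType R}.
Notation V := 'rV[R]_n.
Notation mu := (@lebesgue_rV R n).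
Variables (T : {linear testfun n Y -> R^o}) (i k : nat) (j r0 : R).
Variables (C : set V) (Lb : nat).
Hypothesis CLb : forall b, C b -> `|b| + 20 <= Lb%:R.
Hypothesis clC : closed C.
Hypothesis estC : forall b, C b -> est T i k j r0 b.
Hypothesis j_ge0 : 0 <= j.
Implicit Types (f g : V -> Y) (a b x : V) (r d M : R) (m : nat).

Local Notation cutoff := (cutoff C Lb).
Local Notation pC := (pieceC (n := n) (R := R) i k).
Local Notation eC := (etaC (n := n) (R := R) i).
Local Notation lC := (layerC (n := n) (R := R) i k).

Lemma far_mono (B : set V) s t : measurable B -> (mu B < +oo)%E -> 0 < s -> s <= t ->
  far C B t <= far C B s.
Proof.
move=> mB Boo s0 st; rewrite -subr_ge0 -lee_fin -far_annulus//; exact: measure_ge0.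
Qed.

Lemma whitney_sum_le f a r M m0 v Q : f \in @test_function R n Y -> supp_in f a r ->
  (forall x, jet_le i r M f x) -> dy m0 <= r -> 21 * dy m0 <= r0 ->
  (mu (cube a (3 * r) `\` C) <= v%:E)%E ->
  \sum_(q < Q) `|appl T (fun x => cutoff (m0 + q)%N x *: f x) -
    appl T (fun x => cutoff (m0 + q).+1 x *: f x)| <= 3 * (j * lC * r ^+ k * M * v).
Proof.
move=> tf fr fM mr mr0 hv.
have tef p : (fun x => cutoff p x *: f x) \in @test_function R n Y.
  by apply: test_scaleMr => //; exact: smooth_cutoff.
have M0 := jet_le_ge0 (fM 0).
have r_gt0 : 0 < r by exact: lt_le_trans (dy_gt0 m0) mr.
pose B := cube a (3 * r).
have mB : measurable B := measurable_cube a (3 * r).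
have Boo : (mu B < +oo)%E by rewrite measure_cube ?ltry// mulr_ge0// ltW.
pose G q := far C B (16 * dy (m0 + q)).
have G16 q : 0 < 16 * dy (m0 + q) :> R by rewrite mulr_gt0// dy_gt0.
have GB q : 0 <= G q <= v.
  by rewrite /G far_ge0/=; apply: far_le.
(* The inner radius of the annulus of scale [p] is the outer radius of the one of scale [p + 3], so
   the annuli sum as in [sum_telescope3]. *)
have e16 p : 2 * dy p = 16 * dy p.+3 :> R.
  by rewrite dyS (dyS p.+1) (dyS p.+2); ring.
have step q : `|appl T (fun x => cutoff (m0 + q)%N x *: f x)
  - appl T (fun x => cutoff (m0 + q).+1 x *: f x)|
    <= j * lC * r ^+ k * M * (G q.+3 - G q).
  rewrite -applB//.
  rewrite (_ : (fun x => _) = fun x => (cutoff (m0 + q)%N x - cutoff (m0 + q).+1 x) *: f x);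
    last first.
    by apply/funext => x; rewrite scalerBl.
  have dq : dy (m0 + q) <= dy m0 :> R by apply: dy_ndecr; exact: leq_addr.
  have mr1 : 21 * dy (m0 + q) <= r0 by apply: le_trans mr0; rewrite ler_pM2l.
  have h := layer_le CLb estC j_ge0 tf fr fM (le_trans dq mr) mr1.
  apply: le_trans h _.
  rewrite e16 /G !addnS ler_wpM2r//.
    rewrite subr_ge0; apply: far_mono => //; first by rewrite mulr_gt0// dy_gt0.
    by rewrite ler_pM2l//; apply: dy_ndecr; rewrite -!addnS leq_add2l -addn3 leq_addr.
  rewrite ler_wpM2r// ler_wpM2l//; first by rewrite mulr_ge0// layerC_ge0.
  by rewrite lerXn2r ?nnegrE ?(ltW (dy_gt0 _)) ?(ltW r_gt0)// (le_trans dq).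
apply: le_trans (_ : \sum_(q < Q) j * lC * r ^+ k * M * (G q.+3 - G q) <= _).
  by apply: ler_sum => q _; exact: step.
rewrite -mulr_sumr [leRHS]mulrCA ler_wpM2l//; last exact: sum_telescope3.
by have h := @layerC_ge0 R n i k; nonneg.
Qed.

Lemma whitney_le f a r M m0 v : f \in @test_function R n Y -> supp_in f a r ->
  (forall x, jet_le i r M f x) -> dy m0 <= r -> 21 * dy m0 <= r0 ->
  (mu (cube a (3 * r) `\` C) <= v%:E)%E -> forall m, (m0 <= m)%N ->
  `|appl T (fun x => cutoff m0 x *: f x) - appl T (fun x => cutoff m x *: f x)| <=
  3 * (j * lC * r ^+ k * M * v).
Proof.
move=> tf fr fM mr mr0 hv m /subnKC <-; set Q := (m - m0)%N.
apply: le_trans (whitney_sum_le Q tf fr fM mr mr0 hv).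
elim: (Q) => [|q IH]; first by rewrite addn0 subrr normr0 big_ord0.
by rewrite big_ord_recr/= addnS; apply: le_trans (ler_distD _ _ _) (lerD IH _).
Qed.

(** Starting at the scale with [dy m0 <= r <= 2 * dy m0], the first cutoff is [1] on the support of
    [f], because [a] lies in [C]; the telescoping sum thus starts at [T f] itself. *)
Lemma whitney_pt f a r M v : C a -> 0 < r -> r <= 1 -> 21 * r <= r0 ->
  f \in @test_function R n Y -> supp_in f a r -> (forall x, jet_le i r M f x) ->
  (mu (cube a (3 * r) `\` C) <= v%:E)%E ->
  exists m0, forall m, (m0 <= m)%N ->
  `|appl T f - appl T (fun x => cutoff m x *: f x)| <= 3 * (j * lC * r ^+ k * M * v).
Proof.
move=> Ca r_gt0 r1 rr0 tf fr fM hv; have [m0 [m0r rm0]] := dy_scale r_gt0 r1.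
exists m0 => m m0m.
have := @whitney_le f a r M m0 v tf fr fM m0r _ hv m m0m.
rewrite (_ : (fun x => cutoff m0 x *: f x) = f).
  by apply; apply: le_trans rr0; rewrite ler_pM2l.
apply/funext => x; have [->|fx] := eqVneq (f x) 0; first by rewrite scaler0.
rewrite (@cutoff1 R n C Lb CLb m0 x a Ca) ?scale1r//.
apply: le_trans (fr x fx) _; apply: le_trans rm0 _.
by rewrite ler_pM2r ?dy_gt0// ler_nat.
Qed.

Local Notation S f m := (@touches R n Y Lb (cutoff m) f m).

Lemma touches_supp_count f a r m : supp_in f a r -> 0 < r -> dy m <= r ->
  #|S f m|%:R * dy m ^+ n <= (9 * r) ^+ n.
Proof.
move=> fr r_gt0 dr; have d0 := dy_gt0 (R := R) m.
have h : #|S f m|%:R * (2 * dy m / 3) ^+ n <= (2 * (r + 2 * dy m)) ^+ n.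
  apply: (@node_count R n 0 (dy m) _ (S f m) (cube a (r + 2 * dy m)) _ d0 (measurable_cube _ _)).
    move=> l /touches_near[x [xl _ fx]] z; rewrite /cube/= => zl.
    apply: le_trans (ler_distD x _ _) _; rewrite addrC lerD ?fr//.
    apply: le_trans (ler_distD (node 0 (dy m) l) _ _) _.
    by rewrite [X in _ + X]distrC; apply: le_trans (lerD zl xl) _; lra.
  by rewrite measure_cube// addr_ge0 ?mulr_ge0// ltW.
have -> : #|S f m|%:R * dy m ^+ n = (3 / 2) ^+ n * (#|S f m|%:R * (2 * dy m / 3) ^+ n) :> R.
  by rewrite mulrCA -exprMn; congr (_ * _ ^+ _); field.
apply: le_trans (ler_wpM2l _ h) _; first by rewrite exprn_ge0// divr_ge0.
by rewrite -exprMn; apply: lerXn2r; rewrite ?nnegrE; [nonneg|nonneg|lra].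
Qed.

Lemma touches_count f m : #|S f m|%:R * dy m ^+ n <= (3 * Lb%:R) ^+ n :> R.
Proof.
have d0 := dy_gt0 (R := R) m.
have h : #|S f m|%:R * (2 * dy m / 3) ^+ n <= (2 * Lb%:R) ^+ n :> R.
  apply: (@node_count R n 0 (dy m) _ (S f m) (cube 0 Lb%:R) _ d0 (measurable_cube _ _)).
    move=> l /touches_near[x [xl ex fx]] z; rewrite /cube/= subr0 => zl.
    have [b Cb xb] := cutoff_neq0 ex.
    rewrite -(subrK b z) addrC; apply: le_trans (ler_normD _ _) _; apply: le_trans (CLb Cb).
    rewrite lerD2l; apply: le_trans (ler_distD x _ _) _.
    have zx : `|z - x| <= 2 * dy m.
      apply: le_trans (ler_distD (node 0 (dy m) l) _ _) _.
      by rewrite [X in _ + X]distrC; apply: le_trans (lerD zl xl) _; lra.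
    by apply: le_trans (lerD zx xb) _; have := dy_le1 (R := R) m; lra.
  by rewrite measure_cube.
have -> : #|S f m|%:R * dy m ^+ n = (3 / 2) ^+ n * (#|S f m|%:R * (2 * dy m / 3) ^+ n) :> R.
  by rewrite mulrCA -exprMn; congr (_ * _ ^+ _); field.
apply: le_trans (ler_wpM2l _ h) _; first by rewrite exprn_ge0// divr_ge0.
by rewrite -exprMn; apply: lerXn2r; rewrite ?nnegrE; [nonneg|nonneg|lra].
Qed.

(** Replaces [f] by a constant on each tile. On a tile the jet of the difference is at most
    [e + dy m * M], so the derivatives of [f] become irrelevant as the scale tends to [0]. *)
Lemma cutoff_values f M m (e : R) (y : gridix (gridn Lb m) -> Y) :
  f \in @test_function R n Y -> (forall x, jet_le i 1 M f x) -> 21 * dy m <= r0 ->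
  (forall l x, l \in S f m -> `|x - node 0 (dy m) l| <= dy m -> `|f x - y l| <= e) ->
  `|appl T (fun x => cutoff m x *: f x) -
    \sum_(l in S f m) appl T (fun x => tile_at 0 (dy m) l x *: (cutoff m x *: y l))| <=
  #|S f m|%:R * (j * (pC * dy m ^+ (n + k) * (2 ^+ i * (eC * (e + dy m * M))))).
Proof.
move=> tf fM mr0 fy; have sf := test_smooth tf; have se := smooth_cutoff C Lb m.
have d0 := dy_gt0 (R := R) m.
rewrite (@appl_tiles _ _ _ T _ _ CLb _ _ m se tf); last first.
  move=> x /cutoff_neq0[b Cb xb]; exists b => //; apply: le_trans xb _.
  by rewrite ler_pM2r// ler_nat.
have scy c : smooth (cst c : V -> Y) by exact: smooth_cst.
have ttf l (g : V -> Y) : smooth g -> (fun x => tile_at 0 (dy m) l x *: (cutoff m x *: g x)) \in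
  @test_function R n Y.
  by move=> sg; apply: test_scaleM; [exact: test_tile_at|exact: smooth_scaleM].
rewrite -sumrB; apply: le_trans (ler_norm_sum _ _ _) _.
rewrite mulr_natl -sumr_const; apply: ler_sum => l lS.
rewrite -applB; [|exact: ttf|exact: (ttf _ l (cst (y l)) (scy _))].
rewrite (_ : (fun x => _) = fun x => tile_at 0 (dy m) l x *: (cutoff m x *: (f x - y l)));
  last first.
  by apply/funext => x; rewrite -scalerBr -scalerBr.
have [x [xl ex fx]] := touches_near lS; have [b Cb xb] := cutoff_neq0 ex.
have sfy : smooth (fun x => f x - y l) by exact: (@smoothB _ _ _ f (cst (y l))).
apply: (est_piece (estC Cb) d0 mr0).
- apply: le_trans (ler_distD x _ _) _; rewrite distrC.
  by apply: le_trans (lerD xl xb) _; lra.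
- exact: smooth_scaleM.
- move=> z zl; apply: jet_leM => //; first exact: jet_cutoff.
  by apply: jet_le_sub_cst => //; [exact: ltW|exact: dy_le1|exact: fy].
Qed.

(** The comparison with the constant [0]: near [C] only the sup norm of [f] survives, since its
    derivatives enter with the factor [dy m]. The factor [dy m ^+ k] makes this part vanish in the
    limit when [k] is positive. *)
Lemma cutoff_bound f a r (M0 e : R) : f \in @test_function R n Y -> supp_in f a r -> 0 < r ->
  0 < r0 -> (forall x, `|f x| <= M0) -> 0 < e ->
  exists m0, forall m, (m0 <= m)%N -> `|appl T (fun x => cutoff m x *: f x)| <=
    j * (pC * 2 ^+ i * eC * (9 * r) ^+ n) * dy m ^+ k * (M0 + e).
Proof.
move=> tf fr r_gt0 r0_gt0 fM0 e0; have [M fM] := test_jet i 1 tf.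
have M0' := jet_le_ge0 (fM 0).
have M00 : 0 <= M0 by exact: le_trans (fM0 0).
have [m1 h1] := dy_small r_gt0.
have [m2 h2] := dy_small (divr_gt0 r0_gt0 (ltr0n R 21)).
have [m3 h3] := dy_small (divr_gt0 e0 (ltr_pwDr ltr01 M0')).
exists (maxn m1 (maxn m2 m3)) => m; rewrite !geq_max => /and3P[/h1 d1 /h2 d2 /h3 d3].
have d0 := dy_gt0 (R := R) m.
have := @cutoff_values f M m M0 (fun=> 0) tf fM _ _; rewrite big1 ?subr0; last first.
  move=> l _; rewrite -[RHS](appl0 T); congr appl; apply/funext => x.
  by rewrite !scaler0.
move=> /(_ _ _)/le_trans; apply.
- by rewrite mulrC -ler_pdivlMr.
- by move=> l x _ _; rewrite subr0.
have -> : #|S f m|%:R * (j * (pC * dy m ^+ (n + k) * (2 ^+ i * (eC * (M0 + dy m * M))))) =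
   (j * (pC * 2 ^+ i * eC) * dy m ^+ k) * (#|S f m|%:R * dy m ^+ n * (M0 + dy m * M)).
  by rewrite exprD; ring.
have -> : j * (pC * 2 ^+ i * eC * (9 * r) ^+ n) * dy m ^+ k * (M0 + e) =
   (j * (pC * 2 ^+ i * eC) * dy m ^+ k) * ((9 * r) ^+ n * (M0 + e)) by ring.
have hp := @pieceC_ge0 R n i k; have he := @etaC_ge0 R n i.
apply: ler_wpM2l; first by nonneg.
apply: ler_pM; [by nonneg|by nonneg|exact: (touches_supp_count fr)|].
rewrite lerD2l; apply: le_trans (ler_wpM2r M0' d3) _.
by rewrite mulrAC ler_pdivrMr ?ltr_pwDr// ler_pM2l// lerDl.
Qed.

End whitney_limit.

Section density_estimate.
Context {R : realType} {n : nat} {Y : normedModType R}.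
Notation V := 'rV[R]_n.
Notation mu := (@lebesgue_rV R n).
Variables (T : {linear testfun n Y -> R^o}) (i k : nat) (j r0 : R) (C : set V).
Hypothesis cC : compact C.
Hypothesis estC : forall b, C b -> est T i k j r0 b.
Hypothesis j_ge0 : 0 <= j.
Hypothesis r0_gt0 : 0 < r0.

Lemma compact_nat_bound : exists Lb : nat, forall b, C b -> `|b| + 20 <= Lb%:R.
Proof.
have [L L0 CL] := compact_bounded_cube cC.
exists (Num.bound (L + 20)) => b /CL; rewrite /cube/= subr0 => bL.
have := archi_boundP (ltW (addr_gt0 L0 (ltr0n R 20))).
by move=> /ltW; apply: le_trans; rewrite lerD2r.
Qed.

Lemma closed_of_compact : closed C.
Proof. by apply: compact_closed => //; exact: norm_hausdorff. Qed.

Lemma density_cube a (e : R) : density_pt C a -> 0 < e -> exists2 d, 0 < d &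
  forall r, 0 < r -> r < d -> (mu (cube a (3 * r) `\` C) <= (e * r ^+ n)%:E)%E.
Proof.
move=> da e0; have [d d0 h] := da _ (divr_gt0 e0 (exprn_gt0 n (ltr0n R 3))).
exists (d / 3); first by rewrite divr_gt0.
move=> r r_gt0 rd; apply: le_trans (h (3 * r) _ _) _.
- by rewrite mulr_gt0.
- by rewrite mulrC -ltr_pdivlMr.
by rewrite lee_fin exprMn mulrA divfK// expf_neq0.
Qed.

Definition pointC : R := pieceC (n := n) (R := R) i k * 2 ^+ i * etaC (n := n) (R := R) i * 9 ^+ n.

Lemma pointC_ge0 : 0 <= pointC.
Proof. by have h := @pieceC_ge0 R n i k; have h' := @etaC_ge0 R n i; rewrite /pointC; nonneg. Qed.

(** The first term is the part off [C], small by density. The second is the part carried by [C]: it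
    disappears for [k > 0], and for [k = 0] it sees only the sup norm of [f], a fact on which the
    approximation arguments below rest. *)
Lemma density_estimate a (e : R) : C a -> density_pt C a -> 0 < e -> exists2 d, 0 < d &
  forall r (f : V -> Y) M M0, 0 < r -> r < d -> f \in @test_function R n Y -> supp_in f a r ->
    (forall x, jet_le i r M f x) -> (forall x, `|f x| <= M0) ->
    `|appl T f| <= e * r ^+ (n + k) * M + (k == 0)%:R * (j * pointC * r ^+ n * M0).
Proof.
move=> Ca da e0; have [Lb CLb] := compact_nat_bound; have clC := closed_of_compact.
pose l := layerC (n := n) (R := R) i k; have l0 : 0 <= l := layerC_ge0 _ _.
have jl : 0 < 3 * (j * l) + 1 by rewrite ltr_wpDl// mulr_ge0// mulr_ge0.
have [d d0 dv] := density_cube da (divr_gt0 e0 jl).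
exists (Num.min d (Num.min 1 (r0 / 21))).
  by rewrite !lt_min d0 ltr01 divr_gt0.
move=> r f M M0 r_gt0; rewrite !lt_min => /and3P[rd r1 rr0] tf fr fM fM0.
have M_ge0 := jet_le_ge0 (fM 0); have M0_ge0 : 0 <= M0 by exact: le_trans (fM0 0).
have rr0' : 21 * r <= r0 by rewrite mulrC -ler_pdivlMr// ltW.
have [m0 hm0] := whitney_pt CLb clC estC j_ge0 Ca r_gt0 (ltW r1) rr0' tf fr fM (dv r r_gt0 rd).
set A := 3 * _ in hm0.
have AE : A <= e * r ^+ (n + k) * M.
  rewrite /A -/l; set w := e / _.
  have -> : 3 * (j * l * r ^+ k * M * (w * r ^+ n)) = 3 * (j * l) * w * (r ^+ (n + k) * M).
    by rewrite exprD; ring.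
  rewrite -[leRHS]mulrA ler_wpM2r//; first by nonneg.
  by rewrite /w mulrA ler_pdivrMr// mulrC ler_wpM2l ?(ltW e0)// lerDl.
have pC0 := pointC_ge0.
pose B := j * pointC * r ^+ n; have B0 : 0 <= B by rewrite /B; nonneg.
have T_le (e1 : R) : 0 < e1 -> exists m1, forall m, (m1 <= m)%N ->
    `|appl T f| <= A + B * dy m ^+ k * (M0 + e1).
  move=> e10; have [m1 hm1] := cutoff_bound CLb estC j_ge0 tf fr r_gt0 r0_gt0 fM0 e10.
  exists (maxn m0 m1) => m; rewrite geq_max => /andP[/hm0 h0 /hm1 h1].
  rewrite -[X in `|X|](subrK (appl T (fun x => cutoff C Lb m x *: f x))).
  apply: le_trans (ler_normD _ _) (lerD h0 _); apply: le_trans h1 _.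
  by rewrite le_eqVlt; apply/orP; left; apply/eqP; rewrite /B /pointC exprMn; ring.
apply/ler_addgt0Pr => e1 e10.
have [k0|k0] := eqVneq k 0%N.
  have [m1 /(_ m1 (leqnn _))] := T_le (e1 / (B + 1)) (divr_gt0 e10 (ltr_pwDr ltr01 B0)).
  rewrite {1}k0 expr0 mulr1 mul1r => /le_trans; apply.
  rewrite -addrA; apply: lerD => //; rewrite mulrDr lerD2l mulrCA.
  by rewrite -[leRHS]mulr1 ler_wpM2l ?(ltW e10)// ler_pdivrMr ?ltr_pwDr// mul1r lerDl.
rewrite mul0r addr0.
have [m1 hm1] := T_le 1 ltr01.
have BM : 0 < B * (M0 + 1) + 1 by rewrite ltr_wpDl// mulr_ge0// addr_ge0.
have [m2 hm2] := dy_small (divr_gt0 e10 BM).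
have := hm1 (maxn m1 m2) (leq_maxl _ _); move=> /le_trans; apply; apply: lerD => //.
have := hm2 (maxn m1 m2) (leq_maxr _ _); set d2 := dy _ => hd.
have d20 : 0 <= d2 by rewrite ltW// dy_gt0.
apply: le_trans (_ : B * (M0 + 1) * d2 <= _).
  rewrite mulrAC ler_wpM2l//; first by nonneg.
  by case: (k) k0 => // k' _; rewrite exprS ler_piMr// exprn_ile1// dy_le1.
apply: le_trans (ler_wpM2l _ hd) _; first by nonneg.
by rewrite mulrCA -[leRHS]mulr1 ler_wpM2l ?(ltW e10)// ler_pdivrMr// mul1r lerDl.
Qed.

End density_estimate.

(** * Differentiation of distributions of order zero *)

Section integrals.
Context {R : realType} {n : nat}.
Notation V := 'rV[R]_n.
Notation mu := (@lebesgue_rV R n).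
Implicit Types (f g : V -> R) (a x : V) (r M : R).

Definition intg f : R := (\int[mu]_x f x)%R.

Definition ccfun f : Prop := continuous f /\ exists r, supp_in (f : V -> R^o) 0 r.

Lemma integrable_cube_indic a r : 0 <= r -> mu.-integrable setT (EFin \o \1_(cube a r)).
Proof.
move=> r0; rewrite -(setIT (cube a r)).
have mc : (mu (cube a r) < +oo)%E by rewrite measure_cube// ltry.
rewrite (_ : EFin \o \1_(cube a r `&` setT) = (EFin \o cst 1) \_ (cube a r)).
  apply/(integrable_mkcond _ (measurable_cube a r)).
  apply: measurable_bounded_integrable.
  - exact: measurable_cube.
  - exact: mc.
  - exact: measurable_cst.
  - exact: bounded_cst.
apply/funext => x; rewrite setIT /patch /= indicE.
by case: (x \in cube a r).
Qed.

Lemma intg_cube_indic a r : 0 <= r -> intg \1_(cube a r) = (2 * r) ^+ n.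
Proof.
move=> r0; rewrite /intg /Rintegral.
rewrite integral_indic//; last exact: measurable_cube.
by rewrite setIT -[RHS]/(fine ((2 * r) ^+ n)%:E) -(measure_cube a r0).
Qed.

Lemma ccfun_bounded f : ccfun f -> exists M, forall x, `|f x| <= M.
Proof.
move=> [cf [r fr]].
have cfK : compact (f @` cube 0 r).
  by apply: continuous_compact; [exact: continuous_subspaceT|exact: compact_cube].
have [M [Mr fM]] := compact_bounded cfK.
exists (`|M| + 1) => x; have [fx|fx] := eqVneq (f x) 0.
  by rewrite fx normr0 addr_ge0.
apply: fM; first by rewrite (le_lt_trans (ler_norm _))// ltrDl.
by exists x => //; exact: fr.
Qed.

Lemma ccfun_supp f : ccfun f -> exists2 r, 0 <= r & forall x, f x != 0 -> cube 0 r x.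
Proof.
move=> [_ [r fr]]; exists `|r| => // x fx.
by rewrite /cube/=; apply: le_trans (fr x fx) (ler_norm _).
Qed.

Lemma ccfun_integrable f : ccfun f -> mu.-integrable setT (EFin \o f).
Proof.
move=> cf; have [M fM] := ccfun_bounded cf; have [r r0 fr] := ccfun_supp cf.
have i1 : mu.-integrable setT (fun x => (M%:E * (EFin \o \1_(cube 0 r)) x)%E).
  by apply: integrableZl => //; exact: integrable_cube_indic.
apply: (le_integrable _ _ _ i1) => //.
  by apply/measurable_realfun.measurable_EFinP; apply: continuous_measurable_rV; case: cf.
move=> x _ /=; rewrite lee_fin indicE.
have [fx|/fr cx] := eqVneq (f x) 0; first by rewrite fx normr0.
by rewrite mem_set// mulr1 (le_trans (fM x))// ler_norm.
Qed.

Lemma intgD f g : ccfun f -> ccfun g -> intg (fun x => f x + g x) = intg f + intg g.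
Proof. by move=> cf cg; apply: RintegralD => //; exact: ccfun_integrable. Qed.

Lemma intgB f g : ccfun f -> ccfun g -> intg (fun x => f x - g x) = intg f - intg g.
Proof. by move=> cf cg; apply: RintegralB => //; exact: ccfun_integrable. Qed.

Lemma intgZ (c : R) f : ccfun f -> intg (fun x => c * f x) = c * intg f.
Proof. by move=> cf; apply: RintegralZl => //; exact: ccfun_integrable. Qed.

Lemma intg_ge0 f : (forall x, 0 <= f x) -> 0 <= intg f.
Proof. by move=> f0; exact: Rintegral_ge0. Qed.

Lemma intg_norm_le f a r M : ccfun f -> (forall x, f x != 0 -> `|x - a| <= r) -> 0 <= r ->
  (forall x, `|f x| <= M) -> `|intg f| <= M * (2 * r) ^+ n.
Proof.
move=> cf fr r0 fM; rewrite -(intg_cube_indic a r0).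
have M0 : 0 <= M by exact: le_trans (fM 0).
have i1 : mu.-integrable setT (EFin \o (fun x => M * \1_(cube a r) x)).
  rewrite (_ : _ \o _ = fun x => (M%:E * (EFin \o \1_(cube a r)) x)%E)//.
  by apply: integrableZl => //; exact: integrable_cube_indic.
rewrite -[leRHS](RintegralZl _ measurableT) //; last exact: integrable_cube_indic.
apply: le_trans (le_normr_Rintegral measurableT (ccfun_integrable cf)) _.
apply: le_Rintegral => //.
  have := integrable_norm (ccfun_integrable cf).
  by rewrite /comp/=.
move=> x _; rewrite indicE.
have [fx|/fr cx] := eqVneq (f x) 0; first by rewrite fx normr0 mulr_ge0.
by rewrite mem_set// mulr1.
Qed.

Lemma intg_ge_cubes (I : eqType) (s : seq I) (c : I -> V) (r v : I -> R) f : ccfun f ->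
  (forall x, 0 <= f x) -> uniq s -> (forall i, i \in s -> 0 <= r i) ->
  (forall i x, i \in s -> cube (c i) (r i) x -> v i <= f x) ->
  (forall i j, i \in s -> j \in s -> i != j -> cube (c i) (r i) `&` cube (c j) (r j) = set0) ->
  \sum_(i <- s) v i * (2 * r i) ^+ n <= intg f.
Proof.
move=> cf f0 us r0 vf dis.
pose g (s : seq I) x := \sum_(i <- s) v i * \1_(cube (c i) (r i)) x.
have g_int s' : {subset s' <= s} -> mu.-integrable setT (EFin \o g s') /\
    intg (g s') = \sum_(i <- s') v i * (2 * r i) ^+ n.
  elim: s' => [|i s' IH] ss'.
    rewrite big_nil (_ : g [::] = cst 0); last by apply/funext => x; rewrite /g big_nil.
    split; first exact: integrable0.
    by rewrite /intg Rintegral_cst// mul0r.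
  have [|ig Ig] := IH; first by move=> i' i's; apply: ss'; rewrite in_cons i's orbT.
  have ri : 0 <= r i by apply/r0/ss'; rewrite mem_head.
  have i1 : mu.-integrable setT (EFin \o (fun x => v i * \1_(cube (c i) (r i)) x)).
    rewrite (_ : _ \o _ = fun x => ((v i)%:E * (EFin \o \1_(cube (c i) (r i))) x)%E)//.
    by apply: integrableZl => //; exact: integrable_cube_indic.
  rewrite (_ : g (i :: s') = fun x => v i * \1_(cube (c i) (r i)) x + g s' x); last first.
    by apply/funext => x; rewrite /g big_cons.
  split; first exact: (integrableD measurableT i1 ig).
  rewrite big_cons -Ig -(intg_cube_indic (c i) ri).
  rewrite /intg RintegralD// RintegralZl//; exact: integrable_cube_indic.
have [ig <-] := g_int s (fun _ => id).
apply: le_Rintegral => //; first exact: ccfun_integrable.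
move=> x _; rewrite /g.
have [[i [is_ xi]]|nx] := pselect (exists i, i \in s /\ cube (c i) (r i) x).
  rewrite (bigD1_seq i)//= big1_seq ?addr0.
    by rewrite indicE mem_set// mulr1; exact: vf.
  move=> i' /andP[ii' i's]; rewrite indicE memNset ?mulr0// => xi'.
  by have : (cube (c i') (r i') `&` cube (c i) (r i)) x by []; rewrite dis.
rewrite big1_seq// => i /andP[_ is_]; rewrite indicE memNset ?mulr0// => xi.
by apply: nx; exists i.
Qed.

Lemma ccfun_test (f : V -> R^o) : f \in @test_function R n R^o -> ccfun f.
Proof.
move=> tf; split; first exact: smooth_continuous (test_smooth tf).
by have [r _ fr] := test_supp_in tf; exists r.
Qed.

Lemma ccfunM (f : V -> R) (g : V -> R) : ccfun f -> continuous g -> ccfun (fun x => g x * f x).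
Proof.
move=> [cf [r fr]] cg; split; first by move=> x; exact: (@continuousM _ _ g f x (cg x) (cf x)).
by exists r => x gf; apply: fr; apply: contraNneq gf => ->; rewrite mulr0.
Qed.

Lemma ccfunD f g : ccfun f -> ccfun g -> ccfun (fun x => f x + g x).
Proof.
move=> cf cg; have [r _ fr] := ccfun_supp cf; have [s _ gs] := ccfun_supp cg.
split; first by move=> x; exact: (@continuousD _ _ _ f g x (cf.1 x) (cg.1 x)).
exists (Num.max r s) => x; have [fx|fx] := eqVneq (f x) 0.
  by rewrite fx add0r => /gs; rewrite /cube/= => /le_trans; apply; rewrite le_max lexx orbT.
by move=> _; have := fr x fx; rewrite /cube/= => /le_trans; apply; rewrite le_max lexx.
Qed.

Lemma ccfunZ (c : R) f : ccfun f -> ccfun (fun x => c * f x).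
Proof. by move=> cf; apply: (@ccfunM f (cst c)) => // x; exact: cst_continuous. Qed.

Lemma ccfunB f g : ccfun f -> ccfun g -> ccfun (fun x => f x - g x).
Proof.
move=> cf cg; rewrite (_ : (fun _ => _) = fun x => f x + -1 * g x).
  by apply: ccfunD => //; exact: ccfunZ.
by apply/funext => x; rewrite mulN1r.
Qed.

Lemma intg0 : intg (fun=> 0) = 0.
Proof. by rewrite /intg Rintegral_cst// mul0r. Qed.

End integrals.

Section sequences_facts.
Context {R : realType}.
Implicit Types (u : nat -> R).

Lemma bounded_variation_cvg u (B : R) :
  (forall Q, \sum_(q < Q) `|u q - u q.+1| <= B) -> cvgn u.
Proof.
move=> uB; have : cvgn (series (telescope u)).
  apply: normed_cvg.
  rewrite (_ : [normed series (telescope u)] = fun p => \sum_(q < p) `|telescope u q|).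
    apply: nondecreasing_is_cvgn.
      by apply/nondecreasing_seqP => p; rewrite big_ord_recr/= lerDl.
    exists B => _ [p _ <-]; apply: le_trans (uB p).
    by apply: ler_sum => q _; rewrite /telescope distrC.
  by apply/funext => p; rewrite /normed_series_of /series/= big_mkord.
rewrite telescopeK => cu; rewrite (_ : u = (fun p => (u p - u 0%N) + u 0%N)).
  by apply: is_cvgD => //; exact: is_cvg_cst.
by apply/funext => p; rewrite subrK.
Qed.

Lemma cvg_dist_le u (l x B : R) m0 : u @ \oo --> l ->
  (forall m, (m0 <= m)%N -> `|x - u m| <= B) -> `|x - l| <= B.
Proof.
move=> ul h; apply/ler_addgt0Pr => e e0.
have [m _ hm] := (cvgrPdist_le _ _).1 ul e e0.
apply: le_trans (ler_distD (u (maxn m0 m)) _ _) (lerD (h _ (leq_maxl _ _)) _).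
by rewrite distrC; apply: hm; exact: leq_maxr.
Qed.

(** From [b^2 + (2a - b)^2 = 2 a^2 + 2 (a - b)^2]. It compares values sampled at nodes with the
    values of [f] nearby. *)
Lemma half_sqr_le (a b : R) : `|a - b| <= 1 -> (b ^+ 2 - 2) / 2 <= a ^+ 2.
Proof.
move=> ab; have t2 : (a - b) ^+ 2 <= 1 by rewrite -real_normK ?num_real// exprn_ile1.
have : 0 <= (a + (a - b)) ^+ 2 by exact: sqr_ge0.
by rewrite ler_pdivrMr//; nra.
Qed.

End sequences_facts.

Section uniform_continuity.
Context {R : realType} {n : nat} {Y : normedModType R}.
Notation V := 'rV[R]_n.

Lemma test_unif_cont (f : V -> Y) (e : R) : f \in @test_function R n Y -> 0 < e ->
  exists2 d, 0 < d & forall x y, `|x - y| <= d -> `|f x - f y| <= e.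
Proof.
move=> tf e0; have [r r0 fr] := test_supp_in tf.
have cf := smooth_continuous (test_smooth tf).
pose K : set V := cube 0 (r + 1).
have cK : compact K by exact: compact_cube.
have [m _ hm] : \forall m \near \oo, K `<=` fun x =>
    forall y, `|y - x| <= m.+1%:R^-1 -> `|f y - f x| <= e.
  apply: (compact_near_coveringP K).1 => // x _.
  have e20 : 0 < e / 2 by rewrite divr_gt0.
  have hx := (cvgrPdist_le _ _).1 (cf x) _ e20.
  have [d /= d0 hd] := (nbhs_ballP _ _).1 (hx _).
  have d20 : 0 < d / 2 by rewrite divr_gt0.
  have [m _ mh] := near_infty_natSinv_lt (PosNum d20).
  exists (ball x (d / 2), [set p | (m <= p)%N]).
    by split; [exact: nbhsx_ballx|exists m].
  move=> [x' p] /= [xx' mp] y yx'.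
  have xx : `|x - x'| < d / 2 by move: xx'; rewrite mx_norm_ball.
  have h1 : `|f x - f x'| <= e / 2.
    by apply: hd; rewrite mx_norm_ball /ball_/=; lra.
  have h2 : `|f x - f y| <= e / 2.
    apply: hd; rewrite mx_norm_ball /ball_/=; apply: le_lt_trans (ler_distD x' _ _) _.
    have hp : p.+1%:R^-1 < d / 2 := mh p mp.
    by rewrite [X in _ + X]distrC; apply: lt_le_trans (ltr_leD xx (le_trans yx' (ltW hp))) _; lra.
  apply: le_trans (ler_distD (f x) _ _) _; rewrite distrC; lra.
exists m.+1%:R^-1; first by rewrite invr_gt0.
move=> x y xy.
have [Ky|nKy] := pselect (K y); first exact: (hm m (leqnn _) y Ky x xy).
have fy0 : f y = 0.
  have [//|/fr yr] := eqVneq (f y) 0; exfalso; apply: nKy.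
  by apply: le_trans yr _; rewrite lerDl.
have fx0 : f x = 0.
  have [//|/fr xr] := eqVneq (f x) 0; exfalso; apply: nKy.
  rewrite /K /cube/=; apply: le_trans (ler_distD x _ _) _; rewrite addrC lerD// distrC.
  by apply: le_trans xy _; rewrite invf_le1// ler1n.
by rewrite fx0 fy0 subrr normr0 ltW.
Qed.

End uniform_continuity.

Lemma dilated_le (R : realType) (j pC e K d M : R) n : j * (pC * e) = K -> 0 <= K ->
  0 < d -> 0 <= M ->
  d * (M + 1) <= 1 -> j * (pC * d ^+ n * (e * (1 + d * M))) <= d ^+ n * (2 * K).
Proof.
move=> <- K0 d0 M0 dM.
have -> : j * (pC * d ^+ n * (e * (1 + d * M))) = d ^+ n * ((1 + d * M) * (j * (pC * e))) by ring.
rewrite ler_wpM2l ?exprn_ge0 ?(ltW d0)// ler_wpM2r//.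
by move: dM; rewrite mulrDr mulr1; lra.
Qed.

(** * The part of an order-zero distribution carried by a compact set *)

Section restriction.
Context {R : realType} {n : nat}.
Notation V := 'rV[R]_n.
Notation mu := (@lebesgue_rV R n).
Notation test := (@test_function R n R^o).
Variables (T : {linear testfun n R^o -> R^o}) (i : nat) (j r0 : R) (C : set V) (Lb : nat).
Hypothesis cC : compact C.
Hypothesis CLb : forall b, C b -> `|b| + 20 <= Lb%:R.
Hypothesis estC : forall b, C b -> est T i 0 j r0 b.
Hypothesis j_ge0 : 0 <= j.
Hypothesis r0_gt0 : 0 < r0.
Implicit Types (f g h : V -> R^o) (a x : V).

Let u f m : R := appl T (fun x => cutoff C Lb m x *: f x).

(* The part of [T] carried by [C]. *)
Definition restr f : R := limn (u f).

Lemma test_cutoff f m : f \in test -> (fun x => cutoff C Lb m x *: f x) \in test.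
Proof. by move=> tf; apply: test_scaleMr => //; exact: smooth_cutoff. Qed.

(** The Whitney sum bounds the total variation of the sequence; here a crude bound on the measure
    off [C] suffices, and no density point is involved. *)
Lemma cvg_restr f : f \in test -> u f @ \oo --> restr f.
Proof.
move=> tf; have [r r_gt0 fr] := test_supp_in tf; have [M fM] := test_jet i r tf.
have [m1 h1] := dy_small r_gt0.
have [m2 h2] := dy_small (divr_gt0 r0_gt0 (ltr0n R 21)).
pose m0 := maxn m1 m2.
have d1 : dy m0 <= r by apply: h1; exact: leq_maxl.
have d2 : 21 * dy m0 <= r0 by rewrite mulrC -ler_pdivlMr//; apply: h2; exact: leq_maxr.
have clC := closed_of_compact cC.
have hv : (mu (cube 0 (3 * r) `\` C) <= ((2 * (3 * r)) ^+ n)%:E)%E.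
  have r30 : 0 <= 3 * r by rewrite mulr_ge0// ltW.
  rewrite -(measure_cube 0 r30); apply: le_measure; rewrite ?inE//.
  - by apply: measurableD; [exact: measurable_cube|exact: closed_measurable_rV].
  - exact: measurable_cube.
suff : cvgn (fun q => u f (q + m0)%N).
  by move=> /cvg_ex[l]; rewrite (cvg_shiftn m0 (u f)) => ul; rewrite /restr (cvg_lim _ ul).
apply: bounded_variation_cvg => Q.
have := whitney_sum_le CLb clC estC j_ge0 Q tf fr fM d1 d2 hv.
by apply: le_trans; apply: ler_sum => q _; rewrite /u addSn !(addnC q).
Qed.

Lemma restrD f g : f \in test -> g \in test -> restr (fun x => f x + g x) = restr f + restr g.
Proof.
move=> tf tg; apply: cvg_lim => //.
rewrite (_ : u _ = fun m => u f m + u g m); first by apply: cvgD; exact: cvg_restr.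
apply/funext => m; rewrite /u -applD; [|exact: test_cutoff|exact: test_cutoff].
by congr appl; apply/funext => x; rewrite scalerDr.
Qed.

Lemma restrZ (c : R) f : f \in test -> restr (fun x => c * f x) = c * restr f.
Proof.
move=> tf; apply: cvg_lim => //.
rewrite (_ : u _ = fun m => c * u f m); first by apply: cvgMr; exact: cvg_restr.
apply/funext => m; rewrite /u -applZ; last exact: test_cutoff.
by congr appl; apply/funext => x; rewrite -[c * f x]/(c *: f x) !scalerA mulrC.
Qed.

Lemma restr_near f a r M v : C a -> 0 < r -> r <= 1 -> 21 * r <= r0 ->
  f \in test -> supp_in f a r -> (forall x, jet_le i r M f x) ->
  (mu (cube a (3 * r) `\` C) <= v%:E)%E ->
  `|appl T f - restr f| <= 3 * (j * layerC (n := n) (R := R) i 0 * M * v).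
Proof.
move=> Ca r_gt0 r1 rr0 tf fr fM hv.
have [m0 hm] := whitney_pt CLb (closed_of_compact cC) estC j_ge0 Ca r_gt0 r1 rr0 tf fr fM hv.
apply: cvg_dist_le (cvg_restr tf) _ => m /hm.
by rewrite expr0 mulr1.
Qed.

(** At a scale at which [f] oscillates by at most [1] on tiles, [T] of the cut off function is at
    most a constant times the sum of [dy m ^+ n * (|y l| + 2)]. The number of tiles times
    [dy m ^+ n] is bounded by [N1], and the squares of the samples are compared with the integral
    over disjoint cubes of radius [dy m / 3]. Hence [B] does not depend on [f]. *)
Lemma restr_square_bound : exists B, forall f, f \in test ->
  `|restr f| <= intg (fun x => f x ^+ 2) / 4 + B.
Proof.
have [K eK] : exists K, j * (pieceC (n := n) (R := R) i 0 * (2 ^+ i * etaC (n := n) (R := R) i)) =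
  K.
  by eexists.
have K0 : 0 <= K.
  by have h := @pieceC_ge0 R n i 0; have h' := @etaC_ge0 R n i; rewrite -eK; nonneg.
have [w ew] : exists w : R, (2 / 3) ^+ n = w by eexists.
have w0 : 0 < w by rewrite -ew exprn_gt0// divr_gt0.
have w1 : w <= 1 by rewrite -ew exprn_ile1//; lra.
have [N1 eN] : exists N1 : R, (3 * Lb%:R) ^+ n = N1 by eexists.
pose B := N1 * (1 / 4 + 2 * K + 2 * K ^+ 2 / w).
exists B => f tf; have sf := test_smooth tf.
have [d d0 fd] := test_unif_cont tf ltr01.
have [M fM] := test_jet i 1 tf; have M0 := jet_le_ge0 (fM 0).
have [m1 h1] := dy_small d0.
have [m2 h2] := dy_small (divr_gt0 r0_gt0 (ltr0n R 21)).
have [m3 h3] := dy_small (divr_gt0 ltr01 (ltr_pwDr ltr01 M0)).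
rewrite -[restr f]subr0 distrC.
apply: (@cvg_dist_le _ (u f) _ _ _ (maxn m1 (maxn m2 m3))); first exact: cvg_restr.
move=> m; rewrite !geq_max => /and3P[/h1 dd /h2 dr /h3 dM]; rewrite sub0r normrN.
have dp := dy_gt0 (R := R) m; set S := @touches R n R^o Lb (cutoff C Lb m) f m.
have mr0 : 21 * dy m <= r0 by rewrite mulrC -ler_pdivlMr.
pose y (l : gridix (gridn Lb m)) : R^o := f (node 0 (dy m) l).
have fy l x : l \in S -> `|x - node 0 (dy m) l| <= dy m -> `|f x - y l| <= 1.
  by move=> _ xl; apply: fd; apply: le_trans dd.
have h := cutoff_values CLb estC tf fM mr0 fy.
have piece l : l \in S ->
    `|appl T (fun x => tile_at 0 (dy m) l x *: (cutoff C Lb m x *: y l))| <= K * dy m ^+ n * `|y l|.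
  move=> lS; have [x [xl ex fx]] := touches_near lS; have [b Cb xb] := cutoff_neq0 ex.
  have scy : smooth (cst (y l) : V -> R^o) by exact: smooth_cst.
  apply: le_trans (@est_piece _ _ _ T i 0 j r0 b (dy m) _ l
    (fun x => cutoff C Lb m x *: y l) (2 ^+ i * (etaC (n := n) (R := R) i * `|y l|)) (estC Cb) dp
      mr0 _ _ _) _.
  - apply: le_trans (ler_distD x _ _) _; rewrite distrC.
    by apply: le_trans (lerD xl xb) _; lra.
  - exact: (smooth_scaleM (smooth_cutoff C Lb m) scy).
  - move=> z zl; apply: (jet_leM (smooth_cutoff C Lb m) scy); first exact: jet_cutoff.
    exact: jet_le_cst.
  - by rewrite addn0 -eK le_eqVlt; apply/orP; left; apply/eqP; ring.
(* The coefficient [w / 8] is chosen for the end of the proof: [w] is the volume ratio of counting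
   cubes to [dy m ^+ n], one half is lost in [half_sqr_le], and [1 / 4] is the factor aimed at. *)
have AM (z : R) : K * `|z| <= w * z ^+ 2 / 8 + 2 * K ^+ 2 / w.
  rewrite -[z ^+ 2]real_normK ?num_real//; set t := `|z|.
  rewrite -subr_ge0 (_ : _ - _ = (w * t - 4 * K) ^+ 2 / (8 * w)).
    by rewrite divr_ge0 ?sqr_ge0// mulr_ge0// ltW.
  by field; rewrite gt_eqF.
have cS : #|S|%:R * dy m ^+ n <= N1 by rewrite -eN; exact: touches_count CLb f m.
have cf2 : ccfun (fun x => f x ^+ 2).
  rewrite (_ : (fun _ => _) = fun x => f x * f x); last by apply/funext => x; rewrite expr2.
  by apply: ccfunM; [exact: ccfun_test|exact: smooth_continuous].
have Isq : \sum_(l in S) ((y l ^+ 2 - 2) / 2) * (2 * (dy m / 3)) ^+ n <= intg (fun x => f x ^+ 2).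
  rewrite -big_enum; apply: (@intg_ge_cubes R n _ (enum S) (fun l => node 0 (dy m) l)
    (fun=> dy m / 3)) => //.
  - by move=> x; exact: sqr_ge0.
  - exact: enum_uniq.
  - by move=> l _; rewrite divr_ge0// ltW.
  - move=> l x _ xl; have : `|(f x : R) - y l| <= 1.
      by apply: fd; apply: le_trans dd; apply: le_trans xl _; lra.
    exact: half_sqr_le.
  - by move=> l l' _ _; exact: node_disjoint.
apply: le_trans (_ : \sum_(l in S) K * dy m ^+ n * `|y l| + #|S|%:R * (dy m ^+ n * (2 * K)) <= _).
  rewrite -[u f m](subrK (\sum_(l in S) appl T
    (fun x => tile_at 0 (dy m) l x *: (cutoff C Lb m x *: y l)))).
  apply: le_trans (ler_normD _ _) _; rewrite addrC lerD//.
    by apply: le_trans (ler_norm_sum _ _ _) _; exact: ler_sum.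
  apply: le_trans h _; apply: ler_wpM2l => //.
  rewrite addn0 [2 ^+ i * (_ * _)]mulrA; have h5 := dilated_le (d := dy m) (M := M) n eK K0 dp M0;
    apply: h5.
  by rewrite -ler_pdivlMr ?ltr_pwDr// mulrC.
have dn0 : 0 <= dy m ^+ n :> R by rewrite exprn_ge0// ltW.
apply: le_trans (_ : \sum_(l in S) dy m ^+ n * (w * y l ^+ 2 / 8 + 2 * K ^+ 2 / w) + N1
  * (2 * K) <= _).
  apply: lerD; last by rewrite mulrA ler_wpM2r// mulr_ge0.
  by apply: ler_sum => l _; rewrite -mulrA mulrCA ler_wpM2l.
have e3 : (2 * (dy m / 3)) ^+ n = w * dy m ^+ n :> R.
  by rewrite -ew -exprMn; congr (_ ^+ _); field.
rewrite e3 in Isq.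
have E : \sum_(l in S) dy m ^+ n * (w * y l ^+ 2 / 8 + 2 * K ^+ 2 / w) =
    (\sum_(l in S) ((y l ^+ 2 - 2) / 2) * (w * dy m ^+ n)) / 4 +
    #|S|%:R * dy m ^+ n * (w / 4 + 2 * K ^+ 2 / w).
  have -> : #|S|%:R * dy m ^+ n * (w / 4 + 2 * K ^+ 2 / w) =
      \sum_(l in S) (dy m ^+ n * (w / 4 + 2 * K ^+ 2 / w)).
    by rewrite sumr_const -mulrA mulr_natl.
  rewrite mulr_suml -big_split/=.
  by apply: eq_bigr => l _; field; rewrite gt_eqF.
rewrite E /B.
have Kw : 0 <= 2 * K ^+ 2 / w by rewrite divr_ge0 ?mulr_ge0 ?exprn_ge0// ltW.
have : #|S|%:R * dy m ^+ n * (w / 4 + 2 * K ^+ 2 / w) <= N1 * (1 / 4 + 2 * K ^+ 2 / w).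
  by apply: ler_pM => //; [nonneg|apply: addr_ge0 => //; lra|lra].
move: Isq; set A := \sum_(_ in _) _; set D := _ * _ * (w / 4 + _); set Z := 2 * K ^+ 2 / w.
move=> h4 h5; have -> : N1 * (1 / 4 + 2 * K + Z) = N1 * (1 / 4 + Z) + N1 * (2 * K) by ring.
by rewrite addrA lerD2r; apply: lerD => //; rewrite ler_pM2r// invr_gt0.
Qed.

End restriction.

Section scalar_differentiation.
Context {R : realType} {n : nat}.
Notation V := 'rV[R]_n.
Notation mu := (@lebesgue_rV R n).
Notation test := (@test_function R n R^o).
Variables (T : {linear testfun n R^o -> R^o}) (i : nat) (j r0 : R) (C : set V).
Hypothesis cC : compact C.
Hypothesis estC : forall b, C b -> est T i 0 j r0 b.
Hypothesis j_ge0 : 0 <= j.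
Hypothesis r0_gt0 : 0 < r0.
Implicit Types (f g h : V -> R^o) (a x : V).

Let Lb := sval (cid (compact_nat_bound cC)).
Let CLb : forall b, C b -> `|b| + 20 <= Lb%:R := svalP (cid (compact_nat_bound cC)).
Let restrD := restrD cC CLb estC j_ge0 r0_gt0.
Let restrZ := restrZ cC CLb estC j_ge0 r0_gt0.

Notation rst := (restr T C Lb).

Let D h f : R := rst f - intg (fun x => h x * f x).

Let cc_mul h f : h \in test -> f \in test -> ccfun (fun x => h x * f x).
Proof.
by move=> th tf; apply: ccfunM; [exact: ccfun_test|exact: smooth_continuous (test_smooth th)].
Qed.

Let DD h f g : h \in test -> f \in test -> g \in test -> D h (fun x => f x + g x) = D h f + D h g.
Proof.
move=> th tf tg; rewrite /D restrD// (_ : (fun x => h x * _) = fun x => h x * f x + h x * g x).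
  by rewrite intgD; [ring|exact: cc_mul|exact: cc_mul].
by apply/funext => x; rewrite mulrDr.
Qed.

Let DZ h f (c : R) : h \in test -> f \in test -> D h (fun x => c * f x) = c * D h f.
Proof.
move=> th tf; rewrite /D restrZ// (_ : (fun x => h x * _) = fun x => c * (h x * f x)).
  by rewrite intgZ; [ring|exact: cc_mul].
by apply/funext => x; rewrite mulrCA.
Qed.

Let D0 h : h \in test -> D h (fun=> 0) = 0.
Proof.
move=> th; have t0 : (fun=> 0 : R^o) \in test by exact: rpred0.
by rewrite (_ : (fun=> 0) = fun x : V => 0 * (fun=> 0 : R^o) x) ?DZ ?mul0r//; apply/funext => x;
  rewrite mul0r.
Qed.

(* [h] almost minimizes [intg (h ^ 2) / 2 - rst h]. *)
Lemma near_minimizer (e : R) : 0 < e -> exists2 h, h \in test & forall f (s : R), f \in test ->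
  s * D h f <= e + s ^+ 2 / 2 * intg (fun x => f x ^+ 2).
Proof.
move=> e0; have [B hB] := restr_square_bound cC CLb estC j_ge0 r0_gt0.
pose Q h : R := intg (fun x => h x ^+ 2) / 2 - rst h.
have Qlb h : h \in test -> - B <= Q h.
  move=> th; have := hB h th; rewrite ler_norml => /andP[_ h1].
  have := @intg_ge0 R n (fun x => h x ^+ 2) (fun x => sqr_ge0 _).
  by rewrite /Q; move: h1; set X := intg _; lra.
have sq f : (fun x => f x ^+ 2) = fun x => f x * f x by apply/funext => x; rewrite expr2.
have hinf : has_inf [set Q h | h in [set h | h \in test]].
  split; first by exists (Q (fun=> 0)), (fun=> 0) => //; exact: rpred0.
  by exists (- B) => _ [h /= th <-]; exact: Qlb.
have [_ [h /= th <-] hlt] := inf_adherent e0 hinf.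
exists h => // f s tf.
have tsf : (fun x => s * f x : R^o) \in test by exact: (testZ s tf).
have : inf [set Q h | h in [set h | h \in test]] <= Q (fun x => h x + s * f x).
  by apply: (ge_inf hinf.2); exists (fun x => h x + s * f x) => //=; exact: testD.
rewrite -(lerD2r e) => /(lt_le_trans hlt) {hlt} /ltW.
rewrite /Q restrD// restrZ// !sq.
rewrite (_ : (fun x => (h x + _) * _) = fun x => (h x * h x + (2 * s) * (h x * f x)) + s ^+ 2
  * (f x * f x)); last first.
  by apply/funext => x; ring.
have c1 := cc_mul th th; have c2 := cc_mul th tf; have c3 := cc_mul tf tf.
rewrite intgD; [|by apply: ccfunD => //; exact: ccfunZ|exact: ccfunZ].
rewrite intgD//; last exact: ccfunZ.
rewrite intgZ// intgZ// /D.
set X := intg (fun x => h x * h x); set Z := intg (fun x => f x * f x); set W := intg _.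
by set U := rst h; set U' := rst f; lra.
Qed.

(** Add up functions that violate the bound on disjoint cubes. [D h] of the sum is at least [t]
    times the sum of the [r ^+ n], and disjointness of supports bounds the integral of its square by
    [2 ^+ n] times the same sum. Near minimality makes the first dominate the second unless the sum
    is small. *)
Lemma weak_type (e t : R) : 0 < e -> 0 < t -> exists2 h, h \in test &
  exists U, [/\ measurable U, (mu U <= e%:E)%E & forall a r f, ~ U a -> 0 < r -> f \in test ->
    supp_in f a r -> (forall x, `|f x| <= 1) -> `|D h f| <= t * r ^+ n].
Proof.
move=> e0 t0.
(* With [s = t / 2 ^+ n], which maximizes [s * t - s ^+ 2 / 2 * 2 ^+ n], the gain per unit of the
   sum of the [r ^+ n] is [t ^+ 2 / 2 ^+ n / 2]; this [e1] bounds the sum by [e / 6 ^+ n]. *)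
pose e1 := e / 6 ^+ n * (t ^+ 2 / 2 ^+ n / 2).
have e10 : 0 < e1 by rewrite mulr_gt0 ?divr_gt0 ?exprn_gt0.
have [h th hmin] := near_minimizer e10; exists h => //.
pose S a r := exists f, [/\ f \in test, supp_in f a r, (forall x, `|f x| <= 1) &
  t * r ^+ n < D h f].
pose N := [set a | exists2 r, 0 < r & S a r].
have [//|s c r us Sr dis|U [mU NU Ue]] := @cubes_cover_small R n S N (e / 6 ^+ n).
  pose fam k : V -> R^o := if pselect (S (c k) (r k)) is left P then sval (cid P) else fun=> 0.
  have famP k : k \in s -> [/\ fam k \in test, supp_in (fam k) (c k) (r k),
      (forall x, `|fam k x| <= 1) & t * r k ^+ n < D h (fam k)].
    by move=> /Sr[_ Sk]; rewrite /fam; case: pselect => // P; exact: (svalP (cid P)).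
  have r_gt0 k : k \in s -> 0 < r k by move=> /Sr[].
  pose F (s' : seq nat) x : R^o := \sum_(k <- s') fam k x.
  have FP s' : uniq s' -> {subset s' <= s} -> [/\ F s' \in test,
      (forall x, F s' x != 0 -> exists2 k, k \in s' & cube (c k) (r k) x),
      t * (\sum_(k <- s') r k ^+ n) <= D h (F s') &
      intg (fun x => F s' x ^+ 2) <= 2 ^+ n * (\sum_(k <- s') r k ^+ n)].
    elim: s' => [|k s' IH] /=.
      move=> _ _; rewrite (_ : F [::] = fun=> 0); last by apply/funext => x; rewrite /F big_nil.
      split; first exact: rpred0.
      - by move=> x; rewrite eqxx.
      - by rewrite big_nil mulr0 D0.
      - by rewrite big_nil mulr0 (_ : (fun x => _) = fun=> 0) ?intg0//; apply/funext => x;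
        rewrite expr0n.
    move=> /andP[ks' us'] ss'.
    have [|tF Fs DF IF] := IH us'; first by move=> k' k's; apply: ss'; rewrite in_cons k's orbT.
    have ks : k \in s by apply: ss'; rewrite mem_head.
    have [tk fk f1 Dk] := famP k ks; have rk := r_gt0 k ks.
    have -> : F (k :: s') = fun x => fam k x + F s' x by apply/funext => x; rewrite /F big_cons.
    have z x : fam k x * F s' x = 0.
      apply/eqP; rewrite mulf_eq0; apply: contraT; rewrite negb_or => /andP[kx /Fs[k' k's xk']].
      have /seteqP[+ _] : cube (c k) (r k) `&` cube (c k') (r k') = set0.
        apply: dis => //; first by apply: ss'; rewrite in_cons k's orbT.
        by apply: contraNneq ks' => ->.
      by move=> /(_ x); case; split => //; exact: fk.
    split; first exact: testD.
    - move=> x; have [fx|/fk kx _] := eqVneq (fam k x) 0.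
        by rewrite fx add0r => /Fs[k' k's xk']; exists k' => //; rewrite in_cons k's orbT.
      by exists k => //; exact: mem_head.
    - by rewrite big_cons mulrDr DD//; apply: lerD => //; exact: ltW.
    - have -> : (fun x => (fam k x + F s' x) ^+ 2) = fun x => fam k x * fam k x + F s' x * F s' x.
        by apply/funext => x; rewrite sqrrD z mul0rn addr0 !expr2.
      rewrite intgD; [|exact: cc_mul|exact: cc_mul].
      rewrite big_cons mulrDr; apply: lerD; last first.
        by move: IF; under eq_fun do rewrite expr2.
      rewrite -exprMn -[leRHS]mul1r; apply: le_trans (ler_norm _) _.
      apply: (@intg_norm_le R n _ (c k)); [exact: cc_mul| |exact: ltW|].
        by move=> x kx; apply: fk; apply: contraNneq kx => ->; rewrite mul0r.
      by move=> x; rewrite normrM mulr_ile1.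
  have [tF _ DF IF] := FP s us (fun _ => id).
  have := hmin _ (t / 2 ^+ n) tF.
  move: DF IF; set d := D h (F s); set I := intg _; set Sg := \sum_(_ <- _) _ => DF IF hm.
  have p2 : 0 < 2 ^+ n :> R by rewrite exprn_gt0.
  have h1 : t / 2 ^+ n * (t * Sg) <= e1 + (t / 2 ^+ n) ^+ 2 / 2 * (2 ^+ n * Sg).
    apply: le_trans (le_trans _ hm) _.
      by rewrite ler_pM2l// divr_gt0.
    by rewrite lerD2l ler_pM2l// divr_gt0// exprn_gt0// divr_gt0.
  have h2 : (t / 2 ^+ n) ^+ 2 / 2 * (2 ^+ n * Sg) = t ^+ 2 / 2 ^+ n / 2 * Sg.
    by field; rewrite gt_eqF.
  have h3 : t / 2 ^+ n * (t * Sg) = t ^+ 2 / 2 ^+ n / 2 * Sg + t ^+ 2 / 2 ^+ n / 2 * Sg.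
    by field; rewrite gt_eqF.
  rewrite h2 h3 lerD2r /e1 mulrC ler_pM2r// in h1.
  by rewrite !divr_gt0// exprn_gt0.
exists U; split => //.
  by move: Ue; rewrite mulrC divfK// gt_eqF// exprn_gt0.
move=> a r f Ua r_gt0 tf fr f1; rewrite leNgt; apply/negP => hD; apply: Ua; apply: NU.
exists r => //; have [D_ge0|D_lt0] := leP 0 (D h f).
  by exists f; split => //; move: hD; rewrite ger0_norm.
(* [S] is one-sided, so a negative value is turned around by a change of sign. *)
exists (fun x => -1 * f x); split; first exact: (testZ (-1) tf).
- by move=> x fx; apply: fr; apply: contraNneq fx => ->; rewrite mulr0.
- by move=> x; rewrite mulN1r normrN.
- by rewrite DZ// mulN1r; move: hD; rewrite ltr0_norm.
Qed.

Definition scalar_diff_at (t : R) a (v : R) := exists2 d, 0 < d & forall r f M, 0 < r -> r < d ->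
  f \in test -> supp_in f a r -> (forall x, jet_le i r M f x) ->
  `|appl T f - v * intg f| <= t * r ^+ n * M.

(** The candidate is [h a], for [h] given by the weak type inequality. Each third of [t] pays for
    one replacement: [T] by its part on [C] (density), that part by [h] (weak type), and [h] by
    [h a] (continuity). Both [h] and the exceptional set depend on [e] and [t], so only an
    approximate derivative results. *)
Lemma ae_scalar_diff : mu.-negligible
  (C `\` [set a | forall t, 0 < t -> exists v, scalar_diff_at t a v]).
Proof.
pose G p := [set a | exists v, scalar_diff_at (p.+1%:R^-1) a v].
apply: (@negligibleS _ _ _ mu ((C `\` density_pt C) `|`
    \bigcup_p ((C `&` density_pt C) `\` G p))).
  move=> a [Ca Ga]; have [da|da] := pselect (density_pt C a); last by left.
  right; apply: contrapT => nG; apply: Ga => t t0.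
  have [p _ hp] := near_infty_natSinv_lt (PosNum t0).
  have [v [d d0 hv]] : G p a by apply: contrapT => nGp; apply: nG; exists p.
  exists v, d => // r f M r_gt0 rd tf fr fM.
  have M0 := jet_le_ge0 (fM 0).
  apply: le_trans (hv r f M r_gt0 rd tf fr fM) _.
  have hp1 : p.+1%:R^-1 < t := hp p (leqnn _).
  by rewrite ler_wpM2r// ler_wpM2r ?exprn_ge0// ltW.
apply: negligibleU; first exact: ae_density_pt.
apply: negligible_bigcup_countable => p.
apply: negligible_small => e e0.
pose t : R := p.+1%:R^-1; have t0 : 0 < t by rewrite invr_gt0.
have t30 : 0 < t / 3 by rewrite divr_gt0.
have [h th [U [mU Ue hU]]] := weak_type e0 t30.
exists U; split => // a [[Ca da] nG]; apply: contrapT => nU; apply: nG; exists (h a).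
have t40 : 0 < t / 3 / 2 ^+ n by rewrite divr_gt0// exprn_gt0.
have [d1 d10 hd1] := test_unif_cont th t40.
pose K := 3 * (j * layerC (n := n) (R := R) i 0).
have K0 : 0 <= K by have := @layerC_ge0 R n i 0; rewrite /K => lC; nonneg.
have e20 : 0 < t / 3 / (K + 1) by rewrite divr_gt0// ltr_wpDl.
have [d2 d20 hd2] := density_cube da e20.
exists (Num.min (Num.min d1 d2) (Num.min 1 (r0 / 21))).
  by rewrite !lt_min d10 d20 ltr01 divr_gt0.
move=> r f M r_gt0; rewrite !lt_min => /andP[/andP[rd1 rd2] /andP[r1 rr0]] tf fr fM.
have M0 := jet_le_ge0 (fM 0).
have fM0 x : `|f x| <= M := jet_le0 (fM x).
have [M_eq0|M_neq0] := eqVneq M 0.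
  have -> : f = fun=> 0 by apply/funext => x; apply/eqP; rewrite -normr_le0 -M_eq0.
  by rewrite appl0 intg0 mulr0 subr0 normr0 M_eq0 mulr0.
have M_gt0 : 0 < M by rewrite lt_def M_neq0.
have s1 : `|appl T f - rst f| <= t / 3 * r ^+ n * M.
  apply: le_trans (restr_near cC CLb estC j_ge0 r0_gt0 Ca r_gt0 (ltW r1) _ tf fr fM
    (hd2 r r_gt0 rd2)) _.
    by rewrite mulrC -ler_pdivlMr// ltW.
  have -> : 3 * (j * layerC (n := n) i 0 * M * (t / 3 / (K + 1) * r ^+ n)) =
      K * (t / 3 / (K + 1)) * (r ^+ n * M) by rewrite /K; ring.
  rewrite -[leRHS]mulrA ler_wpM2r ?mulr_ge0 ?exprn_ge0// ?(ltW r_gt0)//.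
  rewrite mulrA ler_pdivrMr ?ltr_wpDl// mulrC ler_wpM2l ?(ltW t30)//.
  by rewrite lerDl.
have s2 : `|rst f - intg (fun x => h x * f x)| <= t / 3 * r ^+ n * M.
  have := hU a r (fun x => M^-1 * f x) nU r_gt0 (testZ M^-1 tf) _ _.
  rewrite DZ// normrM gtr0_norm ?invr_gt0// ler_pdivrMl// [leRHS]mulrC; apply.
    by move=> x fx; apply: fr; apply: contraNneq fx => ->; rewrite mulr0.
  by move=> x; rewrite normrM gtr0_norm ?invr_gt0// ler_pdivrMl// mulr1.
have s3 : `|intg (fun x => h x * f x) - h a * intg f| <= t / 3 * r ^+ n * M.
  have cf := ccfun_test tf.
  rewrite -intgZ// -intgB; [|exact: cc_mul|exact: ccfunZ].
  apply: le_trans (@intg_norm_le R n _ a r (t / 3 / 2 ^+ n * M) _ _ (ltW r_gt0) _) _.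
  - by apply: ccfunB; [exact: cc_mul|exact: ccfunZ].
  - by move=> x fx; apply: fr; apply: contraNneq fx => ->; rewrite !mulr0 subrr.
  - move=> x; rewrite -mulrBl normrM; have [fx|/fr xr] := eqVneq (f x) 0.
      by rewrite fx normr0 mulr0 mulr_ge0// ltW.
    by apply: ler_pM => //; apply: hd1; apply: le_trans xr (ltW rd1).
  - rewrite exprMn le_eqVlt; apply/orP; left; apply/eqP; field.
    by rewrite gt_eqF// exprn_gt0.
apply: le_trans (ler_distD (rst f) _ _) _.
apply: le_trans (lerD s1 (le_trans (ler_distD (intg (fun x => h x * f x)) _ _) (lerD s2 s3))) _.
by rewrite -/t le_eqVlt; apply/orP; left; apply/eqP; field.
Qed.

End scalar_differentiation.

Section slices.
Context {R : realType} {n : nat} {Y : normedModType R}.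
Notation V := 'rV[R]_n.
Notation test := (@test_function R n Y).
Notation stest := (@test_function R n R^o).
Variable T : {linear testfun n Y -> R^o}.
Implicit Types (f : V -> Y) (p : V -> R^o) (a b : V) (y : Y) (g : dual Y).

Lemma smooth_cstT y : smooth (cst y : V -> Y).
Proof. exact: smooth_cst. Qed.

Lemma test_scale_cst p y : p \in stest -> (fun x => p x *: y) \in test.
Proof. by move=> tp; exact: test_scaleM (smooth_cstT y). Qed.

Definition slice y (p : testfun n R^o) : R^o := appl T (fun x => p x *: y).

Lemma slice_linear y : linear (slice y).
Proof.
move=> c p q; rewrite /slice.
have tp := testfunP p; have tq := testfunP q.
rewrite -[RHS]/(c * _ + _) -applZD; [|exact: test_scale_cst|exact: test_scale_cst].
by congr appl; apply/funext => x; rewrite scalerA -scalerDl.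
Qed.

HB.instance Definition _ y := GRing.isLinear.Build R (testfun n R^o) R^o _ (slice y)
  (slice_linear y).

Lemma appl_slice y p : p \in stest -> appl (slice y) p = appl T (fun x => p x *: y).
Proof. by move=> tp; rewrite /appl/= /slice val_insubd tp. Qed.

Lemma est_slice i (j r0 : R) b y : est T i 0 j r0 b -> est (slice y) i 0 (j * (2 ^+ i * `|y|)) r0 b.
Proof.
move=> eb r p M r_gt0 rr0 tp pb pM; rewrite appl_slice//.
apply: le_trans (eb r _ (2 ^+ i * (M * `|y|)) r_gt0 rr0 (test_scale_cst y tp) _ _) _.
- by move=> x px; apply: pb; apply: contraNneq px => ->; rewrite scale0r.
- by move=> x; apply: (jet_leM (test_smooth tp) (smooth_cstT y)) => //; exact: jet_le_cst.
- by rewrite le_eqVlt; apply/orP; left; apply/eqP; ring.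
Qed.

Lemma dual_continuous g : continuous (g : Y -> R^o).
Proof. by have /set_mem[] := dual_funP g. Qed.

Lemma dual_ccfun g f : f \in test -> ccfun (fun x => g (f x)).
Proof.
move=> tf; split.
  move=> x; apply: (@continuous_comp _ _ _ f (g : Y -> R^o)).
    exact: (smooth_continuous (test_smooth tf)).
  exact: dual_continuous.
have [r _ fr] := test_supp_in tf; exists r => x gfx; apply: fr.
by apply: contraNneq gfx => ->; rewrite linear0.
Qed.

Definition subcst g (phi : testfun n Y) : R^o := T phi - intg (fun x => g (phi x)).

Lemma subcst_linear g : linear (subcst g).
Proof.
move=> c p q; rewrite /subcst linearP.
have -> : intg (fun x => g ((c *: p + q : testfun n Y) x)) =
    c * intg (fun x => g (p x)) + intg (fun x => g (q x)).
  rewrite -intgZ; last exact: dual_ccfun (testfunP p).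
  rewrite -intgD; [|exact/ccfunZ/(dual_ccfun g (testfunP p))|exact: dual_ccfun (testfunP q)].
  by congr intg; apply/funext => x; rewrite linearP.
by rewrite -[c *: (_ - _)]/(c * (_ - _)) -[c *: T p]/(c * T p); ring.
Qed.

HB.instance Definition _ g := GRing.isLinear.Build R (testfun n Y) R^o _ (subcst g)
  (subcst_linear g).

Lemma appl_subcst g f : f \in test -> appl (subcst g) f = appl T f - intg (fun x => g (f x)).
Proof. by move=> tf; rewrite /appl/= /subcst val_insubd tf. Qed.

Lemma dual_intg_le g f a r M : 0 < r -> f \in test -> supp_in f a r -> (forall x, `|f x| <= M) ->
  `|intg (fun x => g (f x))| <= dual_norm g * M * (2 * r) ^+ n.
Proof.
move=> r_gt0 tf fr fM; apply: (intg_norm_le (a := a)); [exact: dual_ccfun| |exact: ltW|].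
  by move=> x gfx; apply: fr; apply: contraNneq gfx => ->; rewrite linear0.
move=> x; apply: le_trans (dual_normP g (f x)) _; rewrite ler_wpM2l//.
exact: (normr_ge0 g).
Qed.

Lemma est_subcst i (j r0 : R) b g : est T i 0 j r0 b ->
  est (subcst g) i 0 (j + dual_norm g * 2 ^+ n) r0 b.
Proof.
move=> eb r f M r_gt0 rr0 tf fb fM; rewrite appl_subcst//.
apply: le_trans (ler_normB _ _) _; rewrite !mulrDl; apply: lerD; first exact: eb.
apply: le_trans (dual_intg_le g r_gt0 tf fb (fun x => jet_le0 (fM x))) _.
by rewrite addn0 exprMn le_eqVlt; apply/orP; left; apply/eqP; ring.
Qed.

End slices.

Section scalar_limits.
Context {R : realType} {n : nat}.
Notation V := 'rV[R]_n.
Notation test := (@test_function R n R^o).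
Implicit Types (p : V -> R^o) (a : V).

Lemma ex_bump i : exists c : R, 0 <= c /\ forall a r, 0 < r -> exists p,
  [/\ p \in test, supp_in p a r, forall x, jet_le i r c p x, forall x, 0 <= p x &
      forall x, `|x - a| <= r / 2 -> p x = 1].
Proof.
pose q : V -> R^o := prod_coord (@plateau R).
have sq : smooth q by apply: smooth_prod_coordT => m; exact: Ck_plateau.
have sup : supp_in q 0 2.
  move=> x; rewrite subr0; apply: prod_coord_supp => // t; exact: plateau_supp.
have [c hc] := test_jet i 2 (supp_in_testfun sq sup).
exists c; split => [|a r r_gt0]; first exact: jet_le_ge0 (hc 0).
pose p x : R^o := q ((2 / r) *: (x - a)).
have k0 : 0 < 2 / r by rewrite divr_gt0.
have ps : supp_in p a r.
  move=> x /sup; rewrite subr0 normrZ gtr0_norm// -ler_pdivlMl//.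
  by rewrite invf_div divfK.
exists p; split => //.
- by apply: supp_in_testfun ps; exact: smooth_affine.
- move=> x; apply: (@jet_le_affine _ _ _ i 2) => //.
  by rewrite gtr0_norm// divfK// gt_eqF.
- by move=> x; apply: prodr_ge0 => l _; exact: plateau_ge0.
- move=> x xr; rewrite /p /q /prod_coord big1// => l _; apply: plateau1.
  apply: le_trans (rV_coord_le _ _) _.
  by rewrite normrZ gtr0_norm// -ler_pdivlMl// invf_div mulr1.
Qed.

Definition bumpC i : R := sval (cid (ex_bump i)).

Lemma bumpC_ge0 i : 0 <= bumpC i.
Proof. by rewrite /bumpC; case: cid => c []. Qed.

Lemma bump i a r : 0 < r -> exists p,
  [/\ p \in test, supp_in p a r, forall x, jet_le i r (bumpC i) p x & r ^+ n <= intg p].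
Proof.
move=> r_gt0; have [_ /(_ a r r_gt0)[p [tp ps pM p0 p1]]] := svalP (cid (ex_bump i)).
exists p; split => //.
have := @intg_ge_cubes R n _ [:: 0%N] (fun=> a) (fun=> r / 2) (fun=> 1) p (ccfun_test tp).
rewrite big_seq1 mul1r mulrCA divff// mulr1; apply => //.
- by move=> _ _; rewrite divr_ge0// ltW.
- by move=> _ x _ /p1 ->.
- by move=> l l'; rewrite !mem_seq1 => /eqP-> /eqP->; rewrite eqxx.
Qed.

Lemma plateau_bump a r : 0 < r -> exists p,
  [/\ p \in test, supp_in p a r, forall x, 0 <= p x & forall x, `|x - a| <= r / 2 -> p x = 1].
Proof.
move=> r_gt0; have [c [_ /(_ a r r_gt0)[p [tp ps _ p0 p1]]]] := ex_bump 0.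
by exists p.
Qed.

Variables (T : {linear testfun n R^o -> R^o}) (i : nat).

(** Both approximations are tested on one bump, whose integral is at least [r ^+ n]; this is how a
    number is read off from the distribution. *)
Lemma scalar_diff_close a (t t' v v' : R) : scalar_diff_at T i t a v ->
  scalar_diff_at T i t' a v' ->
  `|v - v'| <= (t + t') * bumpC i.
Proof.
move=> [d d0 h] [d' d'0 h'].
pose r := Num.min d d' / 2.
have m0 : 0 < Num.min d d' by rewrite lt_min d0.
have r_gt0 : 0 < r by rewrite divr_gt0.
have : r < Num.min d d' by rewrite /r; lra.
rewrite lt_min => /andP[rd rd'].
have [p [tp ps pM pI]] := bump i a r_gt0.
have rn : 0 < r ^+ n by rewrite exprn_gt0.
rewrite -(ler_pM2r rn).
apply: le_trans (_ : _ <= `|v - v'| * intg p) _; first by rewrite ler_wpM2l.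
rewrite -[X in _ * X](ger0_norm (le_trans (ltW rn) pI)) -normrM mulrBl.
apply: le_trans (ler_distD (appl T p) _ _) _; rewrite [X in X + _]distrC.
apply: le_trans (lerD (h _ _ _ r_gt0 rd tp ps pM) (h' _ _ _ r_gt0 rd' tp ps pM)) _.
by rewrite le_eqVlt; apply/orP; left; apply/eqP; ring.
Qed.

Lemma scalar_diff_unique a v v' : (forall t, 0 < t -> scalar_diff_at T i t a v) ->
  (forall t, 0 < t -> scalar_diff_at T i t a v') -> v = v'.
Proof.
move=> h h'; apply/eqP; rewrite -subr_eq0 -normr_le0; apply/ler_addgt0Pr => e e0.
have b1 : 0 < bumpC i + 1 by rewrite ltr_wpDl// bumpC_ge0.
have e1 : 0 < e / 2 / (bumpC i + 1) by rewrite !divr_gt0.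
apply: le_trans (scalar_diff_close (h _ e1) (h' _ e1)) _.
rewrite add0r -mulrDl mulrAC ler_pdivrMr// -splitr.
by rewrite ler_wpM2l ?(ltW e0)// lerDl.
Qed.

Lemma scalar_diff_move a (t v v' e : R) : scalar_diff_at T i t a v -> `|v - v'| <= e ->
  scalar_diff_at T i (t + e * 2 ^+ n) a v'.
Proof.
move=> [d d0 h] ve; exists d => // r p M r_gt0 rd tp ps pM.
apply: le_trans (ler_distD (v * intg p) _ _) _; rewrite !mulrDl; apply: lerD; first exact: h.
rewrite -mulrBl normrM.
have := intg_norm_le (ccfun_test tp) ps (ltW r_gt0) (fun x => jet_le0 (pM x)).
move=> /(ler_pM (normr_ge0 _) (normr_ge0 _) ve) /le_trans; apply.
by rewrite exprMn le_eqVlt; apply/orP; left; apply/eqP; ring.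
Qed.

(** The approximate derivatives of tolerance [1 / (p + 1)] carry pairwise overlapping error
    intervals; the supremum of the left end points lies in all of them. *)
Lemma scalar_diff_limit a : (forall t, 0 < t -> exists v, scalar_diff_at T i t a v) ->
  exists v, forall t, 0 < t -> scalar_diff_at T i t a v.
Proof.
move=> h; have b0 := bumpC_ge0 i.
have /choice[w hw] (p : nat) : exists v, scalar_diff_at T i (p.+1%:R^-1) a v.
  by apply: h; rewrite invr_gt0.
pose E := [set w m - m.+1%:R^-1 * bumpC i | m in [set: nat]].
have cl (p q : nat) : w p - p.+1%:R^-1 * bumpC i <= w q + q.+1%:R^-1 * bumpC i.
  have := scalar_diff_close (hw p) (hw q); rewrite ler_norml mulrDl => /andP[_].
  by move: (_^-1 * _) (_^-1 * _) (w p) (w q) => A B W W'; lra.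
have supE : has_sup E.
  split; first by exists (w 0%N - 1%:R^-1 * bumpC i), 0%N.
  by exists (w 0%N + 1%:R^-1 * bumpC i) => _ [p _ <-]; exact: cl.
have near (p : nat) : `|w p - sup E| <= p.+1%:R^-1 * bumpC i.
  rewrite ler_norml; apply/andP; split.
    suff : sup E <= w p + p.+1%:R^-1 * bumpC i by move: (_^-1 * _) (w p) (sup E) => A W W'; lra.
    by apply: ge_sup supE.1 _ => _ [q _ <-]; exact: cl.
  suff : w p - p.+1%:R^-1 * bumpC i <= sup E by move: (_^-1 * _) (w p) (sup E) => A W W'; lra.
  by apply: (ub_le_sup supE.2); exists p.
exists (sup E) => t t0.
pose K : R := 1 + bumpC i * 2 ^+ n.
have K0 : 0 < K by rewrite ltr_pwDl// mulr_ge0.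
have [p _ hp] := near_infty_natSinv_lt (PosNum (divr_gt0 t0 K0)).
have hp1 : p.+1%:R^-1 < t / K := hp p (leqnn _).
have [d d0 hd] := scalar_diff_move (hw p) (near p).
exists d => // r f M r_gt0 rd tf fs fM.
apply: le_trans (hd r f M r_gt0 rd tf fs fM) _.
rewrite ler_wpM2r ?(jet_le_ge0 (fM 0))// ler_wpM2r ?exprn_ge0 ?(ltW r_gt0)//.
have -> : p.+1%:R^-1 + p.+1%:R^-1 * bumpC i * 2 ^+ n = p.+1%:R^-1 * K by rewrite /K; ring.
by rewrite -ler_pdivlMr// ltW.
Qed.

End scalar_limits.

Section weak_derivative.
Context {R : realType} {n : nat} {Y : normedModType R}.
Notation V := 'rV[R]_n.
Notation test := (@test_function R n Y).
Variables (T : {linear testfun n Y -> R^o}) (i : nat) (j r0 : R) (a : V).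
Hypothesis estT : est T i 0 j r0 a.
Hypothesis j_ge0 : 0 <= j.
Hypothesis r0_gt0 : 0 < r0.

Definition weak_diff (g : dual Y) := forall y t, 0 < t -> scalar_diff_at (slice T y) i t a (g y).

(** The estimate at [a] bounds the slice in direction [y] by a multiple of [|y|], so approximate
    derivatives in a dense sequence of directions give them in all directions. Uniqueness makes the
    derivative linear in [y], and testing on a bump makes it bounded. *)
Lemma weak_diff_exists (u : nat -> Y) : (forall (y : Y) (e : R), 0 < e -> exists k,
  `|y - u k| <= e) ->
  (forall k t, 0 < t -> exists v, scalar_diff_at (slice T (u k)) i t a v) -> exists g, weak_diff g.
Proof.
move=> du hu.
have /choice[g hg] (y : Y) : exists v, forall t, 0 < t -> scalar_diff_at (slice T y) i t a v.
  apply: scalar_diff_limit => t t0.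
  have K0 : 0 < 2 * (j * 2 ^+ i + 1) by rewrite mulr_gt0// ltr_wpDl// mulr_ge0.
  have [k yk] := du y _ (divr_gt0 t0 K0).
  have [v [d d0 hd]] := hu k (t / 2) (divr_gt0 t0 (ltr0n R 2)).
  exists v, (Num.min d r0) => [|r p M r_gt0]; first by rewrite lt_min d0.
  rewrite lt_min => /andP[rd rr0] tp ps pM.
  apply: le_trans (ler_distD (appl (slice T (u k)) p) _ _) _.
  have h2 := hd r p M r_gt0 rd tp ps pM.
  have h1 : `|appl (slice T y) p - appl (slice T (u k)) p| <= t / 2 * r ^+ n * M.
    rewrite !appl_slice// -applB; [|exact: test_scale_cst|exact: test_scale_cst].
    under eq_fun do rewrite -scalerBr.
    rewrite -appl_slice//; apply: le_trans (est_slice (y - u k) estT r_gt0 (ltW rr0) tp ps pM) _.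
    rewrite addn0 ler_wpM2r ?(jet_le_ge0 (pM 0))// ler_wpM2r ?exprn_ge0 ?(ltW r_gt0)//.
    rewrite mulrA; apply: le_trans (ler_wpM2l _ yk) _; first by rewrite mulr_ge0.
    rewrite mulrA ler_pdivrMr//.
    by rewrite (_ : t / 2 * (2 * _) = j * 2 ^+ i * t + t) ?lerDl ?(ltW t0)//; field.
  by apply: le_trans (lerD h1 h2) _; rewrite -2!mulrDl -splitr.
have g_lin : linear g.
  move=> c y z; apply: (scalar_diff_unique (hg _)) => t t0.
  have c1 : 0 < `|c| + 1 by rewrite ltr_wpDl.
  have t1 : 0 < t / (`|c| + 1) by rewrite divr_gt0.
  have [d d0 hd] := hg y _ t1; have [d' d'0 hd'] := hg z _ t1.
  exists (Num.min d d') => [|r p M r_gt0]; first by rewrite lt_min d0.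
  rewrite lt_min => /andP[rd rd'] tp ps pM.
  have h1 := hd r p M r_gt0 rd tp ps pM; have h2 := hd' r p M r_gt0 rd' tp ps pM.
  have -> : appl (slice T (c *: y + z)) p = c * appl (slice T y) p + appl (slice T z) p.
    rewrite !appl_slice// -applZD; [|exact: test_scale_cst|exact: test_scale_cst].
    by congr appl; apply/funext => x; rewrite scalerDr !scalerA mulrC.
  rewrite -[c *: g y]/(c * g y).
  rewrite (_ : _ - _ = c * (appl (slice T y) p - g y * intg p)
    + (appl (slice T z) p - g z * intg p)); last by ring.
  apply: le_trans (ler_normD _ _) _; rewrite normrM.
  apply: le_trans (lerD (ler_wpM2l (normr_ge0 c) h1) h2) _.
  by rewrite le_eqVlt; apply/orP; left; apply/eqP; field; rewrite gt_eqF.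
have b0 := @bumpC_ge0 R n i.
have g_bnd y : `|g y| <= j * 2 ^+ i * bumpC (n := n) i * `|y|.
  apply/ler_addgt0Pr => e e0.
  have b1 : 0 < bumpC (n := n) (R := R) i + 1 by rewrite ltr_wpDl.
  have [d d0 hd] := hg y _ (divr_gt0 e0 b1).
  pose r := Num.min d r0 / 2.
  have m0 : 0 < Num.min d r0 by rewrite lt_min d0.
  have r_gt0 : 0 < r by rewrite divr_gt0.
  have : r < Num.min d r0 by rewrite /r; lra.
  rewrite lt_min => /andP[rd rr0].
  have [p [tp ps pM pI]] := @bump R n i a r r_gt0.
  have rn : 0 < r ^+ n by rewrite exprn_gt0.
  rewrite -(ler_pM2r rn).
  apply: le_trans (_ : _ <= `|g y| * intg p) _; first by rewrite ler_wpM2l.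
  rewrite -[X in _ * X](ger0_norm (le_trans (ltW rn) pI)) -normrM.
  rewrite -[g y * _](subrK (appl (slice T y) p)).
  apply: le_trans (ler_normD _ _) _; rewrite distrC addrC mulrDl; apply: lerD.
    apply: le_trans (est_slice y estT r_gt0 (ltW rr0) tp ps pM) _.
    by rewrite addn0 le_eqVlt; apply/orP; left; apply/eqP; ring.
  apply: le_trans (hd r p _ r_gt0 rd tp ps pM) _.
  rewrite mulrAC ler_wpM2r ?(ltW rn)// mulrAC ler_pdivrMr// ler_wpM2l ?(ltW e0)//.
  by rewrite lerDl.
pose G : {linear Y -> R^o} := HB.pack g (GRing.isLinear.Build R Y R^o _ g g_lin).
have cg : continuous g.
  apply: (@bounded_linear_continuous _ _ _ G); apply/linear_boundedP.
  exists (j * 2 ^+ i * bumpC (n := n) i); split; first exact: num_real.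
  by move=> M KM y; apply: le_trans (g_bnd y) _; rewrite ler_wpM2r// ltW.
have gP : g \in @cont_linear R Y by rewrite inE.
by exists (Dual gP) => y t t0; exact: hg.
Qed.

End weak_derivative.

(** * Vector values *)

Section weakly_null.
Context {R : realType} {n : nat} {Y : normedModType R}.
Notation V := 'rV[R]_n.
Notation test := (@test_function R n Y).
Notation stest := (@test_function R n R^o).
Variables (T : {linear testfun n Y -> R^o}) (a : V).
Implicit Types (f : V -> Y) (p : V -> R^o).

Definition null_at f := forall t, 0 < t -> exists2 d, 0 < d & forall r, 0 < r -> r < d ->
  `|appl T (fun x => f (r^-1 *: (x - a)))| <= t * r ^+ n.

Lemma dilate_supp (Z : normedModType R) (f : V -> Z) s r : 0 < r -> supp_in f 0 s ->
  supp_in (fun x => f (r^-1 *: (x - a))) a (r * s).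
Proof.
move=> r_gt0 fs x /fs; rewrite subr0 normrZ gtr0_norm ?invr_gt0//.
by rewrite ler_pdivrMl.
Qed.

Lemma dilate_test (Z : normedModType R) (f : V -> Z) r : 0 < r -> f \in @test_function R n Z ->
  (fun x => f (r^-1 *: (x - a))) \in @test_function R n Z.
Proof.
move=> r_gt0 tf; have [s _ fs] := test_supp_in tf.
by apply: supp_in_testfun (dilate_supp r_gt0 fs); apply: smooth_affine; exact: test_smooth.
Qed.

Lemma dilate_jet (Z : normedModType R) (f : V -> Z) i r s M : 0 < r -> smooth f ->
  (forall x, jet_le i s M f x) -> forall x, jet_le i (r * s) M (fun x => f (r^-1 *: (x - a))) x.
Proof.
move=> r_gt0 sf fM x; apply: (@jet_le_affine _ _ _ i s) => //.
by rewrite gtr0_norm ?invr_gt0// mulKf// gt_eqF.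
Qed.

Lemma null_atD f g : f \in test -> g \in test -> null_at f -> null_at g ->
  null_at (fun x => f x + g x).
Proof.
move=> tf tg hf hg t t0; have t20 : 0 < t / 2 by rewrite divr_gt0.
have [d d0 fd] := hf _ t20; have [d' d'0 gd] := hg _ t20.
exists (Num.min d d') => [|r r_gt0]; first by rewrite lt_min d0.
rewrite lt_min => /andP[rd rd'].
rewrite applD; [|exact: (dilate_test r_gt0 tf)|exact: (dilate_test r_gt0 tg)].
apply: le_trans (ler_normD _ _) _; rewrite [t]splitr mulrDl.
by apply: lerD; [exact: fd|exact: gd].
Qed.

Lemma null_at_sum (I : Type) (s : seq I) (F : I -> V -> Y) : (forall l, F l \in test) ->
  (forall l, null_at (F l)) -> null_at (fun x => \sum_(l <- s) F l x).
Proof.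
move=> tF hF; elim: s => [|l s IH].
  rewrite (_ : (fun x => _) = fun=> 0); last by apply/funext => x; rewrite big_nil.
  by move=> t t0; exists 1 => // r r_gt0 _; rewrite appl0 normr0 mulr_ge0 ?exprn_ge0// ltW.
rewrite (_ : (fun x => _) = fun x => F l x + \sum_(j <- s) F j x); last first.
  by apply/funext => x; rewrite big_cons.
by apply: null_atD => //; exact: (@test_sum R n Y I s xpredT).
Qed.

Lemma null_at_slice i p y : p \in stest -> (forall t, 0 < t ->
  scalar_diff_at (slice T y) i t a 0) ->
  null_at (fun x => p x *: y).
Proof.
move=> tp hy t t0; have [s s0 ps] := test_supp_in tp.
have [M pM] := test_jet i s tp; have M0 := jet_le_ge0 (pM 0).
have K0 : 0 < s ^+ n * (M + 1) by rewrite mulr_gt0 ?exprn_gt0// ltr_wpDl.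
have [d d0 hd] := hy _ (divr_gt0 t0 K0).
exists (d / s) => [|r r_gt0]; first by rewrite divr_gt0.
rewrite ltr_pdivlMr// => rd.
have tpr := dilate_test r_gt0 tp.
have := hd (r * s) _ M (mulr_gt0 r_gt0 s0) rd tpr (dilate_supp r_gt0 ps)
  (dilate_jet r_gt0 (test_smooth tp) pM).
rewrite mul0r subr0 appl_slice// => /le_trans; apply.
have -> : t / (s ^+ n * (M + 1)) * (r * s) ^+ n * M = t * r ^+ n * (M / (M + 1)).
  by rewrite exprMn; field; rewrite !gt_eqF// ?exprn_gt0// ltr_wpDl.
rewrite ler_piMr//; first by rewrite mulr_ge0 ?exprn_ge0// ltW.
by rewrite ler_pdivrMr ?ltr_wpDl// mul1r lerDl.
Qed.

Section density.
Variables (i : nat) (j r0 : R) (C : set V).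
Hypothesis cC : compact C.
Hypothesis estC : forall b, C b -> est T i 0 j r0 b.
Hypothesis j_ge0 : 0 <= j.
Hypothesis r0_gt0 : 0 < r0.

(* [f] is uniformly close to a finite sum of products of a scalar test function and a vector. *)
Lemma null_at_density f : C a -> density_pt C a ->
  (forall y t, 0 < t -> scalar_diff_at (slice T y) i t a 0) -> f \in test -> null_at f.
Proof.
move=> Ca da hT tf t t0; have [s s0 fs] := test_supp_in tf.
pose q := s + 1; have q0 : 0 < q by rewrite addr_gt0.
pose c1 := 4 ^+ n * tile_const (n := n) (R := R) i.
have tc := @tile_const_ge1 R n i.
have c10 : 0 <= c1 by rewrite mulr_ge0 ?exprn_ge0// (le_trans ler01).
have pC0 := @pointC_ge0 R n i 0.
pose K := j * pointC (n := n) (R := R) i 0 * q ^+ n * c1.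
have K0 : 0 <= K by rewrite /K; nonneg.
have t30 : 0 < t / 3 by rewrite divr_gt0.
have e0 : 0 < t / 3 / (K + 1) by rewrite divr_gt0// ltr_wpDl.
have [d d0 fd] := test_unif_cont tf e0.
pose D : R := Num.min d 1; have D0 : 0 < D by rewrite lt_min d0 ltr01.
have Dd : D <= d by rewrite ge_min lexx.
have D1 : D <= 1 by rewrite ge_min lexx orbT.
have [N qN] : exists N, q <= D * N%:R.
  exists (Num.bound (q / D)); rewrite mulrC -ler_pdivrMr//.
  by apply: ltW; apply: archi_boundP; rewrite divr_ge0// ltW.
pose F (l : gridix N) x : Y := tile_at 0 D l x *: f (node 0 D l).
have tF l : F l \in test by apply: test_scale_cst; exact: test_tile_at.
pose G x : Y := f x - \sum_l F l x.
have tFs : (fun x => \sum_l F l x) \in test by exact: (@test_sum R n Y _ _ xpredT).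
have tG : G \in test by exact: testB.
have Gs : supp_in G 0 q.
  move=> x; rewrite subr0; apply: contraNT; rewrite -ltNge => qx.
  have fx : f x = 0.
    have [//|/fs] := eqVneq (f x) 0; rewrite subr0 => xs; move: qx.
    by rewrite ltNge (le_trans xs)// lerDl.
  rewrite /G fx big1 ?subr0// => l _.
  have [|tl] := eqVneq (tile_at 0 D l x) 0; first by rewrite /F => ->; rewrite scale0r.
  rewrite /F; have [->|/fs] := eqVneq (f (node 0 D l)) 0; first by rewrite scaler0.
  rewrite subr0 => ns; move: qx; rewrite ltNge => /negP; case.
  rewrite -[x](subrK (node 0 D l)); apply: le_trans (ler_normD _ _) _.
  by rewrite addrC lerD// (le_trans (tile_at_supp D0 tl)).
have Ge x : `|G x| <= t / 3 / (K + 1) * c1.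
  have e1 : 0 <= t / 3 / (K + 1) * c1 by rewrite mulr_ge0// ltW.
  have [qx|qx] := leP `|x| q; last first.
    have [->|/Gs] := eqVneq (G x) 0; first by rewrite normr0.
    by rewrite subr0 leNgt qx.
  have -> : G x = \sum_(l : gridix N) tile_at 0 D l x *: (f x - f (node 0 D l)).
    under eq_bigr do rewrite scalerBr; rewrite sumrB -scaler_suml sum_tile_at ?scale1r//.
    by rewrite subr0 (le_trans qx).
  apply: le_trans (ler_norm_sum _ _ _) _.
  rewrite (bigID [pred l : gridix N | (`|x - node 0 D l| <= D)%R])/= [X in _ + X]big1 ?addr0;
    last first.
    move=> l xl; have [->|/(tile_at_supp D0) xl'] := eqVneq (tile_at 0 D l x) 0.
      by rewrite scale0r normr0.
    by rewrite xl' in xl.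
  apply: le_trans (_ : _ <= \sum_(l : gridix N | (`|x - node 0 D l| <= D)%R) tile_const (n := n) i
    * (t / 3 / (K + 1))) _.
    apply: ler_sum => l xl; rewrite normrZ; apply: ler_pM => //.
      by have h := jet_le0 (@jet_tile_at R n 0 D N l i x D0); exact: h.
    by apply: fd; apply: le_trans xl Dd.
  rewrite sumr_const -[leLHS]mulr_natl mulrC /c1 mulrA -mulrA [leRHS]mulrC -[leRHS]mulrA.
  have h4 : (#|[pred l : gridix N | (`|x - node 0 D l| <= D)%R]|%:R <= 4 ^+ n :> R).
    by rewrite -natrX ler_nat; exact: card_tiles_at.
  rewrite mulrC; apply: le_trans (ler_wpM2r _ h4) _ => //.
  by rewrite mulr_ge0// ?ltW// (lt_le_trans ltr01).
(* The jet bound [M] of the error depends on the grid and need not be small, but the density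
   estimate multiplies it by a factor chosen afterwards. The sup norm meets the fixed constant
   [pointC], and it was made small beforehand. *)
have [M GM] := test_jet i q tG; have M0 := jet_le_ge0 (GM 0).
have e2 : 0 < t / 3 / (q ^+ n * (M + 1)).
  by rewrite divr_gt0// mulr_gt0 ?exprn_gt0// ltr_wpDl.
have [d1 d10 hd1] := density_estimate cC estC j_ge0 r0_gt0 Ca da e2.
have [d2 d20 hd2] : exists2 d, 0 < d & forall r, 0 < r -> r < d ->
    `|appl T (fun x => \sum_l F l (r^-1 *: (x - a)))| <= t / 3 * r ^+ n.
  by apply: (null_at_sum (index_enum _) tF) => // l; apply: null_at_slice;
    [exact: test_tile_at|exact: hT].
exists (Num.min (d1 / q) d2) => [|r r_gt0]; first by rewrite lt_min d20 divr_gt0.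
rewrite lt_min ltr_pdivlMr// => /andP[rd1 rd2].
have -> : (fun x => f (r^-1 *: (x - a))) =
    fun x => G (r^-1 *: (x - a)) + \sum_l F l (r^-1 *: (x - a)).
  by apply/funext => x; rewrite /G subrK.
have rn0 : 0 <= r ^+ n by rewrite exprn_ge0// ltW.
rewrite applD; [|exact: (dilate_test r_gt0 tG)|exact: (dilate_test r_gt0 tFs)].
apply: le_trans (ler_normD _ _) _.
have hG : `|appl T (fun x => G (r^-1 *: (x - a)))| <= t / 3 * r ^+ n + t / 3 * r ^+ n.
  apply: le_trans (hd1 (r * q) _ M (t / 3 / (K + 1) * c1) (mulr_gt0 r_gt0 q0) rd1
    (dilate_test r_gt0 tG)
    (dilate_supp r_gt0 Gs) (dilate_jet r_gt0 (test_smooth tG) GM) _) _;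
      first by move=> x; exact: Ge.
  rewrite eqxx mul1r addn0 exprMn; apply: lerD.
    have -> : t / 3 / (q ^+ n * (M + 1)) * (r ^+ n * q ^+ n) * M = t / 3 * r ^+ n * (M / (M + 1)).
      by field; rewrite !gt_eqF// ?exprn_gt0// ltr_wpDl.
    rewrite ler_piMr//; first by rewrite (mulr_ge0 (ltW t30)).
    by rewrite ler_pdivrMr ?ltr_wpDl// mul1r lerDl.
  have -> : j * pointC (n := n) i 0 * (r ^+ n * q ^+ n) * (t / 3 / (K + 1) * c1) =
      t / 3 * r ^+ n * (K / (K + 1)) by rewrite /K; ring.
  rewrite ler_piMr//; first by rewrite (mulr_ge0 (ltW t30)).
  by rewrite ler_pdivrMr ?ltr_wpDl// mul1r lerDl.
apply: le_trans (lerD hG (hd2 r r_gt0 rd2)) _.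
by rewrite le_eqVlt; apply/orP; left; apply/eqP; field.
Qed.

End density.

End weakly_null.

Section finite_values.
Context {R : realType} {n : nat} {Y : normedModType R}.
Notation V := 'rV[R]_n.
Notation test := (@test_function R n Y).
Implicit Types (f : V -> Y).

(** The values at the nodes of a fine grid form a finite net of the range. Below, the radius at
    which an estimate holds depends on the direction [u k]; with finitely many directions these
    radii have a positive minimum. *)
Lemma test_finite_net f (u : nat -> Y) (e : R) : f \in test -> 0 < e ->
  (forall y (e : R), 0 < e -> exists k, `|y - u k| <= e) ->
  exists N, forall x, exists2 k, (k < N)%N & `|f x - u k| <= e.
Proof.
move=> tf e0 du; have [s s0 fs] := test_supp_in tf.
have e20 : 0 < e / 2 by rewrite divr_gt0.
have [d d0 fd] := test_unif_cont tf e20.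
have [N sN] : exists N, s <= d * N%:R.
  exists (Num.bound (s / d)); rewrite mulrC -ler_pdivrMr//.
  by apply: ltW; apply: archi_boundP; rewrite divr_ge0// ltW.
have [k0 hk0] := du 0 e e0.
have /choice[k hk] (l : gridix N) : exists k, `|f (node 0 d l) - u k| <= e / 2.
  exact: du.
exists (maxn k0 (\max_(l : gridix N) k l)).+1 => x.
have [xs|xs] := leP `|x| s; last first.
  exists k0; first by rewrite ltnS leq_maxl.
  have [->//|/fs] := eqVneq (f x) 0.
  by rewrite subr0 leNgt xs.
have [l tl] : exists l : gridix N, tile_at 0 d l x != 0.
  apply: contrapT => nl; have := @sum_tile_at R n 0 d N x d0.
  rewrite subr0 => /(_ (le_trans xs sN)); rewrite big1 => [/eqP|l _].
    by rewrite eq_sym oner_eq0.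
  by apply/eqP; apply: contrapT => tl; apply: nl; exists l; exact/negP.
exists (k l).
  by rewrite ltnS leq_max; apply/orP; right; apply: (@leq_bigmax (gridix N) k).
apply: le_trans (ler_distD (f (node 0 d l)) _ _) _; rewrite [e]splitr; apply: lerD => //.
exact/fd/(tile_at_supp d0).
Qed.

Lemma finite_lower_bound (s : nat -> R) N : (forall k, 0 < s k) ->
  exists2 d, 0 < d & forall k, (k < N)%N -> d <= s k.
Proof.
move=> s0; elim: N => [|N [d d0 hd]]; first by exists 1.
exists (Num.min d (s N)) => [|k]; first by rewrite lt_min d0 s0.
rewrite ltnS leq_eqVlt => /orP[/eqP->|/hd kd]; first by rewrite ge_min lexx orbT.
by rewrite ge_min kd.
Qed.

End finite_values.

Lemma mul_div_succ_le (R : realFieldType) (A t : R) : 0 <= A -> 0 <= t -> A * (t / (A + 1)) <= t.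
Proof.
move=> A0 t0; rewrite mulrA ler_pdivrMr ?ltr_wpDl// mulrC.
by rewrite ler_wpM2l// lerDl.
Qed.

Section uniform_estimate.
Context {R : realType} {n : nat} {Y : normedModType R}.
Notation V := 'rV[R]_n.
Notation mu := (@lebesgue_rV R n).
Notation test := (@test_function R n Y).
Variables (T : {linear testfun n Y -> R^o}) (i : nat) (j r0 : R) (u : nat -> Y).
Hypothesis j_ge0 : 0 <= j.
Hypothesis r0_gt0 : 0 < r0.
Hypothesis u_dense : forall y (e : R), 0 < e -> exists k, `|y - u k| <= e.
Implicit Types (f : V -> Y) (a : V).

(** [2] counts the errors [a1] and [a2] of the next proof; in the last term [3] bounds [|u k| + 1]
    for the vectors used, and [9 ^+ n] comes from counting tiles. *)
Definition unifC : R := 2 + 3 * pieceC (n := n) i 0 * etaC (n := n) i * 9 ^+ n.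

Definition unif_le (c : R) a := exists2 d, 0 < d & forall r f, 0 < r -> r < d -> f \in test ->
  supp_in f a r -> (forall x, jet_le i r 1 f x) -> `|appl T f| <= c * r ^+ n.

(* [f] is approximated on the tiles close to [K] by finitely many values [u k]. *)
Lemma unif_le_density (K : set V) (t : R) (s : nat -> R) a : compact K ->
  (forall b, K b -> est T i 0 j r0 b) -> 0 < t -> (forall k, 0 < s k) ->
  (forall k b, K b -> est (slice T (u k)) i 0 (t * (`|u k| + 1)) (s k) b) ->
  K a -> density_pt K a -> unif_le (unifC * t) a.
Proof.
move=> cK estK t0 s0 estu Ka da.
have clK : closed K by apply: compact_closed => //; exact: norm_hausdorff.
have [Lb CLb] := compact_nat_bound cK.
rewrite /unifC.
have := @pieceC_ge0 R n i 0; have [pC epC] : exists c : R, pieceC (n := n) i 0 = c by eexists.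
rewrite epC => pC0.
have := @etaC_ge0 R n i; have [eC eeC] : exists c : R, etaC (n := n) i = c by eexists.
rewrite eeC => eC0.
have := @layerC_ge0 R n i 0; have [lC elC] : exists c : R, layerC (n := n) i 0 = c by eexists.
rewrite elC => lC0.
have k1 : 0 <= 3 * (j * lC) by nonneg.
have e0 : 0 < t / (3 * (j * lC) + 1) by rewrite divr_gt0// ltr_wpDl.
have [d1 d10 hd1] := density_cube da e0.
exists (Num.min d1 (Num.min 1 (r0 / 21))) => [|r f r_gt0].
  by rewrite !lt_min d10 ltr01 divr_gt0.
rewrite !lt_min => /andP[rd1 /andP[r1 rr0]] tf fs fM.
have r21 : 21 * r <= r0 by rewrite mulrC -ler_pdivlMr// ltW.
have [m0 hm0] := whitney_pt CLb clK estK j_ge0 Ka r_gt0 (ltW r1) r21 tf fs fM (hd1 r r_gt0 rd1).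
have [k2 ek2] : exists k2, j * pC * 2 ^+ i * eC * 9 ^+ n * 2 = k2 by eexists.
have k20 : 0 <= k2 by rewrite -ek2; nonneg.
(* The bound [1] keeps the approximating vectors of norm at most [2]; the other makes the total
   error of replacing [f] by constants on tiles at most [t * r ^+ n]. *)
pose e' := Num.min 1 (t / (k2 + 1)).
have e'0 : 0 < e' by rewrite lt_min ltr01 divr_gt0// ltr_wpDl.
have e'1 : e' <= 1 by rewrite ge_min lexx.
have e'k : e' * k2 <= t.
  rewrite mulrC; apply: le_trans (mul_div_succ_le k20 (ltW t0)).
  by rewrite ler_wpM2l// ge_min lexx orbT.
have e'20 : 0 < e' / 2 by rewrite divr_gt0.
have [d d0 fd] := test_unif_cont tf e'20.
have [N hN] := test_finite_net tf e'20 u_dense.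
have /choice[k hk] (x : V) : exists k, (k < N)%N /\ `|f x - u k| <= e' / 2.
  by have [k kN xk] := hN x; exists k.
have [w w0 hw] := finite_lower_bound N s0.
have [M1 fM1] := test_jet i 1 tf; have M10 := jet_le_ge0 (fM1 0).
have [m1 h1] := dy_small d0.
have [m2 h2] := dy_small (divr_gt0 r0_gt0 (ltr0n R 21)).
have [m3 h3] := dy_small (divr_gt0 w0 (ltr0n R 21)).
have [m4 h4] := dy_small (divr_gt0 e'0 (ltr_pwDr ltr01 M10)).
have [m5 h5] := dy_small r_gt0.
(* [r] and [f] are fixed before the scale [m], which may therefore depend on the modulus of
   continuity and on the derivatives of [f]; the final bound does not involve [m]. *)
have [m] : exists m, (maxn m0 (maxn m1 (maxn m2 (maxn m3 (maxn m4 m5)))) <= m)%N by eexists.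
rewrite !geq_max => /andP[/hm0 hm /and5P[/h1 dd /h2 dr0 /h3 dw /h4 dM /h5 dr]].
have dp := dy_gt0 (R := R) m; set S := @touches R n Y Lb (cutoff K Lb m) f m.
have cS : #|S|%:R * dy m ^+ n <= (9 * r) ^+ n :> R.
  exact: (@touches_supp_count R n Y K Lb f a r m fs r_gt0 dr).
have mr0 : 21 * dy m <= r0 by rewrite mulrC -ler_pdivlMr.
pose y (l : gridix (gridn Lb m)) := u (k (node 0 (dy m) l)).
have fy l x : l \in S -> `|x - node 0 (dy m) l| <= dy m -> `|f x - y l| <= e'.
  move=> _ xl; apply: le_trans (ler_distD (f (node 0 (dy m) l)) _ _) _.
  rewrite [e']splitr; apply: lerD; first exact/fd/(le_trans xl).
  by have [_] := hk (node 0 (dy m) l).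
have y2 l : `|y l| <= 2.
  have [_ h] := hk (node 0 (dy m) l).
  rewrite -[y l](subrK (f (node 0 (dy m) l))); apply: le_trans (ler_normD _ _) _.
  rewrite distrC; apply: le_trans (lerD h (jet_le0 (fM _))) _; lra.
have h := cutoff_values CLb estK tf fM1 mr0 fy.
have piece l : l \in S ->
    `|appl T (fun x => tile_at 0 (dy m) l x *: (cutoff K Lb m x *: y l))| <=
      3 * t * pC * eC * dy m ^+ n.
  move=> lS; have [x [xl ex fx]] := touches_near lS; have [b Kb xb] := cutoff_neq0 ex.
  have sc := smooth_cutoff K Lb m.
  have tt := test_scaleM (@test_tile_at R n 0 (dy m) _ l dp) sc.
  have -> : (fun x => tile_at 0 (dy m) l x *: (cutoff K Lb m x *: y l)) =
      fun x => (tile_at 0 (dy m) l x *: cutoff K Lb m x) *: y l.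
    by apply/funext => z; rewrite scalerA.
  rewrite -appl_slice//.
  have [kN _] := hk (node 0 (dy m) l).
  apply: le_trans (@est_piece _ _ _ (slice T (y l)) i 0 _ _ b (dy m) _ l (cutoff K Lb m) eC
    (estu _ _ Kb) dp _ _ sc _) _.
  - by apply: le_trans (hw _ kN); rewrite mulrC -ler_pdivlMr.
  - apply: le_trans (ler_distD x _ _) _; rewrite distrC.
    by apply: le_trans (lerD xl xb) _; lra.
  - by move=> z _; rewrite -eeC; exact: jet_cutoff.
  - rewrite addn0 epC.
    have -> : 3 * t * pC * eC * dy m ^+ n = t * 3 * (pC * dy m ^+ n * eC) by ring.
    have p0 : 0 <= pC * dy m ^+ n * eC by exact: (mulr_ge0
      (mulr_ge0 pC0 (exprn_ge0 n (ltW dp))) eC0).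
    apply: (ler_wpM2r p0); apply: (ler_wpM2l (ltW t0)).
    by have := y2 l; rewrite /y; lra.
have dn0 : 0 <= dy m ^+ n :> R by rewrite exprn_ge0// ltW.
have rn0 : 0 <= r ^+ n by rewrite exprn_ge0// ltW.
have a1 : `|appl T f - appl T (fun x => cutoff K Lb m x *: f x)| <= t * r ^+ n.
  apply: le_trans hm _; rewrite expr0 !mulr1 elC.
  by have := ler_wpM2r rn0 (mul_div_succ_le k1 (ltW t0)); rewrite !mulrA.
have a2 : `|appl T (fun x => cutoff K Lb m x *: f x) -
    \sum_(l in S) appl T (fun x => tile_at 0 (dy m) l x *: (cutoff K Lb m x *: y l))| <= t * r ^+ n.
  apply: le_trans h _; rewrite addn0 epC eeC -/S.
  have dM1 : dy m * M1 <= e'.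
    apply: le_trans (ler_wpM2r M10 dM) _.
    by rewrite mulrC; exact: mul_div_succ_le M10 (ltW e'0).
  apply: le_trans (_ : _ <= #|S|%:R * (j * (pC * dy m ^+ n * (2 ^+ i * (eC * (2 * e')))))) _.
    apply: ler_wpM2l => //; apply: (ler_wpM2l j_ge0); apply: (ler_wpM2l (mulr_ge0 pC0 dn0)).
    apply: ler_wpM2l; first exact: exprn_ge0.
    apply: (ler_wpM2l eC0).
    by rewrite mulr_natl mulr2n lerD2l.
  have -> : #|S|%:R * (j * (pC * dy m ^+ n * (2 ^+ i * (eC * (2 * e'))))) =
      j * pC * 2 ^+ i * eC * (2 * e') * (#|S|%:R * dy m ^+ n) by ring.
  apply: le_trans (ler_wpM2l _ cS) _.
    by have e'00 := ltW e'0; nonneg.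
  rewrite exprMn.
  have -> : j * pC * 2 ^+ i * eC * (2 * e') * (9 ^+ n * r ^+ n) =
    e' * k2 * r ^+ n by rewrite -ek2; ring.
  by rewrite ler_wpM2r// exprn_ge0// ltW.
have a3 : `|\sum_(l in S) appl T (fun x => tile_at 0 (dy m) l x *: (cutoff K Lb m x *: y l))| <=
    3 * pC * eC * 9 ^+ n * t * r ^+ n.
  apply: le_trans (ler_norm_sum _ _ _) _; apply: le_trans (ler_sum _ _) _.
    by move=> l lS; exact: (piece l lS).
  rewrite sumr_const -[leLHS]mulr_natl.
  have -> : #|S|%:R * (3 * t * pC * eC * dy m ^+ n) =
    3 * t * pC * eC * (#|S|%:R * dy m ^+ n) by ring.
  apply: le_trans (ler_wpM2l _ cS) _.
    by have t00 := ltW t0; nonneg.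
  by rewrite exprMn le_eqVlt; apply/orP; left; apply/eqP; ring.
rewrite -[appl T f](subrK (appl T (fun x => cutoff K Lb m x *: f x))).
apply: le_trans (ler_normD _ _) _.
rewrite -[X in _ + `|X|](subrK (\sum_(l in S) appl T
  (fun x => tile_at 0 (dy m) l x *: (cutoff K Lb m x *: y l)))).
apply: le_trans (lerD a1 (le_trans (ler_normD _ _) (lerD a2 a3))) _.
by rewrite le_eqVlt; apply/orP; left; apply/eqP; ring.
Qed.

(** An Egorov argument: for each [k] the radius is made uniform off a set of measure
    [e / 2 ^ (k + 1)], and the intersection [K] of the remaining sets is compact. Closures are taken
    to have measurable sets, and [est_closure] then accounts for the factor [2 ^+ (n + i)]. Density
    points of [K] satisfy the uniform estimate. *)
Lemma ae_unif_le (C : set V) (t : R) : compact C -> (forall b, C b -> est T i 0 j r0 b) -> 0 < t ->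
  mu.-negligible ([set a | C a /\ forall y, exists2 s, 0 < s &
      est (slice T y) i 0 (t * (`|y| + 1)) s a] `\` unif_le (unifC * (t * 2 ^+ (n + i)))).
Proof.
move=> cC estC t0.
have clC : closed C by apply: compact_closed => //; exact: norm_hausdorff.
have tt0 : 0 < t * 2 ^+ (n + i) by rewrite mulr_gt0// exprn_gt0.
pose G k p := [set a | C a /\ est (slice T (u k)) i 0 (t * (`|u k| + 1)) (p.+1%:R^-1) a].
pose E k p := closure (G k p).
have EC k p : E k p `<=` C.
  by rewrite /E closureE; apply: smallest_sub => // a [].
have mE k p : measurable (E k p) by apply: closed_measurable_rV; exact: closed_closure.
have Emono k p q : (p <= q)%N -> E k p `<=` E k q.
  move=> pq; apply: closureS => a [Ca ea]; split => //.
  by apply: est_mono ea => //; rewrite lef_pV2 ?posrE// ler_nat.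
have estE k p b : E k p b ->
    est (slice T (u k)) i 0 (t * 2 ^+ (n + i) * (`|u k| + 1)) (p.+1%:R^-1 / 2) b.
  move=> Eb.
  have -> : t * 2 ^+ (n + i) * (`|u k| + 1) = t * (`|u k| + 1) * 2 ^+ (n + 0 + i).
    by rewrite addn0 mulrAC.
  apply: est_closure; move: b Eb; rewrite -/(_ `<=` _); apply: closureS => a [].
  by [].
pose B k := \bigcup_p E k p.
have mB k : measurable (B k) by exact: bigcupT_measurable.
have [L L0 CL] := compact_bounded_cube cC.
apply: negligible_small => e e0.
have /choice[p hp] (k : nat) : exists p, (mu (B k `\` E k p) <= (e / (2 ^ k.+1)%:R)%:E)%E.
  have ek0 : 0 < e / (2 ^ k.+1)%:R by rewrite divr_gt0// ltr0n expn_gt0.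
  pose F p := B k `\` E k p.
  have mF p : measurable (F p) by exact: measurableD.
  have capF : \bigcap_p F p = set0.
    apply/seteqP; split => // x Fx; have [[p _ Ep] _] := Fx 0%N I.
    by have [_] := Fx p I.
  have cvgF : mu \o F @ \oo --> mu (\bigcap_p F p).
    apply: nonincreasing_cvg_mu => //; last 2 first.
    - by rewrite capF; exact: measurable0.
    - apply/nonincreasing_seqP => q; apply/subsetPset => x [Bx nE]; split => //.
      by apply: contra_not nE; exact: Emono.
    apply: le_lt_trans (_ : (mu (cube 0 L) < +oo)%E).
      apply: le_measure; rewrite ?inE//; first exact: measurable_cube.
      by move=> x [[q _ /EC Cx] _]; exact: CL.
    by rewrite measure_cube ?ltry// ltW.
  rewrite capF measure0 in cvgF.
  have [q _ /(_ q (leqnn _)) /= qe] : \forall q \near \oo, (mu (F q) < (e / (2 ^ k.+1)%:R)%:E)%E.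
    apply: (cvgF [set x | (x < (e / (2 ^ k.+1)%:R)%:E)%E]); apply: open_nbhs_nbhs.
    by split; [exact: open_ereal_lt_ereal|rewrite /= lte_fin].
  by exists q; exact: ltW.
pose K := \bigcap_k E k (p k).
have cK : compact K.
  apply: (@subclosed_compact _ _ C) => //.
    by apply: closed_bigI => k _; exact: closed_closure.
  by move=> x /(_ 0%N I) /EC.
have [A [mA A0 KA]] := ae_density_pt cK.
pose U := \bigcup_k (B k `\` E k (p k)).
have mU : measurable U by apply: bigcupT_measurable => k; exact: measurableD.
have mUe : (mu U <= e%:E)%E.
  apply: le_trans (_ : (\sum_(k <oo) mu (B k `\` E k (p k)) <= _)%E).
    by apply: measure_sigma_subadditive => // k; exact: measurableD.
  apply: le_trans (epsilon_trick0 xpredT (ltW e0)).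
  by apply: lee_nneseries => // k _; exact: measure_ge0.
exists (U `|` A); split; first exact: measurableU.
  move=> a [[Ca ea] na]; have [Ua|nUa] := pselect (U a); [by left|right; apply: KA].
  have Ka : K a.
    move=> k _; apply: contrapT => nE; apply: nUa; exists k => //; split => //.
    have [s s0 es] := ea (u k).
    have [q _ /(_ q (leqnn _)) /= qs] := near_infty_natSinv_lt (PosNum s0).
    exists q => //; apply: subset_closure; split => //.
    by apply: est_mono es => //; exact: ltW.
  split => // da; apply: na.
  apply: (unif_le_density (s := fun k => (p k).+1%:R^-1 / 2) cK _ tt0 _ _ Ka da).
  - by move=> b /(_ 0%N I) /EC; exact: estC.
  - by move=> k; rewrite divr_gt0.
  - by move=> k b /(_ k I); exact: estE.
have h := @measureU2 _ _ _ mu U A mU mA; apply: le_trans h _.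
by rewrite -[leRHS]adde0; apply: leeD => //; rewrite le_eqVlt; apply/orP; left; apply/eqP.
Qed.

End uniform_estimate.

Lemma separable_seq (R : realType) (X : normedModType R) : separable_space X ->
  exists u : nat -> X, forall y (e : R), 0 < e -> exists k, `|y - u k| <= e.
Proof.
move=> [D /countable_injP[f] fD dD].
pose u k : X := if pselect (exists2 y, D y & f y = k) is left h then projT1 (cid2 h) else 0.
exists u => y e e0.
have [||z [yz Dz]] := dD (ball y e).
- by exists y; exact: ballxx.
- exact: ball_open.
exists (f z); rewrite /u; case: pselect => [h|[]]; last by exists z.
case: cid2 => z' Dz' /= /fD -> //; try exact/mem_set.
by move: yz; rewrite -ball_normE => /ltW.
Qed.

Section order_zero.
Context {R : realType} {n : nat} {Y : normedModType R}.
Notation V := 'rV[R]_n.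
Notation mu := (@lebesgue_rV R n).
Notation test := (@test_function R n Y).
Variables (T : {linear testfun n Y -> R^o}) (i : nat).
Implicit Types (f : V -> Y) (a : V) (g : dual Y).

Lemma slice_subcst a g (p : V -> R^o) y : p \in @test_function R n R^o ->
  appl (slice (subcst T g) y) p = appl (slice T y) p - g y * intg p.
Proof.
move=> tp; rewrite !appl_slice// appl_subcst; last exact: test_scale_cst.
congr (_ - _); rewrite -intgZ; last exact: ccfun_test.
by congr intg; apply/funext => x; rewrite linearZ/= mulrC.
Qed.

Lemma weak_diff_subcst a g : weak_diff T i a g ->
  forall y t, 0 < t -> scalar_diff_at (slice (subcst T g) y) i t a 0.
Proof.
move=> h y t t0; have [d d0 hd] := h y t t0.
exists d => // r p M r_gt0 rd tp ps pM.
by rewrite mul0r subr0 (slice_subcst a)//; exact: hd.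
Qed.

Variables (j r0 : R) (C : set V).
Hypothesis cC : compact C.
Hypothesis estC : forall b, C b -> est T i 0 j r0 b.
Hypothesis j_ge0 : 0 <= j.
Hypothesis r0_gt0 : 0 < r0.

Lemma ae_weak_diff : separable_space Y ->
  mu.-negligible (C `\` [set a | exists g, weak_diff T i a g]).
Proof.
move=> /separable_seq[u du].
pose N k := C `\` [set a | forall t, 0 < t -> exists v, scalar_diff_at (slice T (u k)) i t a v].
apply: (@negligibleS _ _ _ mu (\bigcup_k N k)).
  move=> a [Ca na]; apply: contrapT => nN; apply: na.
  apply: (weak_diff_exists (estC Ca) j_ge0 r0_gt0 du) => k; apply: contrapT => nk.
  by apply: nN; exists k.
apply: negligible_bigcup_countable => k.
apply: (ae_scalar_diff (T := slice T (u k)) cC _ _ r0_gt0).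
  by move=> b Cb; exact: est_slice (estC Cb).
by rewrite !mulr_ge0.
Qed.

Lemma ae_null_at : separable_space Y ->
  mu.-negligible (C `\` [set a | exists g, forall f, f \in test -> null_at (subcst T g) a f]).
Proof.
move=> sY; apply: (@negligibleS _ _ _ mu
  ((C `\` [set a | exists g, weak_diff T i a g]) `|` (C `\` density_pt C))); last first.
  by apply: negligibleU; [exact: ae_weak_diff|exact: ae_density_pt].
move=> a [Ca na]; have [da|da] := pselect (density_pt C a); [left|by right].
split => // -[g hg]; apply: na; exists g => f tf.
apply: (null_at_density cC _ _ r0_gt0 Ca da (weak_diff_subcst hg) tf).
  by move=> b Cb; exact: est_subcst (estC Cb).
by rewrite addr_ge0// mulr_ge0// (normr_ge0 g).
Qed.

(** The derivative [g] varies with [a], while the previous lemma treats one distribution at a time.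
    A dense sequence [h] in the dual leaves countably many distributions: near [a], subtracting a
    close [h k] instead of [g] changes the slice in direction [y] by at most [w * |y|] times
    [r ^+ n] and the jet bound. *)
Lemma ae_unif_le_subcst : separable_space Y -> separable_space (dual Y) ->
  mu.-negligible (C `\` [set a | exists g, forall t, 0 < t -> unif_le (subcst T g) i t a]).
Proof.
move=> sY /separable_seq[h dh]; have [u du] := separable_seq sY.
pose N kp := [set a | C a /\ forall y, exists2 s, 0 < s &
      est (slice (subcst T (h kp.1)) y) i 0 (kp.2.+1%:R^-1 * (`|y| + 1)) s a] `\`
    unif_le (subcst T (h kp.1)) i (unifC (n := n) (R := R) i * (kp.2.+1%:R^-1 * 2 ^+ (n + i))).
apply: (@negligibleS _ _ _ mu
  ((C `\` [set a | exists g, weak_diff T i a g]) `|` \bigcup_kp N kp)); last first.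
  apply: negligibleU; first exact: ae_weak_diff.
  apply: negligible_bigcup_countable => -[k p].
  apply: (ae_unif_le (T := subcst T (h k)) (j := j + dual_norm (h k) * 2 ^+ n) _ r0_gt0 du cC).
  - by apply: (addr_ge0 j_ge0); apply: mulr_ge0; [exact: (normr_ge0 (h k))|exact: exprn_ge0].
  - by move=> b Cb; exact: est_subcst (estC Cb).
  - by rewrite invr_gt0.
move=> a [Ca na]; apply: contrapT => nN; apply: nN.
have [[g hg]|nw] := pselect (exists g, weak_diff T i a g); last by left.
right; apply: contrapT => nN; apply: na; exists g => t t0.
have n2 : 0 < 2 ^+ n :> R by rewrite exprn_gt0.
have K0 : 0 <= unifC (n := n) (R := R) i * 2 ^+ (n + i).
  have h1 := @pieceC_ge0 R n i 0; have h2 := @etaC_ge0 R n i.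
  by apply: mulr_ge0; [rewrite /unifC; apply: addr_ge0 => //; nonneg|exact: exprn_ge0].
have K1 : 0 < unifC (n := n) (R := R) i * 2 ^+ (n + i) + 1 by rewrite ltr_wpDl.
have [p _ /(_ p (leqnn _)) /= hp] := near_infty_natSinv_lt (PosNum (divr_gt0 t0 K1)).
set w : R := p.+1%:R^-1 in hp; have w0 : 0 < w by rewrite invr_gt0.
have [k hk] := dh g _ (divr_gt0 w0 n2).
have gh y : `|g y - h k y| <= w / 2 ^+ n * `|y|.
  by apply: le_trans (dual_normP (g - h k) y) _; rewrite ler_wpM2r.
have [d d0 hd] : unif_le (subcst T (h k)) i (unifC (n := n) (R := R) i * (w * 2 ^+ (n + i))) a.
  apply: contrapT => nu; apply: nN; exists (k, p) => //; split => //; split => // y.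
  have [d d0 hd] := hg y w w0; exists (d / 2) => [|r q M r_gt0 rd tq qs qM].
    by rewrite divr_gt0.
  rewrite (slice_subcst a)//; apply: le_trans (ler_distD (g y * intg q) _ _) _.
  have rd1 : r < d by apply: le_lt_trans rd _; lra.
  rewrite addn0 addrC mulrDr !mulrDl mulr1; apply: lerD; last exact: hd.
  rewrite -mulrBl normrM.
  have := intg_norm_le (ccfun_test tq) qs (ltW r_gt0) (fun x => jet_le0 (qM x)).
  move=> /(ler_pM (normr_ge0 _) (normr_ge0 _) (gh y)) /le_trans; apply.
  by rewrite exprMn /= -/w le_eqVlt; apply/orP; left; apply/eqP; field; rewrite gt_eqF.
exists d => // r f r_gt0 rd tf fs fM.
have := hd r f r_gt0 rd tf fs fM; rewrite !appl_subcst// => h1.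
apply: le_trans (ler_distD (intg (fun x => h k (f x))) _ _) _.
have h2 : `|intg (fun x => h k (f x)) - intg (fun x => g (f x))| <= w * r ^+ n.
  rewrite -intgB; [|exact: dual_ccfun|exact: dual_ccfun].
  apply: le_trans (dual_intg_le (h k - g) (M := 1) r_gt0 tf fs (fun x => jet_le0 (fM x))) _.
  rewrite mulr1 exprMn mulrA ler_wpM2r ?exprn_ge0 ?(ltW r_gt0)// -ler_pdivlMr//.
  by apply: le_trans hk; rewrite -/(`|h k - g|) distrC.
apply: le_trans (lerD h1 h2) _; rewrite -mulrDl ler_wpM2r ?exprn_ge0 ?(ltW r_gt0)//.
rewrite (_ : _ + w = w * (unifC (n := n) i * 2 ^+ (n + i) + 1)); last by ring.
by rewrite -ler_pdivlMr// ltW.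
Qed.

End order_zero.

Section positive_order.
Context {R : realType} {n : nat} {Y : normedModType R}.
Notation V := 'rV[R]_n.
Notation mu := (@lebesgue_rV R n).
Notation test := (@test_function R n Y).
Variables (T : {linear testfun n Y -> R^o}) (i k : nat) (j r0 : R) (C : set V).
Hypothesis cC : compact C.
Hypothesis estC : forall b, C b -> est T i k j r0 b.
Hypothesis j_ge0 : 0 <= j.
Hypothesis r0_gt0 : 0 < r0.

Lemma ae_order_null : (0 < k)%N -> mu.-negligible (C `\` [set a | forall t, 0 < t ->
  exists2 d, 0 < d & forall r (f : V -> Y) M, 0 < r -> r < d -> f \in test -> supp_in f a r ->
    (forall x, jet_le i r M f x) -> `|appl T f| <= t * r ^+ (n + k) * M]).
Proof.
move=> k_gt0; apply: (negligibleS _ (ae_density_pt cC)) => a [Ca na]; split => // da;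
  apply: na => t t0.
have [d d0 hd] := density_estimate cC estC j_ge0 r0_gt0 Ca da t0.
exists d => // r f M r_gt0 rd tf fs fM.
have := hd r f M M r_gt0 rd tf fs fM (fun x => jet_le0 (fM x)).
by rewrite gtn_eqF// mul0r addr0.
Qed.

End positive_order.

(** * Pointwise differentiability *)

Section euclidean_norm.
Context {R : realType} {n : nat} {Y : normedModType R}.
Notation V := 'rV[R]_n.
Notation test := (@test_function R n Y).
Implicit Types (x v : V) (f : V -> Y) (phi : testfun n Y).

Lemma le_enorm x : `|x| <= enorm x.
Proof.
apply/rV_normP => [|i]; first exact: sqrtr_ge0.
rewrite -sqrtr_sqr; apply: ler_wsqrtr.
by rewrite (bigD1 i)//= lerDl; apply: sumr_ge0 => l _; exact: sqr_ge0.
Qed.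

Lemma enorm_le x : enorm x <= n%:R * `|x|.
Proof.
have h0 : 0 <= n%:R * `|x| by rewrite mulr_ge0.
rewrite -[leRHS]ger0_norm// -sqrtr_sqr; apply: ler_wsqrtr.
apply: le_trans (_ : _ <= \sum_(i < n) `|x| ^+ 2) _.
  apply: ler_sum => i _; rewrite -[x 0 i ^+ 2]real_normK ?num_real//.
  by rewrite lerXn2r ?nnegrE// rV_coord_le.
rewrite sumr_const card_ord -[leLHS]mulr_natl exprMn ler_wpM2r ?sqr_ge0// expr2.
by rewrite -natrM ler_nat; case: n => // m; rewrite leq_pmulr.
Qed.

Lemma enorm0 : enorm (0 : V) = 0.
Proof. by apply/eqP; rewrite -normr_le0 ger0_norm ?sqrtr_ge0// (le_trans (enorm_le 0))//
  normr0 mulr0. Qed.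

Lemma eball0_cube x : eball 0 1 x -> `|x| <= 1.
Proof. by rewrite /eball/= subr0 => /(le_trans (le_enorm x)). Qed.

Variable i : nat.

Lemma mlin_norm_le m phi x M : (m <= i)%N -> jet_le i 1 M phi x ->
  mlin_norm (derive_mlin (m := m) phi x) <= M.
Proof.
move=> mi h; apply: ge_sup.
  exists `|derive_mlin phi x [tuple (0 : V) | _ < m]|, [tuple (0 : V) | _ < m] => //= j.
  by rewrite tnth_mktuple enorm0.
move=> _ [vs /= hvs <-]; apply: h; first by rewrite size_tuple.
by move=> v /tnthP[j ->]; apply: le_trans (le_enorm _) (hvs j).
Qed.

Lemma nu_le phi M : 0 <= M -> (forall x, jet_le i 1 M phi x) -> nu_seminorm (eball 0 1) i phi <= M.
Proof.
move=> M0 h; apply: ge_sup.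
  exists (mlin_norm (derive_mlin (m := 0) phi 0)), 0%N => //; exists 0 => //.
  by rewrite /eball/= subr0 enorm0.
by move=> _ [m mi [x _ <-]]; apply: mlin_norm_le.
Qed.

(** Directions of sup norm at most [1 / n] have Euclidean norm at most [1]; dilating by [n] costs
    [n ^ i]. The seminorm controls only points of the ball, but off its support [phi] has zero
    jet. *)
Lemma nu_jet phi : (0 < n)%N -> testfun_in (eball 0 1) phi -> nu_seminorm (eball 0 1) i phi <= 1 ->
  forall x, jet_le i 1 (n%:R ^+ i) phi x.
Proof.
move=> n_gt0 phiK phi1 x; have n0 : 0 < n%:R :> R by rewrite ltr0n.
have tphi := testfunP phi.
suff h : jet_le i n%:R^-1 1 phi x.
  have := @jet_le_dilate _ _ _ i _ _ n%:R _ _ (test_smooth tphi) _ h.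
  by rewrite divff ?gt_eqF// mulr1; apply; rewrite ler1n.
have [xs|xs] := pselect (spt phi x); last first.
  by apply: (@jet_le_mono _ _ _ i i n%:R^-1 n%:R^-1 0) => //; exact: jet_le_notin_spt.
have [M hM] := test_jet i 1 tphi; have M0 := jet_le_ge0 (hM 0).
move=> vs vsi hvs.
have ev v : v \in vs -> enorm v <= 1.
  move=> /hvs vn; apply: le_trans (enorm_le v) _.
  by rewrite -ler_pdivlMl// mulr1.
apply: le_trans phi1; apply: le_trans (_ : _ <= mlin_norm (derive_mlin (m := size vs) phi x)) _.
  apply: ub_le_sup; last first.
    exists (in_tuple vs) => // l; apply: ev; exact: mem_tnth.
  exists M => _ [ws /= hws <-]; apply: hM; first by rewrite size_tuple.
  by move=> w /tnthP[l ->]; apply: le_trans (le_enorm _) (hws l).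
apply: ub_le_sup; last by exists (size vs); [rewrite /= ltnS|exists x => //; exact: phiK].
by exists M => _ [m mi [z _ <-]]; apply: mlin_norm_le.
Qed.

End euclidean_norm.

Section remainders.
Context {R : realType} {n : nat} {Y : normedModType R}.
Notation V := 'rV[R]_n.
Notation test := (@test_function R n Y).
Variable T : {linear testfun n Y -> R^o}.
Implicit Types (x v a : V) (f : V -> Y) (phi : testfun n Y) (P : V -> dual Y) (l : int).

Definition excess P f : R := appl T f - intg (fun x => P x (f x)).

Lemma remainder_excess P a r phi : 0 < r ->
  remainder T P a r phi = excess P (fun x => phi (r^-1 *: (x - a))).
Proof. by move=> r_gt0; rewrite /remainder /integral_dist rescaleE ?gt_eqF. Qed.

Lemma ccfun_sum (I : Type) (s : seq I) (p : pred I) (F : I -> V -> R) : (forall j, ccfun (F j)) ->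
  ccfun (fun x => \sum_(j <- s | p j) F j x).
Proof.
move=> cF; elim: s => [|j s IH].
  rewrite (_ : (fun x => _) = fun=> 0); last by apply/funext => x; rewrite big_nil.
  by split; [exact: cst_continuous|exists 0 => x; rewrite eqxx].
have [pj|pj] := boolP (p j).
  rewrite (_ : (fun x => _) = fun x => F j x + \sum_(j <- s | p j) F j x); first exact: ccfunD.
  by apply/funext => x; rewrite big_cons pj.
rewrite (_ : (fun x => _) = fun x => \sum_(j <- s | p j) F j x)//.
by apply/funext => x; rewrite big_cons (negbTE pj).
Qed.

Lemma monomial_continuous (b : 'I_n -> nat) : continuous (fun x : V => \prod_m x 0 m ^+ b m : R).
Proof.
elim: (index_enum _) => [|m s IH].
  rewrite (_ : (fun x => _) = cst 1); last by apply/funext => x; rewrite big_nil.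
  exact: cst_continuous.
rewrite (_ : (fun x => _) = fun x : V => x 0 m ^+ b m * \prod_(m <- s) x 0 m ^+ b m).
  move=> x; apply: (@continuousM _ _ (fun x : V => x 0 m ^+ b m : R)); last exact: IH.
  apply: (@continuous_comp _ _ _ (fun x : V => x 0 m : R) (fun t => t ^+ b m)).
    exact: coord_continuous.
  exact: exprn_continuous.
by apply/funext => x; rewrite big_cons.
Qed.

Lemma dual_sum (I : Type) (s : seq I) (p : pred I) (G : I -> dual Y) y :
  (\sum_(j <- s | p j) G j) y = \sum_(j <- s | p j) G j y.
Proof. by elim/big_rec2: _ => // j g c _ <-. Qed.

Lemma polyfun_ccfun l P f : polyfun l P -> f \in test -> ccfun (fun x => P x (f x)).
Proof.
move=> [c Pc] tf.
rewrite (_ : (fun x => _) = fun x => \sum_(b : {ffun 'I_n -> 'I_`|l|%N.+1} |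
    ((\sum_i b i)%N%:Z <= l)) (\prod_i x 0 i ^+ b i) * c b (f x)).
  apply: ccfun_sum => b; apply: ccfunM; first exact: dual_ccfun.
  exact: monomial_continuous.
by apply/funext => x; rewrite Pc dual_sum.
Qed.

Lemma excessZ l P f (c : R) : polyfun l P -> f \in test -> excess P (fun x => c *: f x) =
  c * excess P f.
Proof.
move=> pP tf; rewrite /excess applZ// mulrBr; congr (_ - _).
rewrite -intgZ; last exact: polyfun_ccfun pP tf.
by congr intg; apply/funext => x; rewrite linearZ.
Qed.

(** A function supported in a cube of radius [r] is, after rescaling by [q = n * r], supported in
    the Euclidean unit ball; dividing by [n ^ i * M] normalizes its seminorm. *)
Lemma excess_bound i k l P a (B d : R) : (0 < n)%N -> polyfun l P -> 0 <= B ->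
  (forall r phi, 0 < r -> r < d -> testfun_in (eball 0 1) phi ->
    nu_seminorm (eball 0 1) i phi <= 1 -> remainder T P a r phi <= B * r ^+ (n + k)) ->
  forall r f M, 0 < r -> r < d / n%:R -> f \in test -> supp_in f a r ->
    (forall x, jet_le i r M f x) ->
    `|excess P f| <= B * n%:R ^+ (n + k + i) * r ^+ (n + k) * M.
Proof.
move=> n_gt0 pP B0 h r f M r_gt0 rd tf fs fM.
have n0 : 0 < n%:R :> R by rewrite ltr0n.
have M0 := jet_le_ge0 (fM 0).
have [M_eq0|M_neq0] := eqVneq M 0.
  have -> : f = fun x => 0 *: f x.
    by apply/funext => x; rewrite scale0r; apply/eqP; rewrite -normr_le0 -M_eq0 (jet_le0 (fM x)).
  by rewrite (excessZ _ pP tf) mul0r normr0 M_eq0 mulr0.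
have M_gt0 : 0 < M by rewrite lt_def M_neq0.
pose q := n%:R * r; have q0 : 0 < q by rewrite mulr_gt0.
have qd : q < d by rewrite /q mulrC -ltr_pdivlMr.
have qM0 : 0 < n%:R ^+ i * M by rewrite mulr_gt0// exprn_gt0.
(* The hypothesis bounds values from above only; applying it with both signs of [c] bounds the
   absolute value. *)
have key c : `|c| = (n%:R ^+ i * M)^-1 -> c * excess P f <= B * q ^+ (n + k).
  move=> hc; pose F x := c *: f (q *: (x - (- (q^-1 *: a)))).
  have qx x : q *: (x - - (q^-1 *: a)) = q *: x + a.
    by rewrite opprK scalerDr scalerA divff ?gt_eqF// scale1r.
  have sf := test_smooth tf.
  have sF0 : smooth (fun x => f (q *: (x - (- (q^-1 *: a))))) by exact: smooth_affine.
  have Fs : supp_in F 0 n%:R^-1.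
    move=> x; rewrite /F qx subr0 => Fx.
    have /fs : f (q *: x + a) != 0 by apply: contraNneq Fx => ->; rewrite scaler0.
    rewrite addrK normrZ gtr0_norm// /q -mulrA mulrCA.
    by rewrite ger_pMr// mulrC -ler_pdivlMr// div1r.
  have tF : F \in test by apply: supp_in_testfun Fs; exact: smoothZ.
  have Fin : testfun_in (eball 0 1) (Testfun tF).
    move=> x /(spt_supp_in Fs); rewrite /cube /eball /= subr0 => xn.
    apply: le_trans (enorm_le x) _.
    by rewrite -ler_pdivlMl// mulr1.
  have Fnu : nu_seminorm (eball 0 1) i (Testfun tF) <= 1.
    apply: nu_le => // x.
    have : jet_le i 1 (`|c| * (n%:R ^+ i * M)) F x.
      apply: jet_leZ => //.
      apply: (@jet_le_affine _ _ _ i (n%:R * r)) => //; first by rewrite mulr1 gtr0_norm.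
      by apply: jet_le_dilate => //; rewrite ler1n.
    by rewrite hc mulVf// gt_eqF.
  have := h q (Testfun tF) q0 qd Fin Fnu.
  rewrite remainder_excess//= (_ : (fun x => F _) = fun x => c *: f x).
    by rewrite (excessZ _ pP tf).
  by apply/funext => x; rewrite /F qx scalerA divff ?gt_eqF// scale1r subrK.
have e : B * n%:R ^+ (n + k + i) * r ^+ (n + k) * M = B * q ^+ (n + k) * (n%:R ^+ i * M).
  by rewrite /q exprMn (exprD _ (n + k) i); ring.
rewrite e ler_norml; apply/andP; split.
  rewrite lerNl -ler_pdivrMr// mulrC mulrN -mulNr; apply: key.
  by rewrite normrN gtr0_norm// invr_gt0.
rewrite -ler_pdivrMr// mulrC; apply: key.
by rewrite gtr0_norm// invr_gt0.
Qed.

Lemma frac_bound i k a : (0 < n)%N ->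
  nu_ptdiff_frac (nu_seminorm (eball 0 1) i) T a (k%:Z - 1) 1 ->
  exists2 P, polyfun (k%:Z - 1) P & exists B d : R, [/\ 0 <= B, 0 < d &
    forall r f M, 0 < r -> r < d -> f \in test -> supp_in f a r ->
    (forall x, jet_le i r M f x) -> `|excess P f| <= B * r ^+ (n + k) * M].
Proof.
move=> n_gt0 [P pP]; rewrite /limf_esup => /ereal_inf_lt[_ [W FW <-] Wlt].
exists P => //.
set w : R -> R := fun r => r `^ (- (k%:Z - 1)%:~R - 1 - n%:R) in Wlt.
have [B0 [B00 hB]] : exists B : R, 0 <= B /\ forall r, W r ->
    (remainder_sup T P (nu_seminorm (eball 0 1) i) a w r <= B%:E)%E.
  suff [B [B0 hB]] : exists B : R, 0 <= B /\ (ereal_sup [set remainder_sup T P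
      (nu_seminorm (eball 0 1) i) a w r | r in W] <= B%:E)%E.
    by exists B; split => // r Wr; apply: le_trans hB; apply: ereal_sup_ubound; exists r.
  (* The supremum is below [+oo] but might be [-oo]; any nonnegative [B] serves then. *)
  move: Wlt; set S := ereal_sup _; case: S => [s| |] // _.
    by exists `|s|; split => //; rewrite lee_fin ler_norm.
  by exists 0; split => //; exact: leNye.
have [d /= d0 hd] := (nbhs_ballP _ _).1 FW.
have n0 : 0 < n%:R :> R by rewrite ltr0n.
exists (B0 * n%:R ^+ (n + k + i)), (d / n%:R); split.
- by rewrite mulr_ge0// exprn_ge0// ltW.
- by rewrite divr_gt0.
apply: (excess_bound n_gt0 pP B00) => r phi r_gt0 rd phiK phi1.
have Wr : W r.
  by apply: hd => //; rewrite -ball_normE /ball_/= sub0r normrN gtr0_norm.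
have : ((w r * remainder T P a r phi)%:E <= B0%:E)%E.
  by apply: le_trans (hB r Wr); apply: ereal_sup_ubound; exists phi.
rewrite /w lee_fin (_ : - _ - 1 - _ = - (n + k)%:R).
  by rewrite powRN powR_mulrn ?(ltW r_gt0)// mulrC ler_pdivrMr// exprn_gt0.
by rewrite intrB natrD; ring.
Qed.

Lemma cvg_right0P (F : R -> R) : F r @[r --> 0^'+] --> (0 : R) <->
  forall t, 0 < t -> exists2 d, 0 < d & forall r, 0 < r -> r < d -> `|F r| <= t.
Proof.
split => [h t t0|h].
  move/cvgrPdist_le: h => /(_ t t0) h1; have [d /= d0 hd] := (nbhs_ballP _ _).1 h1.
  exists d => // r r_gt0 rd; rewrite -normrN -sub0r; apply: hd => //.
  by rewrite -ball_normE /ball_/= sub0r normrN gtr0_norm.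
apply/cvgrPdist_le => t /h[d d0 hd]; apply/nbhs_ballP; exists d => // r.
by rewrite -ball_normE /ball_/= sub0r normrN => + r_gt0; rewrite gtr0_norm// => rd;
  rewrite sub0r normrN; exact: hd.
Qed.

Lemma exprz_sub_pos (r : R) (l : nat) : 0 < r -> r ^ (- l%:Z - n%:Z) = (r ^+ (n + l))^-1.
Proof. by move=> r_gt0; rewrite -opprD -PoszD addnC exprnN. Qed.

Lemma ptdiff_byP a (l : nat) P : ptdiff_by T a l%:Z P <-> polyfun l%:Z P /\
  forall phi t, 0 < t -> exists2 d, 0 < d & forall r, 0 < r -> r < d ->
    `|excess P (fun x => phi (r^-1 *: (x - a)))| <= t * r ^+ (n + l).
Proof.
split=> -[pP h]; split => // phi.
  move=> t t0; have [d d0 hd] := (cvg_right0P _).1 (h phi) t t0.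
  exists d => // r r_gt0 rd; have := hd r r_gt0 rd.
  rewrite remainder_excess// exprz_sub_pos// normrM gtr0_norm ?invr_gt0 ?exprn_gt0//.
  by rewrite ler_pdivrMl ?exprn_gt0// mulrC.
apply/cvg_right0P => t t0; have [d d0 hd] := h phi t t0.
exists d => // r r_gt0 rd; have := hd r r_gt0 rd.
rewrite remainder_excess// exprz_sub_pos// normrM gtr0_norm ?invr_gt0 ?exprn_gt0//.
by rewrite ler_pdivrMl ?exprn_gt0// mulrC.
Qed.

Lemma nu_ptdiff_intro i a (l : nat) P : (0 < n)%N -> polyfun l%:Z P ->
  (forall t, 0 < t -> exists2 d, 0 < d & forall r f, 0 < r -> r < d -> f \in test ->
    supp_in f a r -> (forall x, jet_le i r 1 f x) -> `|excess P f| <= t * r ^+ (n + l)) ->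
  nu_ptdiff (nu_seminorm (eball 0 1) i) T a l%:Z.
Proof.
move=> n_gt0 pP h; exists P => //; have n0 : 0 < n%:R :> R by rewrite ltr0n.
have ni0 : 0 < n%:R ^+ i :> R by rewrite exprn_gt0.
have bound t : 0 < t -> exists2 d, 0 < d & forall r phi, 0 < r -> r < d ->
    testfun_in (eball 0 1) phi -> nu_seminorm (eball 0 1) i phi <= 1 ->
    `|r ^ (- l%:Z - n%:Z) * remainder T P a r phi| <= t.
  move=> t0; have [d d0 hd] := h _ (divr_gt0 t0 ni0).
  exists d => // r phi r_gt0 rd phiK phi1.
  rewrite remainder_excess// exprz_sub_pos// normrM gtr0_norm ?invr_gt0 ?exprn_gt0//.
  rewrite ler_pdivrMl ?exprn_gt0//; set f := fun x => _.
  have tf : f \in test by exact: (dilate_test a r_gt0 (testfunP phi)).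
  have fs : supp_in f a r.
    rewrite -[r]mulr1; apply: dilate_supp => // x phix.
    by rewrite subr0; apply: eball0_cube; apply: phiK; exact: subset_closure.
  have fM x : jet_le i r (n%:R ^+ i) f x.
    rewrite -[r]mulr1; apply: dilate_jet => //; first exact: test_smooth (testfunP phi).
    exact: nu_jet.
  have := hd r (fun x => (n%:R ^+ i)^-1 *: f x) r_gt0 rd (testZ _ tf) _ _.
  rewrite (excessZ _ pP tf) normrM gtr0_norm ?invr_gt0// ler_pdivrMl//.
  rewrite (_ : _ * (t / _ * _) = r ^+ (n + l) * t); last by field; rewrite gt_eqF.
  apply.
    by move=> x fx; apply: fs; apply: contraNneq fx => ->; rewrite scaler0.
  move=> x; have := @jet_leZ _ _ _ i r _ (n%:R ^+ i)^-1 _ _ (test_smooth tf) (fM x).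
  by rewrite gtr0_norm ?invr_gt0// mulVf// gt_eqF.
set S := remainder_sup _ _ _ _ _.
(* The zero test function is admissible, so the supremum is nonnegative and the upper bound alone
   gives the limit. *)
have S0 r : 0 < r -> (0 <= S r)%E.
  move=> r_gt0; apply: le_ereal_sup_tmp; exists 0%E => //; exists 0.
    split; last by apply: le_trans ler01; apply: nu_le => // x vs _ _;
      rewrite iter_derive0 /cst normr0.
    move=> x; rewrite /spt (_ : [set _ | _] = set0) ?closure0//.
    by apply/seteqP; split => z //=; rewrite eqxx.
  rewrite remainder_excess// /excess appl0 (_ : (fun x => _) = fun=> 0) ?intg0 ?subrr ?mulr0//.
  by apply/funext => x; rewrite linear0.
have Sle t : 0 < t -> exists2 d, 0 < d & forall r, 0 < r -> r < d -> (S r <= t%:E)%E.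
  move=> /bound[d d0 hd]; exists d => // r r_gt0 rd; apply: ge_ereal_sup => _ [phi [phiK phi1] <-].
  by rewrite lee_fin; apply: le_trans (ler_norm _) _; exact: hd.
apply/fine_cvgP; split.
  have [d d0 hd] := Sle 1 ltr01.
  apply/nbhs_ballP; exists d => // r; rewrite -ball_normE /ball_/= sub0r normrN => + r_gt0;
    rewrite gtr0_norm// => rd.
  by rewrite fin_numE -ltey -ltNye (lt_le_trans _ (S0 r r_gt0))//
    (le_lt_trans (hd r r_gt0 rd))// ltry.
apply/cvg_right0P => t /Sle[d d0 hd]; exists d => // r r_gt0 rd.
have := hd r r_gt0 rd; have := S0 r r_gt0; rewrite /comp; case: (S r) => [s| |] //=.
by rewrite !lee_fin => s0 st; rewrite ger0_norm.
Qed.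

End remainders.

(** * Polynomials along rays from a point *)

Section ray_polynomials.
Context {R : realType} {n : nat} {Y : normedModType R}.
Notation V := 'rV[R]_n.
Notation test := (@test_function R n Y).
Notation stest := (@test_function R n R^o).
Implicit Types (a x : V) (y : Y) (Q : V -> dual Y).

Definition coef_cont (F : V -> {poly R}) := forall q, continuous (fun x => (F x)`_q : R).

Lemma sum_continuous (I : Type) (s : seq I) (p : pred I) (F : I -> V -> R) :
  (forall j, continuous (F j)) -> continuous (fun x => \sum_(j <- s | p j) F j x).
Proof.
move=> cF; elim: s => [|j s IH].
  rewrite (_ : (fun x => _) = cst 0); last by apply/funext => x; rewrite big_nil.
  exact: cst_continuous.
rewrite (_ : (fun x => _) = fun x => (if p j then F j x else 0) + \sum_(j <- s | p j) F j x).
  move=> x; apply: (@continuousD _ _ _ (fun x => if p j then F j x else 0)); last exact: IH.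
  by case: (p j); [exact: cF|exact: cst_continuous].
by apply/funext => x; rewrite big_cons; case: ifP => // _; rewrite add0r.
Qed.

Lemma coef_contM F G : coef_cont F -> coef_cont G -> coef_cont (fun x => F x * G x).
Proof.
move=> cF cG q; under eq_fun do rewrite coefM.
by apply: sum_continuous => m x; apply: (@continuousM _ _ _ (fun x => (G x)`_(q - m)));
  [exact: cF|exact: cG].
Qed.

Lemma coef_cont1 : coef_cont (fun=> 1).
Proof. by move=> q; exact: cst_continuous. Qed.

Lemma coef_cont_exp F m : coef_cont F -> coef_cont (fun x => F x ^+ m).
Proof.
move=> cF; elim: m => [|m IH]; first exact: coef_cont1.
by under eq_fun do rewrite exprS; exact: coef_contM.
Qed.

Lemma coef_cont_prod (I : Type) (s : seq I) (F : I -> V -> {poly R}) :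
  (forall j, coef_cont (F j)) -> coef_cont (fun x => \prod_(j <- s) F j x).
Proof.
move=> cF; elim: s => [|j s IH].
  by under eq_fun do rewrite big_nil; exact: coef_cont1.
by under eq_fun do rewrite big_cons; exact: coef_contM.
Qed.

Definition ray_mono a (b : 'I_n -> nat) x : {poly R} := \prod_m ((a 0 m)%:P + x 0 m *: 'X) ^+ b m.

Lemma coef_cont_mono a b : coef_cont (ray_mono a b).
Proof.
apply: coef_cont_prod => m; apply: coef_cont_exp => q.
under eq_fun do rewrite coefD coefC coefZ coefX.
move=> x; apply: (@continuousD _ _ _ (fun _ : V => (if q == 0%N then a 0 m else 0) : R)
    (fun x => x 0 m * (q == 1%N)%:R)); first exact: cst_continuous.
apply: (@continuousM _ _ (fun x : V => x 0 m : R) (fun _ : V => (q == 1%N)%:R));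
  last exact: cst_continuous.
exact: coord_continuous.
Qed.

Lemma size_ray_mono a b x : (size (ray_mono a b x) <= (\sum_m b m).+1)%N.
Proof.
rewrite /ray_mono; elim/big_rec2: _ => [|m s p _ IH]; first by rewrite size_poly1.
apply: leq_trans (size_polyMleq _ _) _.
have h : (size (((a 0 m)%:P + x 0 m *: 'X) ^+ b m)%R <= (b m).+1)%N.
  apply: leq_trans (size_poly_exp_leq _ _) _; rewrite ltnS -[leqRHS]mul1n leq_mul2r.
  apply/orP; right; rewrite -subn1 leq_subLR; apply: leq_trans (size_polyD _ _) _.
  rewrite geq_max (leq_trans (size_polyC_leq1 _))//=.
  by apply: leq_trans (size_scale_leq _ _) _; rewrite size_polyX.
by have := leq_add h IH; rewrite addSn addnS; case: (_ + _)%N => //= m'; rewrite !ltnS.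
Qed.

Lemma ray_mono_horner a b x (r : R) : (ray_mono a b x).[r] = \prod_m (a + r *: x) 0 m ^+ b m.
Proof.
rewrite /ray_mono horner_prod; apply: eq_bigr => m _.
by rewrite horner_exp hornerD hornerC hornerZ hornerX !mxE mulrC.
Qed.

(** Along each ray and in each direction [y] the polynomial becomes a polynomial in one real
    variable with coefficients continuous in [x]; further arguments compare powers of [r] and can
    forget multi-indices. *)
Lemma polyfun_ray (l : nat) Q a : polyfun l%:Z Q -> exists H : Y -> V -> {poly R},
  [/\ forall y x r, Q (a + r *: x) y = (H y x).[r], forall y x, (size (H y x) <= l.+1)%N,
      forall y, coef_cont (H y) & forall y x, H (- y) x = - H y x].
Proof.
move=> [c Qc]; exists (fun y x => \sum_(b : {ffun 'I_n -> 'I_`|l%:Z|%N.+1} |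
    ((\sum_i b i)%N%:Z <= l%:Z)) c b y *: ray_mono a (fun m => b m) x); split.
- move=> y x r; rewrite Qc dual_sum horner_sum; apply: eq_bigr => b _.
  by rewrite hornerZ ray_mono_horner mulrC.
- move=> y x; apply: leq_trans (size_sum _ _ _) _; apply/bigmax_leqP => b bl.
  apply: leq_trans (size_scale_leq _ _) _; apply: leq_trans (size_ray_mono _ _ _) _.
  by rewrite ltnS -lez_nat.
- move=> y q; under eq_fun do rewrite coef_sum.
  apply: sum_continuous => b; under eq_fun do rewrite coefZ.
  move=> x; apply: (@continuousM _ _ (fun _ : V => c b y : R)
    (fun x => (ray_mono a (fun m => b m) x)`_q)); first exact: cst_continuous.
  exact: coef_cont_mono.
- by move=> y x; rewrite -sumrN; apply: eq_bigr => b _; rewrite linearN scaleNr.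
Qed.

(* The lowest nonvanishing coefficient is detected by a bump centred where it does not vanish. *)
Lemma ray_coef_null (l M : nat) Q a (H : Y -> V -> {poly R}) : polyfun l%:Z Q ->
  (forall y x r, Q (a + r *: x) y = (H y x).[r]) -> (forall y x, (size (H y x) <= l.+1)%N) ->
  (forall y, coef_cont (H y)) -> (forall y x, H (- y) x = - H y x) ->
  (forall (p : V -> R^o) y t, p \in stest -> 0 < t -> exists2 d, 0 < d & forall r, 0 < r -> r < d ->
    `|intg (fun z => Q z (p (r^-1 *: (z - a)) *: y))| <= t * r ^+ (n + M)) ->
  forall q, (q <= M)%N -> forall y x, (H y x)`_q = 0.
Proof.
move=> pQ QH sH cH HN hQ; elim/ltn_ind => q IH qM.
(* Replacing [y] by [- y] changes the sign of the coefficient, so one inequality is enough. *)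
suff le0 y x0 : (H y x0)`_q <= 0.
  move=> y x; apply/eqP; rewrite eq_le le0 -oppr_le0 -coefN -HN; exact: le0.
rewrite leNgt; apply/negP => c00; set c0 := (H y x0)`_q in c00.
have ql : (q < l.+1)%N.
  by rewrite ltnNge; apply/negP => /(leq_trans (sH y x0))/leq_sizeP/(_ q (leqnn _)) h;
    rewrite /c0 h ltxx in c00.
have c20 : 0 < c0 / 2 by rewrite divr_gt0.
have c84 : c0 / 8 < c0 / 4 by move: c00; lra.
have hx := (cvgrPdist_le _ _).1 (cH y q x0) _ c20.
have [d1 /= d10 hd1] := (nbhs_ballP _ _).1 (hx _).
pose g x := \sum_(m < l.+1) `|(H y x)`_m|.
have cg : continuous g.
  apply: sum_continuous => m x; apply: (@continuous_comp _ _ _ (fun x => (H y x)`_m : R)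
    (fun t : R => `|t|)).
    exact: cH.
  exact: norm_continuous.
have [B gB] : exists B, forall x, `|x - x0| <= 1 -> g x <= B.
  have cgK : compact (g @` cube x0 1).
    by apply: continuous_compact; [exact: continuous_subspaceT|exact: compact_cube].
  have [B [Br hB]] := compact_bounded cgK.
  exists (`|B| + 1) => x xx0; apply: le_trans (ler_norm _) _; apply: hB; last by exists x.
  by rewrite (le_lt_trans (ler_norm _))// ltrDl.
have B0 : 0 <= B.
  by apply: le_trans (gB x0 _); [apply: sumr_ge0|rewrite subrr normr0].
pose e : R := Num.min (d1 / 2) 1.
have e0 : 0 < e by rewrite lt_min ltr01 divr_gt0.
have e1 : e <= 1 by rewrite ge_min lexx orbT.
have ed : e < d1 by rewrite gt_min; apply/orP; left; lra.
(* For small [r] the lowest term dominates: lower coefficients vanish by induction, and higher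
   powers contribute at most [B * r * r ^+ q]. *)
have low x r : `|x - x0| <= e -> 0 < r -> r <= 1 -> r * (B + 1) <= c0 / 4 ->
    c0 / 4 * r ^+ q <= (H y x).[r].
  move=> xe r_gt0 r1 rB; rewrite (horner_coef_wide _ (sH y x)) (bigD1 (Ordinal ql))//=.
  have rq0 : 0 <= r ^+ q by rewrite exprn_ge0// ltW.
  have h1 : c0 / 2 * r ^+ q <= (H y x)`_q * r ^+ q.
    rewrite ler_wpM2r//.
    have : `|c0 - (H y x)`_q| <= c0 / 2.
      by apply: hd1; rewrite mx_norm_ball /ball_/= distrC (le_lt_trans xe).
    by rewrite ler_norml => /andP[_]; lra.
  have h2 : `|\sum_(m < l.+1 | m != Ordinal ql) (H y x)`_m * r ^+ m| <= B * r * r ^+ q.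
    apply: le_trans (ler_norm_sum _ _ _) _.
    apply: le_trans (_ : _ <= \sum_(m < l.+1) `|(H y x)`_m| * (r * r ^+ q)) _.
      rewrite big_mkcond/=; apply: ler_sum => m _.
      have rr0 : 0 <= r * r ^+ q by rewrite mulr_ge0// ltW.
      case: ifPn => mq; last by rewrite mulr_ge0.
      rewrite normrM [X in _ * X]ger0_norm ?exprn_ge0 ?(ltW r_gt0)//.
      have [mq'|mq'] := ltnP m q.
        by rewrite IH// ?normr0 ?mul0r// (leq_trans (ltnW mq')).
      rewrite ler_wpM2l// -exprS; apply: ler_wiXn2l => //; first exact: ltW.
      by rewrite ltn_neqAle mq' andbT; apply: contraNneq mq => mq; apply/eqP/val_inj.
    rewrite -mulr_suml -mulrA; apply: ler_wpM2r; first by rewrite mulr_ge0// ltW.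
    by apply: gB; apply: le_trans xe e1.
  have h3 : B * r * r ^+ q <= c0 / 4 * r ^+ q.
    rewrite ler_wpM2r//; apply: le_trans rB; rewrite mulrDr mulr1 mulrC lerDl; exact: ltW.
  move: h1 h2 h3; rewrite ler_norml => + /andP[+ _].
  by move: (\sum_(_ < _ | _) _) ((H y x)`_q) (r ^+ q) => S A P; lra.
have [p [tp ps p0 p1]] := plateau_bump x0 e0.
have en0 : 0 < e ^+ n by rewrite exprn_gt0.
(* Half of the constant [c0 / 4 * e ^+ n] that the lower bound on the integral produces below, which
   gives the contradiction. *)
have t0 : 0 < c0 / 8 * e ^+ n by rewrite mulr_gt0// divr_gt0.
have [d d0 hd] := hQ p y _ tp t0.
have B1 : 0 < B + 1 by rewrite ltr_wpDl.
pose m0 : R := Num.min d (Num.min 1 (c0 / 4 / (B + 1))).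
have m00 : 0 < m0 by rewrite !lt_min d0 ltr01 !divr_gt0.
pose r := m0 / 2; have r_gt0 : 0 < r by rewrite divr_gt0.
have : r < m0 by rewrite /r; lra.
rewrite !lt_min => /andP[rd /andP[r1 rB]].
have rB' : r * (B + 1) <= c0 / 4 by rewrite -ler_pdivlMr// ltW.
pose F z := Q z (p (r^-1 *: (z - a)) *: y).
have zE z : z = a + r *: (r^-1 *: (z - a)).
  by rewrite scalerA divff ?gt_eqF// scale1r addrC subrK.
have FE z : F z = p (r^-1 *: (z - a)) * (H y (r^-1 *: (z - a))).[r].
  by rewrite /F linearZ -QH -zE.
have tpr := dilate_test a r_gt0 tp.
have cF : ccfun F by exact: (polyfun_ccfun pQ (test_scale_cst y tpr)).
have F0 z : 0 <= F z.
  rewrite FE; have [->|/ps xe] := eqVneq (p (r^-1 *: (z - a))) 0; first by rewrite mul0r.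
  rewrite mulr_ge0//; apply: le_trans (low _ _ xe r_gt0 (ltW r1) rB').
  by rewrite mulr_ge0 ?exprn_ge0 ?(ltW r_gt0)// divr_ge0// ltW.
have := @intg_ge_cubes R n _ [:: 0%N] (fun=> a + r *: x0) (fun=> r * e / 2)
  (fun=> c0 / 4 * r ^+ q) F cF F0.
rewrite big_seq1 => /(_ isT) h.
have {h} : c0 / 4 * r ^+ q * (2 * (r * e / 2)) ^+ n <= intg F.
  apply: h.
  - by move=> _ _; rewrite divr_ge0// mulr_ge0// ltW.
  - move=> _ z _; rewrite /cube/= => zx.
    have hz : `|r^-1 *: (z - a) - x0| <= e / 2.
      rewrite (_ : _ - x0 = r^-1 *: (z - (a + r *: x0))).
        rewrite normrZ gtr0_norm ?invr_gt0// ler_pdivrMl//.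
        by apply: le_trans zx _; rewrite mulrA.
      by rewrite opprD addrA [in RHS]scalerBr scalerA mulVf ?gt_eqF// scale1r.
    rewrite FE p1// mul1r; apply: low => //; last exact: ltW.
    by apply: le_trans hz _; lra.
  - by move=> l1 l2; rewrite !mem_seq1 => /eqP-> /eqP->; rewrite eqxx.
move=> h; have := le_trans (le_trans h (ler_norm _)) (hd r r_gt0 rd).
apply/negP; rewrite -ltNge.
have -> : c0 / 4 * r ^+ q * (2 * (r * e / 2)) ^+ n = c0 / 4 * e ^+ n * r ^+ (n + q).
  by rewrite exprD (_ : 2 * (r * e / 2) = r * e); [rewrite (exprMn n r e); ring|field].
apply: le_lt_trans (_ : _ <= c0 / 8 * e ^+ n * r ^+ (n + q)) _.
  rewrite ler_wpM2l ?(ltW t0)//; apply: ler_wiXn2l; [exact: ltW|exact: ltW|].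
  by rewrite leq_add2l.
by rewrite (ltr_pM2r (exprn_gt0 (n + q) r_gt0)) (ltr_pM2r en0).
Qed.

Lemma derive_ray (W : normedModType R) (g : V -> W) a x (k : R) (j : nat) (C : W) (s : R) :
  (forall s, g (a + s *: x) = (k * s ^+ j) *: C) ->
  'D_x g (a + s *: x) = (k * (j%:R * s ^+ j.-1)) *: C.
Proof.
move=> gE; pose p : R^o -> R^o := fun s => k * s ^+ j.
have dX : is_derive (s : R^o) (1 : R^o) p (k * (j%:R * s ^+ j.-1)).
  have h := @is_deriveZ R R^o R^o (fun s => s ^+ j) k s 1 (j%:R * s ^+ j.-1).
  apply: h; rewrite (_ : (fun s => s ^+ j) = (id : R^o -> R^o) ^+ j).
    have h := @is_deriveX R R^o id j s 1 1 (is_derive_id _ _).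
    by apply: (is_derive_eq h); rewrite /GRing.scale/= mulr1.
  by apply/funext => t; rewrite exprfctE.
transitivity ('D_(1 : R^o) (fun s : R^o => p s *: C) s).
  rewrite /derive.
  suff -> : (fun h : R => h^-1 *: (g (h *: x + (a + s *: x)) - g (a + s *: x))) =
      (fun h : R => h^-1 *: (p (h *: (1 : R^o) + s) *: C - p s *: C)) by [].
  apply/funext => h; rewrite /p -!gE; congr (_ *: (g _ - _)).
  by rewrite addrCA -scalerDl /GRing.scale/= mulr1.
rewrite derive_scaleM.
- by rewrite derive_cst scaler0 add0r derive_val.
- by apply/derivable1_diffP; exact: (@ex_derive _ _ _ _ _ _ _ dX).
- exact: differentiable_cst.
Qed.

(** For [q = m] and [s = 0] the value is [m!] times [C]: derivatives along the diagonal recover a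
    homogeneous polynomial, without polarization. *)
Lemma iter_derive_ray (W : normedModType R) (f : V -> W) a x (C : W) m :
  (forall s, f (a + s *: x) = s ^+ m *: C) -> forall q (s : R),
  iter_derive f (nseq q x) (a + s *: x) = ((m ^_ q)%:R * s ^+ (m - q)) *: C.
Proof.
move=> fE; elim=> [|q IH] s; first by rewrite /= ffactn0 subn0 mul1r.
rewrite /= (derive_ray _ IH) ffactnSr natrM subnS.
by congr (_ *: _); ring.
Qed.

End ray_polynomials.

(** * Vanishing derivatives *)

Section vanishing_derivatives.
Context {R : realType} {n : nat} {Y : normedModType R}.
Notation V := 'rV[R]_n.
Notation test := (@test_function R n Y).
Notation stest := (@test_function R n R^o).
Variables (T : {linear testfun n Y -> R^o}) (a : V).
Implicit Types (f : V -> Y) (P : V -> dual Y).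

Definition null_order (l : nat) := forall f t, f \in test -> 0 < t -> exists2 d, 0 < d &
  forall r, 0 < r -> r < d -> `|appl T (fun x => f (r^-1 *: (x - a)))| <= t * r ^+ (n + l).

Lemma excess0 f : excess T (fun=> 0) f = appl T f.
Proof. by rewrite /excess (_ : (fun x => _) = fun=> 0) ?intg0 ?subr0. Qed.

Lemma polyfun0 l : polyfun l ((fun=> 0) : V -> dual Y).
Proof. by exists (fun=> 0) => x; rewrite big1// => b _; rewrite scaler0. Qed.

Lemma polyfun_lt0 P : polyfun (-1) P -> P = fun=> 0.
Proof. by move=> [c Pc]; apply/funext => x; rewrite Pc big1. Qed.

Lemma polyfun_cst (g : dual Y) : polyfun 0 ((fun=> g) : V -> dual Y).
Proof.
exists (fun=> g) => x; rewrite (bigD1 [ffun=> ord0])/=; last first.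
  by rewrite big1// => m _; rewrite ffunE.
rewrite big1 => [|m _]; last by rewrite ffunE.
rewrite scale1r big1 ?addr0// => b /andP[_ /eqP]; case.
by apply/ffunP => m; rewrite ffunE; apply/val_inj; case: (b m) => -[].
Qed.

Lemma excess_null_coef (l m : nat) P : polyfun m%:Z P -> null_order l ->
  (forall f t, f \in test -> 0 < t -> exists2 d, 0 < d & forall r, 0 < r -> r < d ->
    `|excess T P (fun x => f (r^-1 *: (x - a)))| <= t * r ^+ (n + l)) ->
  forall (p : V -> R^o) y t, p \in stest -> 0 < t -> exists2 d, 0 < d & forall r, 0 < r -> r < d ->
    `|intg (fun z => P z (p (r^-1 *: (z - a)) *: y))| <= t * r ^+ (n + l).
Proof.
move=> pP nT eT p y t tp t0; have t20 : 0 < t / 2 by rewrite divr_gt0.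
have tpy := test_scale_cst y tp.
have [d d0 hd] := nT _ _ tpy t20; have [d' d'0 hd'] := eT _ _ tpy t20.
exists (Num.min d d') => [|r r_gt0]; first by rewrite lt_min d0.
rewrite lt_min => /andP[rd rd'].
set I := intg _; set A := appl T (fun x => p (r^-1 *: (x - a)) *: y).
have -> : I = A - (A - I) by rewrite subKr.
apply: le_trans (ler_normB _ _) _; rewrite [t]splitr mulrDl.
by apply: lerD; [exact: hd|exact: hd'].
Qed.

(** Since [T] already vanishes to order [m - 1], the coefficients of [P] below degree [m] along rays
    from [a] vanish. So [P] is homogeneous of degree [m] around [a], its [m]-th derivative there
    determines it, and [P = 0]. *)
Lemma null_orderS (m : nat) P : ptdiff_by T a m%:Z P ->
  derive_mlin P a = (fun _ : m.-tuple V => 0) -> ((0 < m)%N -> null_order m.-1) -> null_order m.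
Proof.
move=> /ptdiff_byP[pP hP] DP hm.
have [H [PH sH cH HN]] := polyfun_ray a pP.
have low q : (q < m)%N -> forall y x, (H y x)`_q = 0.
  move=> qm; have m0 : (0 < m)%N by exact: leq_ltn_trans qm.
  have qm1 : (q <= m.-1)%N by rewrite -ltnS prednK.
  apply: (ray_coef_null pP PH sH cH HN _ qm1).
  apply: (excess_null_coef pP (hm m0)) => f t tf t0.
  have [d d0 hd] := hP (Testfun tf) t t0.
  exists (Num.min d 1) => [|r r_gt0]; first by rewrite lt_min d0 ltr01.
  rewrite lt_min => /andP[rd r1]; apply: le_trans (hd r r_gt0 rd) _.
  rewrite ler_wpM2l ?(ltW t0)//; apply: ler_wiXn2l; [exact: ltW|exact: ltW|].
  by rewrite leq_add2l leq_pred.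
have Pray x (s : R) : P (a + s *: x) = s ^+ m *: P (a + x).
  have e y r : P (a + r *: x) y = (H y x)`_m * r ^+ m.
    rewrite PH (horner_coef_wide _ (sH y x)) big_ord_recr/= big1 ?add0r// => q _.
    by rewrite low ?mul0r.
  apply/val_inj/funext => y /=.
  rewrite -[RHS]/(s ^+ m * P (a + x) y) e -[x in a + x]scale1r e.
  by rewrite expr1n mulr1 mulrC.
have P0 : P = fun=> 0.
  apply/funext => z; have := iter_derive_ray (Pray (z - a)) m 0.
  rewrite scale0r addr0 subnn expr0 mulr1 [a + _]addrC subrK.
  have -> : iter_derive P (nseq m (z - a)) a = 0.
    by have := congr1 (fun h => h [tuple of nseq m (z - a)]) DP.
  move=> /esym/eqP; rewrite scaler_eq0 pnatr_eq0 ffactnn.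
  by rewrite eqn0Ngt fact_gt0/= => /eqP.
move=> f t tf t0; have [d d0 hd] := hP (Testfun tf) t t0.
by exists d => // r r_gt0 rd; have := hd r r_gt0 rd; rewrite P0 excess0.
Qed.

(** The polynomial of the hypothesis has degree at most [k - 1], while [T] vanishes to order [k - 1]
    and the remainder is of order [r ^ (n + k)]. All its coefficients along rays are therefore zero,
    and the estimate holds for [T] itself. *)
Lemma frac_est i k : (0 < n)%N ->
  nu_ptdiff_frac (nu_seminorm (eball 0 1) i) T a (k%:Z - 1) 1 ->
  (forall m, (m < k)%N -> is_ptD T a (fun _ : m.-tuple V => 0)) ->
  exists B d : R, [/\ 0 <= B, 0 < d &
    forall r f M, 0 < r -> r < d -> f \in test -> supp_in f a r ->
    (forall x, jet_le i r M f x) -> `|appl T f| <= B * r ^+ (n + k) * M].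
Proof.
move=> n_gt0 /(frac_bound n_gt0)[P pP [B [d [B0 d0 hd]]]] hm.
have nT m : (m < k)%N -> null_order m.
  elim: m => [|m IH] mk; have [Q QT DQ] := hm _ mk; first exact: null_orderS QT DQ _.
  by apply: null_orderS QT DQ _ => _; apply: IH; exact: ltnW.
exists B, d; split => // r f M r_gt0 rd tf fs fM.
suff P0 : P = fun=> 0 by have := hd r f M r_gt0 rd tf fs fM; rewrite P0 excess0.
(* For [k = 0] the degree is at most [-1], and the polynomial is zero by definition. *)
case: k pP hd hm nT => [|k] pP hd hm nT; first by apply: polyfun_lt0; rewrite sub0r in pP.
have {}pP : polyfun k%:Z P by move: pP; rewrite -addn1 PoszD addrK.
have [H [PH sH cH HN]] := polyfun_ray a pP.
have low q : (q <= k)%N -> forall y x, (H y x)`_q = 0.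
  apply: (ray_coef_null pP PH sH cH HN).
  apply: (excess_null_coef pP (nT k (ltnSn k))) => g t tg t0.
  have [s s0 gs] := test_supp_in tg; have [N gN] := test_jet i s tg.
  have N0 := jet_le_ge0 (gN 0).
  pose K := B * s ^+ (n + k.+1) * N; have K0 : 0 <= K by rewrite /K !mulr_ge0// exprn_ge0// ltW.
  exists (Num.min (d / s) (t / (K + 1))) => [|q0 q_gt0].
    by rewrite lt_min !divr_gt0// ltr_wpDl.
  rewrite lt_min ltr_pdivlMr// => /andP[qd qt].
  have := hd (q0 * s) _ N (mulr_gt0 q_gt0 s0) qd (dilate_test a q_gt0 tg) (dilate_supp q_gt0 gs)
    (dilate_jet a q_gt0 (test_smooth tg) gN).
  move=> /le_trans; apply; rewrite exprMn addnS exprS.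
  have -> : B * (q0 * q0 ^+ (n + k) * s ^+ (n + k).+1) * N = K * q0 * q0 ^+ (n + k).
    by rewrite /K addnS; ring.
  rewrite ler_wpM2r ?exprn_ge0 ?(ltW q_gt0)//.
  apply: le_trans (ler_wpM2l K0 (ltW qt)) _.
  exact: mul_div_succ_le K0 (ltW t0).
apply/funext => z; apply/val_inj/funext => y /=.
rewrite -[z](subrK a) addrC -[z - a]scale1r PH (horner_coef_wide _ (sH y _)) big1// => q _.
by rewrite low ?mul0r// -ltnS.
Qed.

End vanishing_derivatives.

Section conclusions.
Context {R : realType} {n : nat} {Y : normedModType R}.
Notation V := 'rV[R]_n.
Notation test := (@test_function R n Y).
Variables (T : {linear testfun n Y -> R^o}) (a : V) (i k : nat).
Hypothesis n_gt0 : (0 < n)%N.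

Lemma ptdiff_cst (g : dual Y) : (forall f, f \in test -> null_at (subcst T g) a f) -> ptdiff T a 0.
Proof.
move=> h; exists (fun=> g); apply/(@ptdiff_byP _ _ _ T a 0); split; first exact: polyfun_cst.
move=> phi t t0; have [d d0 hd] := h phi (testfunP phi) t t0.
exists d => // r r_gt0 rd; rewrite addn0; have := hd r r_gt0 rd.
by rewrite appl_subcst//; exact: dilate_test (testfunP phi).
Qed.

Lemma nu_ptdiff_cst (g : dual Y) : (forall t, 0 < t -> unif_le (subcst T g) i t a) ->
  nu_ptdiff (nu_seminorm (eball 0 1) i) T a 0.
Proof.
move=> h; apply: (@nu_ptdiff_intro _ _ _ T i a 0 (fun=> g) n_gt0 (polyfun_cst g)) => t t0.
have [d d0 hd] := h t t0; exists d => // r f r_gt0 rd tf fs fM; rewrite addn0.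
by have := hd r f r_gt0 rd tf fs fM; rewrite appl_subcst.
Qed.

Hypothesis nullT : forall t, 0 < t -> exists2 d, 0 < d & forall r (f : V -> Y) M, 0 < r -> r < d ->
  f \in test -> supp_in f a r -> (forall x, jet_le i r M f x) -> `|appl T f| <=
    t * r ^+ (n + k) * M.

Lemma ptdiff_by_null : ptdiff_by T a k%:Z (fun=> 0).
Proof.
apply/ptdiff_byP; split; first exact: polyfun0.
move=> phi t t0; have tphi := testfunP phi.
have [s s0 gs] := test_supp_in tphi; have [N gN] := test_jet i s tphi.
have N0 := jet_le_ge0 (gN 0).
pose K := s ^+ (n + k) * N; have K0 : 0 <= K by rewrite mulr_ge0// exprn_ge0// ltW.
have tK : 0 < t / (K + 1) by rewrite divr_gt0// ltr_wpDl.
have [d d0 hd] := nullT tK; exists (d / s) => [|r r_gt0]; first by rewrite divr_gt0.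
rewrite ltr_pdivlMr// excess0 => rd.
have := hd (r * s) _ N (mulr_gt0 r_gt0 s0) rd (dilate_test a r_gt0 tphi) (dilate_supp r_gt0 gs)
  (dilate_jet a r_gt0 (test_smooth tphi) gN).
move=> /le_trans; apply; rewrite exprMn.
have -> : t / (K + 1) * (r ^+ (n + k) * s ^+ (n + k)) * N = K * (t / (K + 1)) * r ^+ (n + k).
  by rewrite /K; ring.
by rewrite ler_wpM2r ?exprn_ge0 ?(ltW r_gt0)//; exact: mul_div_succ_le K0 (ltW t0).
Qed.

Lemma nu_ptdiff_null : nu_ptdiff (nu_seminorm (eball 0 1) i) T a k%:Z.
Proof.
apply: (nu_ptdiff_intro n_gt0 (polyfun0 k%:Z)) => t t0.
have [d d0 hd] := nullT t0; exists d => // r f r_gt0 rd tf fs fM.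
by rewrite excess0 -[leRHS]mulr1; exact: hd.
Qed.

Lemma is_ptD_null : is_ptD T a (fun _ : k.-tuple V => 0).
Proof.
exists (fun=> 0); first exact: ptdiff_by_null.
by apply/funext => vs; rewrite /derive_mlin iter_derive0.
Qed.

End conclusions.

Theorem theoremF (R : realType) (n i k : nat) (Y : completeNormedModType R)
    (T : {linear testfun n Y -> R^o})
    (n_gt0 : (0 < n)%N) (Y_separable : separable_space Y)
    (T_continuous : continuous T) :
  let nu := nu_seminorm (eball 0 1) i in
  let A := [set a : 'rV[R]_n | nu_ptdiff_frac nu T a (k%:Z - 1) 1 /\
    forall m, (m < k)%N -> is_ptD T a (fun _ : m.-tuple 'rV[R]_n => 0)] in
  {ae lebesgue_rV n, forall a, A a ->
    [/\ ptdiff T a k%:Z,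
        (0 < k)%N \/ separable_space (dual Y) -> nu_ptdiff nu T a k%:Z &
        (0 < k)%N -> is_ptD T a (fun _ : k.-tuple 'rV[R]_n => 0)]}.
Proof.
move=> nu A.
pose Good a := [/\ ptdiff T a k%:Z, (0 < k)%N \/ separable_space (dual Y) -> nu_ptdiff nu T a k%:Z &
  (0 < k)%N -> is_ptD T a (fun _ : k.-tuple 'rV[R]_n => 0)].
(* A single natural number bounds the constant, the inverse radius and the location of [a], so that
   the closures of the [E p] are countably many compact sets covering [A]. *)
pose E p := [set a : 'rV[R]_n | cube 0 p%:R a /\ est T i k p%:R (p.+1%:R^-1) a].
pose C p := closure (E p).
have cC p : compact (C p).
  apply: (@subclosed_compact _ _ (cube 0 p%:R)); first exact: closed_closure.
    exact: compact_cube.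
  by rewrite /C closureE; apply: smallest_sub; [exact: closed_cube|move=> a []].
pose j p : R := p%:R * 2 ^+ (n + k + i); pose r0 p : R := p.+1%:R^-1 / 2.
have j0 p : 0 <= j p by rewrite mulr_ge0// exprn_ge0.
have r00 p : 0 < r0 p by rewrite divr_gt0// invr_gt0.
have estC p b : C p b -> est T i k (j p) (r0 p) b.
  move=> Cb; apply: est_closure; move: b Cb; rewrite -/(_ `<=` _).
  by apply: closureS => a [].
have AC a : A a -> exists p, C p a.
  move=> [fa ha]; have [B [d [B0 d0 hd]]] := frac_est n_gt0 fa ha.
  have [q _ /(_ q (leqnn _)) /= qd] := near_infty_natSinv_lt (PosNum d0).
  exists (maxn q (maxn (Num.bound B) (Num.bound `|a|))); apply: subset_closure; split.
    rewrite /cube/= subr0; apply: le_trans (ltW (archi_boundP (normr_ge0 a))) _.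
    by rewrite ler_nat !leq_max leqnn !orbT.
  move=> r f M r_gt0 rp tf fs fM.
  have rd : r < d.
    apply: le_lt_trans rp _; apply: le_lt_trans qd; rewrite lef_pV2 ?posrE//.
    by rewrite ler_nat ltnS leq_max leqnn.
  apply: le_trans (hd r f M r_gt0 rd tf fs fM) _.
  rewrite ler_wpM2r ?(jet_le_ge0 (fM 0))// ler_wpM2r ?exprn_ge0 ?(ltW r_gt0)//.
  apply: le_trans (ltW (archi_boundP B0)) _.
  by rewrite ler_nat !leq_max leqnn !orbT.
suff CG p : (lebesgue_rV n).-negligible (C p `\` [set a | Good a]).
  apply: (negligibleS _ (negligible_bigcup_countable CG)) => a /= /not_implyP[/AC[p Cp] nG].
  by exists p.
have [k0|] := posnP k; last first.
  move=> k_gt0; apply: (negligibleS _ (ae_order_null (cC p) (@estC p) (j0 p) (r00 p) k_gt0)).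
  move=> a [Ca nG]; split => // h; apply: nG; split.
  - by exists (fun=> 0); exact: (ptdiff_by_null h).
  - by move=> _; exact: (nu_ptdiff_null n_gt0 h).
  - by move=> _; exact: is_ptD_null h.
move: (@estC p); rewrite k0 => estCp.
pose N1 := C p `\` [set a | exists g, forall f, f \in @test_function R n Y ->
  null_at (subcst T g) a f].
pose N2 := C p `\` [set a | exists g, forall t, 0 < t -> unif_le (subcst T g) i t a].
have n1 : (lebesgue_rV n).-negligible N1 by exact: (ae_null_at (cC p) estCp (j0 p) (r00 p)).
have [sD|nD] := pselect (separable_space (dual Y)).
  have n2 : (lebesgue_rV n).-negligible N2.
    exact: (ae_unif_le_subcst (cC p) estCp (j0 p) (r00 p)).
  apply: (negligibleS _ (negligibleU n1 n2)) => a [Ca nG].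
  have [[g hg]|] := pselect (exists g, forall f, f \in @test_function R n Y ->
    null_at (subcst T g) a f); last by left.
  right; split => // -[g' hg']; apply: nG; rewrite /Good k0; split => //;
    first exact: ptdiff_cst hg.
  by move=> _; exact: (nu_ptdiff_cst n_gt0 hg').
apply: (negligibleS _ n1) => a [Ca nG]; split => // -[g hg]; apply: nG;
  rewrite /Good k0; split => //.
  exact: ptdiff_cst hg.
by case.
Qed.
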